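(* Let $1<p<\infty$, let $g,V:\mathbb{R}^d\to\mathbb{R}$ be continuous, and assume that $g$ is Lipschitz continuous on $\mathbb{R}^d$, $\inf V>-\infty$, and $V(x)=O(|x|^p)$ as $|x|\to\infty$. Define $\mathcal{G}(\mu)=\int_{\mathbb{R}^d}g\,d\mu$ and $\mathcal{V}(\mu)=\int_{\mathbb{R}^d}V\,d\mu$ for $\mu\in\mathcal{M}_p$. Let $$u(x,t)=\inf\left\{g(\gamma(0))+\int_0^t\left(\tfrac1p|\dot\gamma(s)|^p-V(\gamma(s))\right)ds:\ \gamma\in AC_p([0,t];\mathbb{R}^d),\ \gamma(t)=x\right\}$$ and $$\mathcal{U}(\mu,t)=\inf\left\{\mathcal{G}(\sigma(0))+\int_0^t\left(\tfrac1p\|\dot\sigma(s)\|^p-\mathcal{V}(\sigma(s))\right)ds:\ \sigma\in AC_p([0,t],\mathcal{M}_p),\ \sigma(t)=\mu\right\}.$$ Then there is $T=T(V,p)>0$ for which: (i) $\displaystyle\mathcal{U}(\mu,t)=\int_{\mathbb{R}^d}u(x,t)\,d\mu(x)$ for all $(\mu,t)\in\mathcal{M}_p\times[0,T)$; (ii) for each $t\in(0,T)$ there is a Borel map $\Psi:\mathbb{R}^d\times[0,t]\to\mathbb{R}^d$ such that for each $x\in\mathbb{R}^d$ the path $s\mapsto\Psi(x,s)$ is a minimizer for $u(x,t)$, and, for every $\mu\in\mathcal{M}_p$, the path $\sigma(s):=\Psi(\cdot,s)_{\#}\mu$, $s\in[0,t]$, is a minimizing path for $\mathcal{U}(\mu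,t)$.
   Context: $\mathcal{M}_p$ is the set of Borel probability measures on $\mathbb{R}^d$ with finite $p$-th moment, endowed with the $p$-Wasserstein metric $W_p$ (cost $|x-y|^p$). $AC_p([0,t];\mathbb{R}^d)$ is the set of absolutely continuous $\gamma:[0,t]\to\mathbb{R}^d$ with $\dot\gamma\in L^p([0,t];\mathbb{R}^d)$. $AC_p([0,t],\mathcal{M}_p)$ is the set of paths $\sigma:[0,t]\to\mathcal{M}_p$ for which there is $h\in L^p([0,t])$ with $W_p(\sigma(s_1),\sigma(s_2))\le\int_{s_1}^{s_2}h(u)\,du$ for all $0\le s_1\le s_2\le t$; the (a.e.) smallest such $h$ is denoted $\|\dot\sigma\|$ (metric derivative). A minimizer for $u(x,t)$ (respectively a minimizing path for $\mathcal{U}(\mu,t)$) is an admissible path attaining the infimum in the definition. $f_{\#}\mu$ denotes the push-forward of $\mu$ by $f$. *)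

(* Defs.v *)
From HB Require Import structures.
From mathcomp Require Import all_boot all_order all_algebra.
From mathcomp Require Import all_classical all_reals all_analysis.

Set Implicit Arguments.
Unset Strict Implicit.
Unset Printing Implicit Defensive.

Import Order.TTheory GRing.Theory Num.Theory.
Import numFieldNormedType.Exports.

Local Open Scope classical_set_scope.
Local Open Scope ring_scope.

(* The canonical norm on 'rV[R]_d is the sup norm; it induces the usual
   topology, but |x| in the costs and the action is the Euclidean norm. *)
Definition enorm (R : realType) (d : nat) (x : 'rV[R]_d) : R :=
  Num.sqrt (\sum_(i < d) x ord0 i ^+ 2).

(* 'rV[R]_d equipped with its Borel sigma-algebra. *)
Notation borelRd R d := (g_sigma_algebraType (@open 'rV[R]_d)).

(* Elements of probability T R are set functions defined on all subsets of T,
   with unspecified values on non-measurable ones, so two of them are the same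
   measure when they agree on the measurable sets. *)
Definition same_measure d (T : measurableType d) (R : realType)
    (mu nu : set T -> \bar R) : Prop :=
  forall A : set T, measurable A -> mu A = nu A.

Section spaces_of_paths.
Variables (R : realType) (d : nat) (p : R).
Local Notation leb := (@lebesgue_measure R).
Local Notation prob := (probability (borelRd R d) R).

Definition Lp_on (t : R) (h : R -> R) : Prop :=
  measurable_fun `[0, t] h /\
  (\int[leb]_(s in `[0%R, t]) (`|h s| `^ p)%:E < +oo)%E.

Definition abs_continuous (t : R) (gamma : R -> 'rV[R]_d) : Prop :=
  forall e : R, 0 < e -> exists2 delta : R, 0 < delta &
    forall (n : nat) (a b : 'I_n -> R),
      (forall i, [/\ 0 <= a i, a i <= b i & b i <= t]) ->
      trivIset [set: 'I_n] (fun i => `]a i, b i[%classic) ->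
      \sum_(i < n) (b i - a i) < delta ->
      \sum_(i < n) enorm (gamma (b i) - gamma (a i)) < e.

(* A path on [0, t] is a total function on R of which only the restriction to
   [0, t] matters: an absolutely continuous path is differentiable at almost
   every point of ]0, t[, and derive1 is only ever integrated. *)
Definition ACp (t : R) (gamma : R -> 'rV[R]_d) : Prop :=
  [/\ abs_continuous t gamma,
      measurable_fun `[0, t] (derive1 gamma : R -> borelRd R d) &
      Lp_on t (fun s => enorm (derive1 gamma s))].

Definition Mp (mu : prob) : Prop :=
  (\int[mu]_x (enorm x `^ p)%:E < +oo)%E.

Definition coupling (mu nu : prob)
    (pi : probability (borelRd R d * borelRd R d)%type R) : Prop :=
  same_measure (fun A => pi (A `*` setT)) mu /\
  same_measure (fun B => pi (setT `*` B)) nu.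

Definition wasserstein (mu nu : prob) : \bar R :=
  (ereal_inf [set (\int[pi]_z (enorm (z.1 - z.2 : 'rV[R]_d) `^ p)%:E)%E
             | pi in coupling mu nu] `^ p^-1)%E.

Definition speed_bound (t : R) (sigma : R -> prob) (h : R -> R) : Prop :=
  Lp_on t h /\
  forall s1 s2 : R, 0 <= s1 -> s1 <= s2 -> s2 <= t ->
    (wasserstein (sigma s1) (sigma s2) <=
     \int[leb]_(r in `[s1, s2]) (h r)%:E)%E.

Definition ACp_Mp (t : R) (sigma : R -> prob) : Prop :=
  (forall s : R, 0 <= s <= t -> Mp (sigma s)) /\
  exists h : R -> R, speed_bound t sigma h.

Definition is_metric_derivative (t : R) (sigma : R -> prob) (h : R -> R) :
    Prop :=
  speed_bound t sigma h /\
  forall k : R -> R, speed_bound t sigma k ->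
    {ae leb, forall s, 0 <= s <= t -> h s <= k s}.

(* Unique up to equality a.e. on [0, t]; a representative is chosen. *)
Definition metric_derivative (t : R) (sigma : R -> prob) : R -> R :=
  xget (fun=> 0) [set h | is_metric_derivative t sigma h].

End spaces_of_paths.

Section value_functions.
Variables (R : realType) (d : nat) (p : R) (g V : 'rV[R]_d -> R).
Local Notation leb := (@lebesgue_measure R).
Local Notation prob := (probability (borelRd R d) R).

Definition admissible (x : 'rV[R]_d) (t : R) (gamma : R -> 'rV[R]_d) : Prop :=
  ACp p t gamma /\ gamma t = x.

Definition action (t : R) (gamma : R -> 'rV[R]_d) : \bar R :=
  ((g (gamma 0))%:E + \int[leb]_(s in `[0%R, t])
     (p^-1 * enorm (derive1 gamma s) `^ p - V (gamma s))%:E)%E.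

Definition value (x : 'rV[R]_d) (t : R) : \bar R :=
  ereal_inf [set action t gamma | gamma in admissible x t].

Definition minimizer (x : 'rV[R]_d) (t : R) (gamma : R -> 'rV[R]_d) : Prop :=
  admissible x t gamma /\ action t gamma = value x t.

(* \mathcal{G} and \mathcal{V} are [potential g] and [potential V]. *)
Definition potential (f : 'rV[R]_d -> R) (mu : prob) : \bar R :=
  (\int[mu]_x (f x)%:E)%E.

Definition admissible_Mp (mu : prob) (t : R) (sigma : R -> prob) : Prop :=
  ACp_Mp p t sigma /\ same_measure (sigma t) mu.

Definition action_Mp (t : R) (sigma : R -> prob) : \bar R :=
  (potential g (sigma 0%R) + \int[leb]_(s in `[0%R, t])
     ((p^-1 * metric_derivative p t sigma s `^ p)%:E
      - potential V (sigma s)))%E.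

Definition value_Mp (mu : prob) (t : R) : \bar R :=
  ereal_inf [set action_Mp t sigma | sigma in admissible_Mp mu t].

Definition minimizing_path (mu : prob) (t : R) (sigma : R -> prob) : Prop :=
  admissible_Mp mu t sigma /\ action_Mp t sigma = value_Mp mu t.

End value_functions.

Definition lipschitz_continuous (R : realType) (d : nat) (f : 'rV[R]_d -> R) :
    Prop :=
  exists L : R, forall x y, `|f x - f y| <= L * enorm (x - y).

(* f(x) = O(|x|^p) as |x| -> +oo *)
Definition bigO_power (R : realType) (d : nat) (p : R) (f : 'rV[R]_d -> R) :
    Prop :=
  exists C M : R, forall x, M <= enorm x -> `|f x| <= C * enorm x `^ p.

(* Main.v *)
Require Import Defs.
From HB Require Import structures.
From mathcomp Require Import all_boot all_order all_algebra.
From mathcomp Require Import all_classical all_reals all_analysis.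
From mathcomp Require Import measurable_realfun giry ring lra.

Set Implicit Arguments.
Unset Strict Implicit.
Unset Printing Implicit Defensive.

Import Order.TTheory GRing.Theory Num.Theory.
Import numFieldNormedType.Exports.

Local Open Scope classical_set_scope.
Local Open Scope ring_scope.

(** Lower bound. Minimizing over concatenations with a segment gives the dynamic
    programming inequality
      u(y, s+h) <= u(x, s) + |x-y|^p / (p h^(p-1)) - \int V along the segment.
    Integrated against an almost optimal coupling of sigma(s) and sigma(s+h), it
    shows that s |-> \int u(., s) dsigma(s) grows at rate at most
    |sigma'|^p / p - V(sigma), up to an arbitrarily small error near each time;
    continuous induction on [0, t] then gives \int u(., t) dmu <= U(mu, t),
    without representing sigma as a superposition of curves.
    Upper bound. As V grows at most like |x|^p, the action is coercive for short
    times, so u(x, t) has minimizers, of energy O(1 + |x|^p). A lexicographic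
    choice among them is Borel in x, and moving mu along the chosen paths has
    metric derivative at most the L^p(mu) mean of their speeds, hence action at
    most \int u(., t) dmu. *)

(** * The Euclidean norm and Borel measurability *)

Section euclidean_norm.
Context {R : realType} {d : nat}.
Implicit Types (x y z : 'rV[R]_d).

(** The energy of a path is handled through the sums of [|gamma b - gamma a|^p / (b - a)^(p - 1)]
    over finite families of nonoverlapping intervals. Their supremum is the integral of
    [|gamma'|^p], yet each sum sees finitely many values of the path: lower semicontinuity under
    pointwise convergence, compactness by Tychonoff and the energy of a concatenation are read off
    from it. The horizon [T] balances the potential against the energy. The integral of [V] along a
    path of energy [E] is at most [K 2^p T^p E] plus a term in the endpoint, and [T] makes this
    coefficient at most [1 / (4p)]. The cost [g] grows linearly and is absorbed at any horizon, so
    [T] does not depend on it. In the lower bound [V] is merely continuous and unbounded, and its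
    means under two nearby measures must be compared. The modulus of continuity of [V] is based at
    one end of the transport, so that only the tails of one fixed measure enter near each time;
    slopes are then estimated on short intervals that have this time as an endpoint. *)

Lemma sum_sqr_ge0 x : 0 <= \sum_(i < d) x ord0 i ^+ 2.
Proof. by apply: sumr_ge0 => i _; exact: sqr_ge0. Qed.

Lemma enorm_ge0 x : 0 <= enorm x.
Proof. exact: sqrtr_ge0. Qed.

Lemma sqr_enorm x : enorm x ^+ 2 = \sum_(i < d) x ord0 i ^+ 2.
Proof. by rewrite sqr_sqrtr// sum_sqr_ge0. Qed.

Lemma enormZ (a : R) x : enorm (a *: x) = `|a| * enorm x.
Proof.
rewrite /enorm -sqrtr_sqr -sqrtrM ?sqr_ge0// mulr_sumr.
by congr Num.sqrt; apply: eq_bigr => i _; rewrite mxE exprMn.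
Qed.

Lemma enorm0 : enorm (0 : 'rV[R]_d) = 0.
Proof. by rewrite -[X in enorm X](scale0r 0) enormZ normr0 mul0r. Qed.

Lemma enormN x : enorm (- x) = enorm x.
Proof. by rewrite -scaleN1r enormZ normrN normr1 mul1r. Qed.

Lemma enormB x y : enorm (x - y) = enorm (y - x).
Proof. by rewrite -enormN opprB. Qed.

(** Cauchy-Schwarz by the discriminant argument: [|a x - b y|^2] is nonnegative for all [a] and [b].
    When the product [D] is positive, [a = D] and [b = |x|^2] give the bound if [x] is nonzero, and
    [a = (|y|^2 + 1) / D] with [b = 1] excludes [x = 0]. *)
Lemma dot_le_enorm x y :
  \sum_(i < d) x ord0 i * y ord0 i <= enorm x * enorm y.
Proof.
set D := (X in X <= _).
have expand (a b : R) : 0 <= a ^+ 2 * enorm x ^+ 2 - 2 * a * b * D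
    + b ^+ 2 * enorm y ^+ 2.
  rewrite !sqr_enorm /D !mulr_sumr -sumrB -big_split/=.
  apply: sumr_ge0 => i _.
  rewrite (_ : _ + _ = (a * x ord0 i - b * y ord0 i) ^+ 2) ?sqr_ge0//.
  ring.
have x0 := enorm_ge0 x; have y0 := enorm_ge0 y.
have [D0|D0] := leP D 0; first by rewrite (le_trans D0)// mulr_ge0.
have := expand ((enorm y ^+ 2 + 1) / D) 1.
have := expand D (enorm x ^+ 2).
move: (enorm x) (enorm y) x0 y0 => u v u0 v0 {expand} h2 h3.
rewrite -(ler_pXn2r (ltn0Sn 1)) ?nnegrE ?mulr_ge0//; last exact: ltW.
have [u00|u00] := eqVneq u 0.
  exfalso; have := h3; rewrite u00 expr0n/= mulr0 sub0r.
  have -> : 2 * ((v ^+ 2 + 1) / D) * 1 * D = 2 * (v ^+ 2 + 1).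
    by rewrite mulr1 -mulrA mulfVK// gt_eqF.
  by rewrite expr1n mul1r; have := sqr_ge0 v; lra.
have {}u0 : 0 < u ^+ 2 by rewrite exprn_gt0// lt_neqAle eq_sym u00.
by rewrite exprMn; nra.
Qed.

Lemma enormD x y : enorm (x + y) <= enorm x + enorm y.
Proof.
rewrite -(ler_pXn2r (ltn0Sn 1)) ?nnegrE ?addr_ge0 ?enorm_ge0//.
rewrite sqrrD !sqr_enorm.
have -> : \sum_(i < d) (x + y) ord0 i ^+ 2 =
    \sum_(i < d) x ord0 i ^+ 2 + (\sum_(i < d) x ord0 i * y ord0 i) *+ 2
    + \sum_(i < d) y ord0 i ^+ 2.
  rewrite -sumrMnl -!big_split/=; apply: eq_bigr => i _.
  by rewrite mxE sqrrD.
by have := dot_le_enorm x y; lra.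
Qed.

Lemma enorm_triangle z x y : enorm (x - y) <= enorm (x - z) + enorm (z - y).
Proof. by rewrite (le_trans _ (enormD _ _))// addrA subrK. Qed.

Lemma coord_le_enorm x i : `|x ord0 i| <= enorm x.
Proof.
rewrite -sqrtr_sqr ler_wsqrtr//.
by rewrite (bigD1 i)//= lerDl sumr_ge0// => j _; exact: sqr_ge0.
Qed.

Lemma enorm_le_sum x : enorm x <= \sum_(i < d) `|x ord0 i|.
Proof.
rewrite -(ler_pXn2r (ltn0Sn 1)) ?nnegrE ?enorm_ge0 ?sumr_ge0//.
rewrite sqr_enorm expr2 mulr_suml; apply: ler_sum => i _.
rewrite -real_normK ?num_real// expr2 ler_wpM2l//.
by rewrite (bigD1 i)//= lerDl sumr_ge0.
Qed.

Lemma norm_le_enorm x : `|x| <= enorm x.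
Proof.
rewrite [leLHS]/Num.norm/= mx_normrE; apply/bigmax_leP; split; first exact: enorm_ge0.
by move=> [i j] _ /=; rewrite ord1; exact: coord_le_enorm.
Qed.

Lemma coord_le_norm x i : `|x ord0 i| <= `|x|.
Proof.
by rewrite [leRHS]/Num.norm/= mx_normrE; apply/bigmax_geP; right; exists (ord0, i).
Qed.

Lemma enorm_le_norm x : enorm x <= d%:R * `|x|.
Proof.
rewrite (le_trans (enorm_le_sum x))//.
rewrite mulr_natl -[X in _ *+ X](card_ord d) -sumr_const.
by apply: ler_sum => i _; exact: coord_le_norm.
Qed.

Lemma enorm_eq0 x : enorm x = 0 -> x = 0.
Proof.
by move=> x0; apply/normr0_eq0/le_anti; rewrite normr_ge0 -x0 norm_le_enorm.
Qed.

Lemma enorm_lip x y : `|enorm x - enorm y| <= enorm (x - y).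
Proof.
rewrite ler_norml; apply/andP; split.
  rewrite lerBrDr addrC lerBlDr enormB addrC.
  by rewrite (le_trans _ (enormD _ _))// subrK.
by rewrite lerBlDr (le_trans _ (enormD _ _))// subrK.
Qed.

Lemma lipschitz_enorm_continuous (f : 'rV[R]_d -> R) (C : R) :
  (forall x y, `|f x - f y| <= C * enorm (x - y)) -> continuous f.
Proof.
move=> fC x; apply/(@cvgrPdist_lt _ _ _ (nbhs x)) => e e0.
(* [C] may be negative and [d] may be zero; the absolute value and the added [1] give a positive
   Lipschitz constant for the sup norm. *)
have C0 : 0 < `|C| * d%:R + 1 by rewrite ltr_wpDl// mulr_ge0.
near=> y.
rewrite (le_lt_trans (fC _ _))//.
rewrite (le_lt_trans (y := (`|C| * d%:R + 1) * `|x - y|))//.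
  rewrite (le_trans (ler_wpM2r (enorm_ge0 _) (ler_norm C)))//.
  rewrite (le_trans (ler_wpM2l (normr_ge0 _) (enorm_le_norm _)))//.
  by rewrite mulrA ler_wpM2r// lerDl.
rewrite -ltr_pdivlMl// mulrC.
near: y; apply/nbhs_ballP; exists (e / (`|C| * d%:R + 1)); first exact: divr_gt0.
by move=> z; rewrite mx_norm_ball.
Unshelve. all: by end_near. Qed.

Lemma enorm_continuous : continuous (@enorm R d).
Proof.
by apply: (@lipschitz_enorm_continuous _ 1) => x y; rewrite mul1r enorm_lip.
Qed.

End euclidean_norm.

Section borel_rV.
Context {R : realType} {d : nat}.
Local Notation borel := (borelRd R d).

Lemma open_measurable_rV (U : set 'rV[R]_d) :
  open U -> measurable (U : set borel).
Proof. exact: sub_sigma_algebra. Qed.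

Lemma continuous_measurable_rV (f : 'rV[R]_d -> R) :
  continuous f -> measurable_fun setT (f : borel -> R).
Proof.
move=> /continuousP cf; apply: (measurability _ (measurable_realfun.RGenOpens.measurableE R)).
move=> _ [_ [a [b ->] <-]]; rewrite setTI; apply: open_measurable_rV.
exact/cf/interval_open.
Qed.

Lemma measurable_coord (i : 'I_d) :
  measurable_fun setT (fun x : borel => (x : 'rV[R]_d) ord0 i).
Proof. by apply: continuous_measurable_rV => x; exact: coord_continuous. Qed.

Lemma measurable_enorm : measurable_fun setT (@enorm R d : borel -> R).
Proof. by apply: continuous_measurable_rV; exact: enorm_continuous. Qed.

(* An open set is the union of the rational open boxes that it contains. *)
Lemma measurable_fun_rV d' (T : measurableType d') (D : set T) (f : T -> borel) :
  (forall i, measurable_fun D (fun x => (f x : 'rV[R]_d) ord0 i)) ->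
  measurable_fun D f.
Proof.
move=> mf mD; apply: (@measurability _ _ _ _ D f (@open 'rV[R]_d)) => //.
move=> _ [U oU <-].
pose box (q : {ffun 'I_d -> rat * rat}) : set 'rV[R]_d :=
  [set x | forall i, ratr (q i).1 < x ord0 i < ratr (q i).2].
have -> : U = \bigcup_(q in [set q | box q `<=` U]) box q.
  apply/seteqP; split => [x Ux|x [q qU qx]]; last exact: qU.
  move: oU; rewrite openE => /(_ _ Ux)/nbhs_ballP[e /= e0 eU].
  have H i : exists q : rat * rat,
      [/\ x ord0 i - e < ratr q.1, ratr q.1 < x ord0 i,
        x ord0 i < ratr q.2 & ratr q.2 < x ord0 i + e].
    have [|q1] := @rat_in_itvoo R (x ord0 i - e) (x ord0 i); first by lra.
    have [|q2] := @rat_in_itvoo R (x ord0 i) (x ord0 i + e); first by lra.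
    by rewrite !in_itv/= => /andP[? ?] /andP[? ?]; exists (q1, q2).
  have [q Hq] := choice H.
  exists [ffun i => q i]; last first.
    by move=> i; rewrite ffunE; case: (Hq i) => _ -> ->.
  move=> y /= hy; apply: eU; rewrite mx_norm_ball /ball_/=.
  rewrite [ltLHS]/Num.norm/= mx_normrE; apply/bigmax_ltP; split => //.
  move=> [k i] _ /=; rewrite ord1 !mxE ltr_distl.
  have := hy i; rewrite ffunE => /andP[h1 h2].
  by case: (Hq i) => *; apply/andP; split; lra.
rewrite preimage_bigcup setI_bigcupr bigcup_mkcond.
apply: countable_bigcupT_measurable; first exact: countableP.
move=> q; case: ifPn => // _.
rewrite (_ : _ `&` _ = D `&` \bigcap_(i in [set: 'I_d])
    (D `&` (fun x => (f x : 'rV[R]_d) ord0 i) @^-1`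
      `](ratr (q i).1), (ratr (q i).2)[%classic)); last first.
  apply/seteqP; split => [x [Dx bx]|x [Dx bx]]; split => // i.
    by move=> _; split => //=; rewrite in_itv/=; exact: bx.
  by have [_] := bx i I; rewrite /= in_itv.
apply: measurableI => //; apply: fin_bigcap_measurable => // i _.
exact: mf.
Qed.

End borel_rV.

(** * Power inequalities *)

Section powR_inequalities.
Context {R : realType} (p : R).
Hypothesis p1 : 1 < p.

Let p0 : 0 < p. Proof. exact: lt_trans p1. Qed.

(** Convexity: the graph of [y^p] lies above its tangent at [m]. This is Young's inequality for [y]
    and [m^(p - 1)], whose exponents are [p] and [p / (p - 1)]. *)
Lemma powR_tangent (y m : R) : 0 <= y -> 0 <= m ->
  p * (y * m `^ (p - 1)) <= y `^ p + (p - 1) * m `^ p.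
Proof.
move=> y0 m0.
have q0 : 0 < p / (p - 1) by rewrite divr_gt0// subr_gt0.
have := @conjugate_powR _ y (m `^ (p - 1)) p (p / (p - 1)) y0 (powR_ge0 _ _) p0 q0.
have -> : p^-1 + (p / (p - 1))^-1 = 1.
  by rewrite invf_div -{1}(div1r p) -mulrDl subrKC divff// gt_eqF.
move=> /(_ erefl).
rewrite -powRrM mulrCA divff ?mulr1; last by rewrite gt_eqF// subr_gt0.
rewrite -(ler_pM2l p0) => /le_trans; apply.
rewrite mulrDr mulrCA divff ?mulr1; last by rewrite gt_eqF.
by rewrite lerD2l invf_div mulrCA [X in _ * X]mulrCA divff ?gt_eqF// mulr1 mulrC.
Qed.

(** The tangent inequality for [a / w] at [c], multiplied by [w]. Summed or integrated at a single
    slope [c], the quotient of the totals of [a] and [w], it yields the Jensen inequalities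
    below. *)
Lemma powR_weighted_tangent (a w c : R) : 0 <= a -> 0 < w -> 0 <= c ->
  p * c `^ (p - 1) * a <= w `^ (1 - p) * a `^ p + (p - 1) * c `^ p * w.
Proof.
move=> a0 w0 c0; have := powR_tangent (divr_ge0 a0 (ltW w0)) c0.
rewrite -(ler_pM2l w0).
have -> : w * (p * (a / w * c `^ (p - 1))) = p * c `^ (p - 1) * a.
  by field; rewrite gt_eqF.
move=> /le_trans; apply; rewrite mulrDr (mulrC w (_ * _)) lerD2r.
rewrite powRM ?invr_ge0// ?(ltW w0)// mulrCA -powR_inv1 ?(ltW w0)// -powRrM mulN1r.
rewrite mulrC [leRHS]mulrC -{1}(powRr1 (ltW w0)) -powRD ?(gt_eqF w0) ?implybT//.
by rewrite mulrC.
Qed.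

(** Above [M], [y = y^(1 - p) y^p] and the exponent [1 - p] is negative. A large [M] makes the
    coefficient of [y^p] as small as desired: this is the form in which energies absorb first powers
    of increments. *)
Lemma powR_le_linear (M y : R) : 0 < M -> 0 <= y -> y <= M + M `^ (1 - p) * y `^ p.
Proof.
move=> M0 y0; have [yM|My] := leP y M.
  by rewrite (le_trans yM)// lerDl mulr_ge0// powR_ge0.
rewrite (@le_trans _ _ (M `^ (1 - p) * y `^ p))//; last by rewrite lerDr ltW.
have yE : y = y `^ (1 - p) * y `^ p.
  by rewrite -powRD ?subrK ?powRr1// (gt_eqF (lt_trans M0 My)) implybT.
rewrite {1}yE ler_wpM2r ?powR_ge0//.
rewrite -(opprB p 1) !powRN lef_pV2 ?posrE ?powR_gt0 ?(lt_trans M0 My)//.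
by apply: ge0_ler_powR; rewrite ?nnegrE ?subr_ge0 ?(ltW p1) ?(ltW M0)//; exact: ltW.
Qed.

Lemma powRD_le (a b : R) : 0 <= a -> 0 <= b ->
  (a + b) `^ p <= 2 `^ p * (a `^ p + b `^ p).
Proof.
move=> a0 b0; wlog ab : a b a0 b0 / a <= b.
  have [ab /(_ a b)|/ltW ba /(_ b a)] := leP a b; first by apply.
  by rewrite addrC (addrC (b `^ p)); apply.
rewrite (@le_trans _ _ ((2 * b) `^ p))//.
  by apply: ge0_ler_powR; rewrite ?nnegrE ?(ltW p0) ?addr_ge0 ?mulr_ge0//; lra.
by rewrite powRM// ler_wpM2l ?powR_ge0// lerDr powR_ge0.
Qed.

(** The function [w^(1 - p) a^p] is jointly convex and homogeneous of degree one, hence subadditive.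
    Three terms serve the triangle inequality for the Wasserstein distance, whose middle term is a
    gluing error. *)
Lemma powR3_le (a1 a2 a3 w1 w2 w3 : R) : 0 <= a1 -> 0 <= a2 -> 0 <= a3 ->
  0 < w1 -> 0 < w2 -> 0 < w3 ->
  (a1 + a2 + a3) `^ p <= (w1 + w2 + w3) `^ (p - 1) *
    (w1 `^ (1 - p) * a1 `^ p + w2 `^ (1 - p) * a2 `^ p + w3 `^ (1 - p) * a3 `^ p).
Proof.
move=> a10 a20 a30 w10 w20 w30.
set A := a1 + _ + _; set W := w1 + _ + _; set S := _ + _ + _.
have W0 : 0 < W by rewrite /W; lra.
have A0 : 0 <= A by rewrite /A; lra.
pose c := A / W; have c0 : 0 <= c by rewrite divr_ge0// ltW.
have h1 := powR_weighted_tangent a10 w10 c0.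
have h2 := powR_weighted_tangent a20 w20 c0.
have h3 := powR_weighted_tangent a30 w30 c0.
have cS : c `^ p * W <= S.
  have cA : c `^ (p - 1) * A = c `^ p * W.
    rewrite -(mulr_powRB1 c0 p0) mulrAC mulrC; congr (_ * _).
    by rewrite /c mulfVK ?gt_eqF.
  have : p * (c `^ (p - 1) * A) <= S + (p - 1) * (c `^ p * W).
    by rewrite /S /A /W; lra.
  by rewrite cA; lra.
have -> : A `^ p = W `^ (p - 1) * (c `^ p * W).
  rewrite mulrC -mulrA mulr_powRB1 ?(ltW W0)// -powRM ?(ltW W0)//.
  by rewrite /c mulfVK// gt_eqF.
by rewrite ler_wpM2l// powR_ge0.
Qed.

(** Weight [1] gives Hölder's inequality over an interval; a weight adapted to [f] gives Minkowski's
    integral inequality after a further integration. *)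
Lemma weighted_jensen d (T : measurableType d) (mu : {measure set T -> \bar R})
    (D : set T) (f w : T -> R) (W : R) :
  measurable D -> measurable_fun D f -> measurable_fun D w ->
  (forall x, D x -> 0 <= f x) -> (forall x, D x -> 0 < w x) ->
  0 < W -> (\int[mu]_(x in D) (w x)%:E = W%:E)%E ->
  ((\int[mu]_(x in D) (f x)%:E) `^ p <= (W `^ (p - 1))%:E *
    \int[mu]_(x in D) (w x `^ (1 - p) * f x `^ p)%:E)%E.
Proof.
move=> mD mf mw f0 w0 W0 intw.
set S := (\int[mu]_(x in D) (w x `^ (1 - p) * f x `^ p)%:E)%E.
have mS : measurable_fun D (fun x => w x `^ (1 - p) * f x `^ p).
  by apply: measurable_funM; exact: (measurableT_comp (measurable_powR _)).
have S0 : (0 <= S)%E.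
  by apply: integral_ge0 => x Dx; rewrite lee_fin mulr_ge0// powR_ge0.
have key (c : R) : 0 <= c ->
    ((p * c `^ (p - 1))%:E * \int[mu]_(x in D) (f x)%:E <=
      S + ((p - 1) * c `^ p)%:E * W%:E)%E.
  move=> c0.
  have k1 : 0 <= p * c `^ (p - 1) by rewrite mulr_ge0 ?powR_ge0// ltW.
  have k2 : 0 <= (p - 1) * c `^ p by rewrite mulr_ge0 ?powR_ge0// subr_ge0 ltW.
  have w0' x : D x -> 0 <= w x by move=> /w0/ltW.
  rewrite -ge0_integralZl//; last exact/measurable_EFinP.
  rewrite -intw -ge0_integralZl//; last exact/measurable_EFinP.
  rewrite -ge0_integralD//; last 4 first.
  - by move=> x Dx; rewrite lee_fin mulr_ge0// powR_ge0.
  - exact/measurable_EFinP.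
  - by move=> x Dx; rewrite -EFinM lee_fin mulr_ge0// w0'.
  - by apply/measurable_EFinP; exact: measurable_funM.
  apply: ge0_le_integral => //.
  - move=> x Dx; rewrite -EFinM lee_fin !mulr_ge0 ?powR_ge0 ?f0//; exact: ltW.
  - by apply/measurable_EFinP; exact: measurable_funM.
  - by apply/measurable_EFinP; apply: measurable_funD => //; exact: measurable_funM.
  - move=> x Dx; rewrite -!EFinM -EFinD lee_fin.
    by apply: powR_weighted_tangent; [exact: f0|exact: w0|].
have [->|Sfin] := eqVneq S +oo%E.
  by rewrite gt0_muley ?leey// lte_fin powR_gt0.
have {}Sfin : S \is a fin_num by rewrite ge0_fin_numE// ltey.
have f0' : (0 <= \int[mu]_(x in D) (f x)%:E)%E.
  by apply: integral_ge0 => x Dx; rewrite lee_fin f0.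
have ffin : (\int[mu]_(x in D) (f x)%:E)%E \is a fin_num.
  rewrite ge0_fin_numE//.
  (* The tangent at slope [1] bounds the integral of [f] by [S] and [W], so it is finite. *)
  have := key 1 ler01; rewrite !powR1 !mulr1 => h.
  rewrite -(@lte_pmul2l _ p%:E) ?lte_fin//.
  rewrite gt0_muley ?lte_fin// (le_lt_trans h)//.
  by rewrite -(fineK Sfin) -EFinM -EFinD ltry.
move: key f0'; rewrite -(fineK ffin) -(fineK Sfin).
set A := fine _; set s := fine _ => key; rewrite lee_fin => A0.
rewrite poweR_EFin -EFinM lee_fin.
(* The quotient of the totals is the optimal tangent point, at which [key] becomes the claim. *)
pose c := A / W; have c0 : 0 <= c by rewrite divr_ge0// ltW.
have := key c c0; rewrite -!EFinM -EFinD lee_fin.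
have cA : c `^ (p - 1) * A = c `^ p * W.
  rewrite -(mulr_powRB1 c0 p0) mulrAC mulrC; congr (_ * _).
  by rewrite /c mulfVK ?gt_eqF.
rewrite -!mulrA cA => h.
have -> : A `^ p = W `^ (p - 1) * (c `^ p * W).
  rewrite mulrC -mulrA mulr_powRB1 ?(ltW W0)// -powRM ?(ltW W0)//.
  by rewrite /c mulfVK// gt_eqF.
by rewrite ler_wpM2l// ?powR_ge0//; lra.
Qed.

End powR_inequalities.

(** * Absolutely continuous functions *)

Section interval_families.
Context {R : realType}.
Implicit Types (F G : R -> R) (s : seq (R * R)).

(** Families are lists, so that an interval can be replaced by the list of pieces of a partition.
    Intervals may touch, and degenerate ones are allowed. *)
Definition itv_family (t : R) s :=
  all (fun I => [&& 0 <= I.1, I.1 <= I.2 & I.2 <= t]) s &&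
  pairwise (fun I J => (I.2 <= J.1) || (J.2 <= I.1)) s.

Definition total_length s := \sum_(I <- s) (I.2 - I.1).

Definition oscillation F s := \sum_(I <- s) `|F I.2 - F I.1|.

Definition ac_on (t : R) F := forall e : R, 0 < e -> exists2 delta : R, 0 < delta &
  forall s, itv_family t s -> total_length s < delta -> oscillation F s <= e.

Lemma itv_family_cons t I s : itv_family t (I :: s) =
  [&& [&& 0 <= I.1, I.1 <= I.2 & I.2 <= t],
    all (fun J => (I.2 <= J.1) || (J.2 <= I.1)) s & itv_family t s].
Proof. by rewrite /itv_family/= -!andbA; do !bool_congr. Qed.

Lemma itv_family_cat t s1 s2 : itv_family t (s1 ++ s2) =
  [&& allrel (fun I J => (I.2 <= J.1) || (J.2 <= I.1)) s1 s2,
      itv_family t s1 & itv_family t s2].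
Proof.
rewrite /itv_family all_cat pairwise_cat.
by case: (all _ s1); case: (all _ s2); case: allrel; rewrite ?andbF.
Qed.

Lemma itv_family_catC t s1 s2 : itv_family t (s1 ++ s2) = itv_family t (s2 ++ s1).
Proof.
rewrite !itv_family_cat; congr andb; last by rewrite andbC.
rewrite allrelC; apply: eq_allrel => I J; by rewrite orbC.
Qed.

Definition partition_itvs (a : R) (l : seq R) := zip (a :: l) l.

Lemma partition_itvsP t a l : path <%R a l -> 0 <= a -> last a l <= t ->
  itv_family t (partition_itvs a l) /\
  all (fun I => (a <= I.1) && (I.2 <= last a l)) (partition_itvs a l).
Proof.
elim: l a => [//|x l ih] a /= /andP[ax pl] a0 lt.
have [] := ih x pl (le_trans a0 (ltW ax)) lt => f al.
have xl : x <= last x l.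
  elim: l x pl {ih ax lt f al} => //= y l ih x /andP[xy yl].
  by rewrite (le_trans (ltW xy))// ih.
rewrite /partition_itvs/= -/(partition_itvs x l) itv_family_cons/= a0 (ltW ax) f andbT lexx xl/=.
split.
  rewrite (le_trans xl)//=; apply: sub_all al => I /andP[-> _] //.
by apply: sub_all al => I /andP[/(le_trans (ltW ax)) -> ->].
Qed.

Lemma total_length_partition a l : total_length (partition_itvs a l) = last a l - a.
Proof.
elim: l a => [|x l ih] a /=; first by rewrite /total_length/= big_nil subrr.
by rewrite /total_length big_cons/= -/(total_length _) ih; lra.
Qed.

Lemma oscillation_partition F a b l : itv_partition a b l ->
  oscillation F (partition_itvs a l) = variation a b F l.
Proof.
move=> abl; rewrite variation_zip// /oscillation /partition_itvs.
elim: l a {abl} => [|x l ih] a; first by rewrite !big_nil.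
by rewrite !big_cons/= -ih.
Qed.

Lemma total_length_cat s1 s2 :
  total_length (s1 ++ s2) = total_length s1 + total_length s2.
Proof. by rewrite /total_length big_cat. Qed.

Lemma oscillation_cat F s1 s2 :
  oscillation F (s1 ++ s2) = oscillation F s1 + oscillation F s2.
Proof. by rewrite /oscillation big_cat. Qed.

(** The condition of absolute continuity passes from [F] to its variation function. By induction on
    [s1], an arbitrary partition of the head interval is moved into [s2], and the supremum over
    these partitions is then taken; this is why total variations and oscillations appear in one
    sum. *)
Lemma total_variation_family t F (e delta : R) :
  (forall s, itv_family t s -> total_length s < delta -> oscillation F s <= e) ->
  forall s1 s2, itv_family t (s1 ++ s2) -> total_length (s1 ++ s2) < delta ->
  (\sum_(I <- s1) total_variation I.1 I.2 F + (oscillation F s2)%:E <= e%:E)%E.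
Proof.
move=> H; elim=> [|I s1 ih] s2 fs ls; first by rewrite big_nil add0e lee_fin H.
move: fs; rewrite /= itv_family_cons => /and3P[/and3P[I0 I12 It] dI fs].
have ls' : total_length (s1 ++ s2) < delta.
  by move: ls; rewrite /= /total_length big_cons; lra.
rewrite big_cons -addeA.
have X0 : (0 <= \sum_(J <- s1) total_variation J.1 J.2 F + (oscillation F s2)%:E)%E.
  rewrite adde_ge0 ?lee_fin ?sumr_ge0//; move: fs; rewrite itv_family_cat.
  move=> /and3P[_ /andP[/allP s1P _] _]; rewrite big_seq; apply: sume_ge0 => J /s1P.
  by move=> /and3P[_ J12 _]; exact: total_variation_ge0.
have Xe := ih _ fs ls'.
have Xfin : (\sum_(J <- s1) total_variation J.1 J.2 F + (oscillation F s2)%:E)%E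
    \is a fin_num by rewrite ge0_fin_numE// (le_lt_trans Xe)// ltry.
rewrite addeC -leeBrDl//; apply: ge_ereal_sup => _ [_ [l pl <-] <-].
rewrite leeBrDl//.
have [fl al] : itv_family t (partition_itvs I.1 l) /\
    all (fun J => (I.1 <= J.1) && (J.2 <= I.2)) (partition_itvs I.1 l).
  by case: pl => pl /eqP lI; rewrite -lI; apply: partition_itvsP => //; rewrite lI.
rewrite -(oscillation_partition F pl) -addeA -EFinD -oscillation_cat.
rewrite ih//.
- rewrite catA itv_family_catC catA.
  rewrite -catA itv_family_cat fs fl !andbT.
  apply/allrelP => J K /(allP al)/andP[JI IJ] Ks.
  have /orP[h|h] := allP dI _ Ks; first by rewrite (le_trans IJ h).
  by rewrite orbC (le_trans h JI).
- move: ls; rewrite !total_length_cat total_length_partition.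
  by case: pl => _ /eqP ->; rewrite {1}/total_length big_cons -/(total_length s1); lra.
Qed.

(** For [0 <= t], the projection onto [[0, t]]. Composition with it extends a function on [[0, t]]
    by constants to the whole line. *)
Definition clamp (t x : R) := Num.min t (Num.max 0 x).

Lemma clamp_itv t x : 0 <= t -> 0 <= clamp t x <= t.
Proof. by move=> t0; rewrite /clamp ge_min lexx le_min t0 le_max lexx. Qed.

Lemma clamp_id t x : 0 <= x <= t -> clamp t x = x.
Proof. by move=> /andP[x0 xt]; rewrite /clamp max_r// min_r. Qed.

Lemma le_clamp t x y : x <= y -> clamp t x <= clamp t y.
Proof. by move=> xy; rewrite /clamp le_min2// le_max2. Qed.

Lemma clampK t x : 0 <= t -> clamp t (clamp t x) = clamp t x.
Proof. by move=> t0; apply: clamp_id; exact: clamp_itv. Qed.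

Lemma clampB_le t x y : x <= y -> clamp t y - clamp t x <= y - x.
Proof.
move=> xy; rewrite /clamp !minEle !maxEle.
have [x0|x0] := leP 0 x; have [y0|y0] := leP 0 y;
  try have [tx|tx] := leP t x; try have [ty|ty] := leP t y;
  try have [t0|t0] := leP t 0; lra.
Qed.

(** Pieces shorter than the [delta] attached to [1] have variation at most [1], and finitely many of
    them fill [[a, b]]. *)
Lemma ac_finite_variation t F a b : ac_on t F -> 0 <= a -> a <= b -> b <= t ->
  total_variation a b F \is a fin_num.
Proof.
move=> /(_ 1 ltr01)[delta delta0 H] a0 ab bt.
pose N := (Num.truncn ((b - a) / delta)).+1.
pose h := (b - a) / N%:R.
have h0 : 0 <= h by rewrite divr_ge0// subr_ge0.
have hd : h < delta.
  rewrite /h ltr_pdivrMr ?ltr0n// -ltr_pdivrMl// mulrC truncnS_gt//.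
have bE : b = a + h *+ N.
  by rewrite /h -mulr_natr mulfVK ?pnatr_eq0// subrKC.
have lea k : a <= a + h *+ k by rewrite lerDl mulrn_wge0.
suff hk k : (k <= N)%N -> (total_variation a (a + h *+ k) F <= k%:R%:E)%E.
  rewrite ge0_fin_numE ?total_variation_ge0//.
  by rewrite bE (le_lt_trans (hk _ (leqnn _)))// ltry.
elim: k => [|k ih] kN; first by rewrite mulr0n addr0 total_variationxx.
rewrite (@total_variationD _ _ _ (a + h *+ k))//; last first.
  by rewrite lerD2l mulrSr lerDl.
rewrite -natr1 EFinD leeD ?ih//; first exact: ltnW.
have := total_variation_family H (s1 := [:: (a + h *+ k, a + h *+ k.+1)]) (s2 := [::]).
rewrite /= /oscillation big_nil adde0 big_seq1; apply.
  rewrite /itv_family/= !andbT; apply/and3P; split.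
  - by rewrite (le_trans a0).
  - by rewrite lerD2l mulrSr lerDl.
  - by rewrite (le_trans _ bt)// bE lerD2l ler_wpMn2l.
by rewrite /total_length big_seq1/= mulrSr; lra.
Qed.

End interval_families.

(** * Stieltjes measures of monotone absolutely continuous functions *)

Section monotone_ac.
Context {R : realType} (t : R) (G : R -> R).
Local Notation leb := (@lebesgue_measure R).
Hypothesis t0 : 0 <= t.
Hypothesis ndG : {homo G : x y / x <= y}.
Hypothesis clampG : forall x, G (clamp t x) = G x.
Hypothesis acG : ac_on t G.

(** Intervals may leave [[0, t]] here: clamping their endpoints changes no value of [G], keeps them
    separated and does not lengthen them. *)
Lemma monotone_ac_small (e : R) : 0 < e -> exists2 delta : R, 0 < delta &
  forall s, pairwise (fun I J : R * R => (I.2 <= J.1) || (J.2 <= I.1)) s ->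
    all (fun I => I.1 <= I.2) s ->
    total_length s < delta -> \sum_(I <- s) (G I.2 - G I.1) <= e.
Proof.
move=> e0; have [delta delta0 H] := acG e0; exists delta => // s ps s12 ls.
pose c (J : R * R) := (clamp t J.1, clamp t J.2).
have := H [seq c J | J <- s]; rewrite /oscillation big_map /=.
rewrite (@eq_big_seq _ _ _ _ _ _ (fun I => G I.2 - G I.1)); last first.
  move=> I Is; rewrite !clampG ger0_norm// subr_ge0; apply: ndG.
  exact: (allP s12).
apply.
  rewrite /itv_family; apply/andP; split.
    rewrite all_map; apply: sub_all s12 => I I12 /=.
    have /andP[-> _] := clamp_itv I.1 t0; have /andP[_ ->] := clamp_itv I.2 t0.
    by rewrite le_clamp.
  rewrite pairwise_map; apply: sub_pairwise ps => I J /=.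
  by move=> /orP[h|h]; rewrite (le_clamp t h) ?orbT.
rewrite (le_lt_trans _ ls)// /total_length big_map big_seq [leRHS]big_seq.
by apply: ler_sum => I Is; apply: clampB_le; exact: (allP s12).
Qed.

Let rcG : right_continuous G.
Proof.
move=> x; apply/cvgrPdist_le => e e0.
have [delta delta0 H] := monotone_ac_small e0.
near=> y.
have xy : x < y by near: y; exact: nbhs_right_gt.
have := H [:: (x, y)]; rewrite /= /total_length !big_seq1/= (ltW xy) distrC.
rewrite ger0_norm ?subr_ge0 ?ndG ?(ltW xy)//; apply => //.
rewrite ltrBlDl.
by near: y; apply: nbhs_right_lt; rewrite ltrDl.
Unshelve. all: by end_near. Qed.

Lemma monotone_ac_cumulative : exists F : cumulative R R, G = F.
Proof. by exists (HB.pack_for (cumulative R R) G (isCumulative.Build R _ R G ndG rcG)). Qed.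

End monotone_ac.

Section monotone_density.
Context {R : realType} (t : R) (G : cumulative R R).
Local Notation leb := (@lebesgue_measure R).
Hypothesis t0 : 0 <= t.
Hypothesis clampG : forall x, G (clamp t x) = G x.
Hypothesis acG : ac_on t G.
Let ndG : {homo G : x y / x <= y}. Proof. exact: cumulative_is_nondecreasing. Qed.
Local Notation mu := (lebesgue_stieltjes_measure G).

Let muE a b : a <= b -> mu `]a, b] = (G b - G a)%:E.
Proof.
move=> ab; rewrite /mu /lebesgue_stieltjes_measure /measure_extension.
by rewrite measurable_mu_extE/= ?wlength_itv_bnd//; exact: is_ocitv.
Qed.

Let bounded_open_itv (A : set R) : open A -> is_interval A -> (leb A < +oo)%E ->
  A !=set0 -> exists x y : R, x < y /\ A = `]x, y[%classic.
Proof.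
move=> oA iA lA A0.
have [lbA ubA] : has_lbound A /\ has_ubound A.
  have /is_intervalP AE := iA; move: lA A0.
  rewrite AE lebesgue_measure_itv; case: (Rhull A) => [[b x|[]] [c y|[]]]/= lA [z0].
  - move=> _; split; [exists x|exists y] => z /=; rewrite in_itv => /andP[].
    + by move=> + _; case: b => //=; exact: ltW.
    + by move=> _; case: c => //=; exact: ltW.
  - by rewrite /= in_itv/= andbF.
  - by move: lA; rewrite ltry.
  - by move: lA; rewrite ltNyr.
  - by rewrite /= in_itv.
  - by [].
  - by rewrite /= in_itv.
  - by rewrite /= in_itv.
  - by rewrite /= in_itv.
have AE : A = `]inf A, sup A[%classic.
  rewrite -{1}(interior_id A).1// interval_bounded_interior//.
exists (inf A), (sup A); split => //.
by case: A0 => x; rewrite {1}AE /= in_itv/= => /andP[]; exact: lt_trans.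
Qed.

(** A Lebesgue-null set lies in an open set of measure below [delta]. This open set is a countable
    disjoint union of intervals, and every finite part of the sum of the increments of [G] over them
    is at most [e] by absolute continuity. *)
Lemma stieltjes_dominated : mu `<< leb.
Proof.
apply/null_content_dominatesP => N mN N0.
apply/eqP; rewrite eq_le measure_ge0 andbT; apply/lee_addgt0Pr => e e0.
rewrite add0e.
have [delta delta0 H] := monotone_ac_small t0 ndG clampG acG e0.
have [|U [oU NU UN]] := lebesgue_regularity_outer mN _ delta0; first by rewrite N0.
have {UN}Ud : (leb U < delta%:E)%E.
  rewrite (le_lt_trans _ UN)// -{1}(setDUK NU) (le_trans (measureU2 _ _ _))//.
    by apply: measurableD => //; exact: open_measurable.
  by rewrite N0 add0e.
apply: (@le_trans _ _ (mu U)).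
  by apply: le_measure; rewrite ?inE//; exact: open_measurable.
pose A := open_disjoint_itv oU.
have mA k : measurable (A k).
  by apply: open_measurable; exact: open_disjoint_itv_open.
have tA : trivIset setT A by exact: open_disjoint_itv_trivIset.
have UE : U = \bigcup_k A k by exact: open_disjoint_itv_bigcup.
have lA k : (leb (A k) < +oo)%E.
  rewrite (@le_lt_trans _ _ (leb U))//; last by rewrite (lt_trans Ud)// ltry.
  apply: le_measure; rewrite ?inE; [exact: mA|exact: open_measurable|].
  by rewrite UE; exact: bigcup_sup.
have [ab abP] : exists ab : nat -> R * R, forall k, A k !=set0 ->
    (ab k).1 < (ab k).2 /\ A k = `](ab k).1, (ab k).2[%classic.
  suff : forall k, exists I : R * R, A k !=set0 ->
    I.1 < I.2 /\ A k = `]I.1, I.2[%classic by move=> /choice[f fP]; exists f.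
  move=> k; have [A0|A0] := pselect (A k !=set0); last by exists (0, 0).
  have [x [y xy]] := bounded_open_itv (@open_disjoint_itv_open _ _ oU k)
    (@open_disjoint_itv_is_interval _ _ oU k) (lA k) A0.
  by exists (x, y).
have muU : mu U = (\sum_(0 <= k <oo) mu (A k))%E.
  rewrite UE measure_bigcup; [|by move=> *; exact: mA|exact: tA].
  by apply: eq_eseriesl => k; rewrite in_setT.
have lebU : leb U = (\sum_(0 <= k <oo) leb (A k))%E.
  rewrite UE measure_bigcup; [|by move=> *; exact: mA|exact: tA].
  by apply: eq_eseriesl => k; rewrite in_setT.
rewrite muU; apply: lime_le; first exact: is_cvg_nneseries.
apply: nearW => n /=.
(* Empty components are skipped, because [ab] says nothing about them. *)
pose s := [seq ab k | k <- iota 0 n & `[< A k !=set0 >]].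
have sumE (h : set R -> \bar R) (h' : R * R -> R) : h set0 = 0%E ->
    (forall k, A k !=set0 -> (h (A k) <= (h' (ab k))%:E)%E) ->
    (\sum_(0 <= k < n) h (A k) <= (\sum_(I <- s) h' I)%:E)%E.
  move=> h0 hh'; rewrite /s big_map big_filter -sumEFin.
  rewrite (bigID (fun k => `[< A k !=set0 >]))/= addeC big1 ?add0e; last first.
    move=> k /asboolPn/set0P/negP; rewrite negbK => /eqP ->; exact: h0.
  by rewrite /index_iota subn0; apply: lee_sum => k /asboolP; exact: hh'.
apply: (@le_trans _ _ (\sum_(I <- s) (G I.2 - G I.1))%:E).
  apply: sumE => [|k A0]; first exact: measure0.
  have [lt_ab AE] := abP k A0; rewrite -muE ?(ltW lt_ab)//.
  rewrite AE; apply: le_measure; rewrite ?inE;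
    [exact: measurable_itv|exact: measurable_itv|exact: subset_itv_oo_oc].
have kA k : k \in [seq k <- iota 0 n | `[< A k !=set0 >]] -> A k !=set0.
  by rewrite mem_filter => /andP[/asboolP].
rewrite lee_fin H//.
- rewrite /s pairwise_map.
  have : uniq [seq k <- iota 0 n | `[< A k !=set0 >]] by rewrite filter_uniq ?iota_uniq.
  rewrite uniq_pairwise; apply: (@sub_in_pairwise _ [pred k | `[< A k !=set0 >]]).
    move=> i j /asboolP Ai /asboolP Aj /= ij.
    have [lti Ei] := abP i Ai; have [ltj Ej] := abP j Aj.
    have := tA i j Logic.I Logic.I; rewrite Ei Ej => h.
    apply/negP => /negP; rewrite negb_or -!ltNge => /andP[h1 h2].
    move/eqP: ij; apply; apply: h.
    (* The midpoint of the overlap would lie in both components. *)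
    exists ((Num.max (ab i).1 (ab j).1 + Num.min (ab i).2 (ab j).2) / 2).
    by split; rewrite /= in_itv/= !maxEle !minEle; do 2 case: ifPn;
      rewrite -?ltNge => ? ?; apply/andP; split; lra.
  by apply/allP => k /kA/asboolP.
- by apply/allP => I /mapP[k /kA/abP[/ltW + _] ->].
- rewrite -lte_fin (le_lt_trans _ Ud)// lebU.
  apply: (@le_trans _ _ (\sum_(0 <= k < n) leb (A k))%E); last first.
    by apply: nneseries_lim_ge => k _.
  rewrite /total_length /s big_map big_filter -sumEFin /index_iota subn0.
  rewrite [leRHS](bigID (fun k => `[< A k !=set0 >]))/= -[leLHS]adde0 leeD//; last first.
    by apply: sume_ge0 => k _; exact: measure_ge0.
  apply: lee_sum => k /asboolP /abP[lt_ab ->].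
  by rewrite lebesgue_measure_itv/= lte_fin lt_ab EFinB.
Qed.

(** The Radon-Nikodym density of the Stieltjes measure of [G], restricted to []0, t]] so that the
    measure is finite. *)
Lemma stieltjes_density : exists f : R -> R,
  [/\ leb.-integrable setT (EFin \o f), forall x, 0 <= f x &
      forall a b, 0 <= a -> a <= b -> b <= t ->
      (\int[leb]_(x in `[a, b]) (f x)%:E = (G b - G a)%:E)%E].
Proof.
have mE : measurable (`]0, t]%classic : set (measurableTypeR R)).
  exact: measurable_itv.
have muE0 : (mu `]0%R, t] < +oo)%E by rewrite muE ?ltry.
pose nu : {finite_measure set (measurableTypeR R) -> \bar R} := mfrestr mE muE0.
have nuleb : nu `<< leb.
  apply/null_content_dominatesP => N mN N0.
  have /null_content_dominatesP H := stieltjes_dominated.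
  have : mu N = 0%E by exact: H.
  rewrite /nu /mfrestr/= /mrestr => muN.
  apply/eqP; rewrite eq_le measure_ge0 andbT -muN.
  by apply: le_measure; rewrite ?inE//; exact: measurableI.
have [f [f0 ffin intf fE]] := radon_nikodym_sigma_finite nuleb.
exists (fine \o f); split.
- by apply: eq_integrable intf => // x _; rewrite /= fineK.
- by move=> x; rewrite fine_ge0.
- move=> a b a0 ab bt.
  rewrite (eq_integral f); last by move=> x _; rewrite /= fineK.
  rewrite -integral_itv_obnd_cbnd; last first.
    by apply: measurable_funTS; exact: measurable_int intf.
  rewrite -fE; last exact: measurable_itv.
  rewrite -muE//; change (mu (`]a, b] `&` `]0, t]) = mu `]a, b]); congr (mu _).
  apply: setIidl => x.
  by rewrite /= !in_itv/= => /andP[ax xb]; rewrite (le_lt_trans a0 ax) (le_trans xb bt).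
Qed.

End monotone_density.

(** * Densities and derivatives of absolutely continuous functions *)

Lemma near_shift_derivable {R : realType} (F G : R -> R) (c s : R) :
  derivable G s 1 -> {near s, (fun y => c + G y) =1 F} ->
  derivable F s 1 /\ derive1 F s = derive1 G s.
Proof.
move=> dG cGF; have dcG : derivable (fun y => c + G y) s 1.
  by apply: derivableD => //; exact: derivable_cst.
split; first exact: near_eq_derivable cGF dcG.
by rewrite !derive1E -(near_eq_derive _ cGF) deriveD// derive_cst add0r.
Qed.

Section ac_density.
Context {R : realType} (t : R) (F : R -> R).
Local Notation leb := (@lebesgue_measure R).
Hypothesis t0 : 0 <= t.
Hypothesis acF : ac_on t F.

Let V (x : R) := fine (total_variation 0 (clamp t x) F).

Let VB a b : a <= b ->
  V b - V a = fine (total_variation (clamp t a) (clamp t b) F).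
Proof.
move=> ab; have cab := le_clamp t ab.
have /andP[a0 aT] := clamp_itv a t0; have /andP[b0 bT] := clamp_itv b t0.
rewrite /V (@total_variationD _ _ _ (clamp t a))// fineD.
- by rewrite addrC addKr.
- exact: (@ac_finite_variation _ t).
- exact: (@ac_finite_variation _ t).
Qed.

Let V_ge a b : a <= b -> `|F (clamp t b) - F (clamp t a)| <= V b - V a.
Proof.
move=> ab; have cab := le_clamp t ab.
have /andP[a0 aT] := clamp_itv a t0; have /andP[b0 bT] := clamp_itv b t0.
rewrite VB// -lee_fin fineK; last exact: (@ac_finite_variation _ t).
exact: total_variation_ge.
Qed.

Let Vnd : {homo V : x y / x <= y}.
Proof. by move=> x y xy; rewrite -subr_ge0 (le_trans _ (V_ge xy)). Qed.

Let acV : ac_on t V.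
Proof.
move=> e e0; have [delta delta0 H] := acF e0; exists delta => // s fs ls.
have := total_variation_family H (s1 := s) (s2 := [::]).
rewrite cats0 => /(_ fs ls); rewrite /oscillation big_nil adde0 => h.
rewrite -lee_fin (le_trans _ h)// -sumEFin big_seq [leRHS]big_seq.
apply: lee_sum => J Js; move: fs => /andP[/allP /(_ _ Js)/and3P[J0 J12 Jt] _].
rewrite ger0_norm ?subr_ge0 ?Vnd// VB// !clamp_id ?fineK ?J0 ?Jt ?andbT//=.
- exact: (@ac_finite_variation _ t).
- exact: le_trans J12.
- exact: le_trans J12 _.
Qed.

Let W x := V x - F (clamp t x).

Let Wnd : {homo W : x y / x <= y}.
Proof.
move=> x y xy; have := V_ge xy; rewrite /W ler_norml => /andP[_]; lra.
Qed.

Let acW : ac_on t W.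
Proof.
move=> e e0; have e20 : 0 < e / 2 by rewrite divr_gt0.
have [d1 d10 H1] := acF e20; have [d2 d20 H2] := acV e20.
exists (Num.min d1 d2) => [|s fs]; first by rewrite lt_min d10.
rewrite lt_min => /andP[l1 l2].
have {H1} := H1 _ fs l1; have {H2} := H2 _ fs l2.
suff : oscillation W s <= oscillation V s + oscillation F s by lra.
rewrite /oscillation -big_split/= big_seq [leRHS]big_seq; apply: ler_sum => J Js.
move: fs => /andP[/allP /(_ _ Js)/and3P[J0 J12 Jt] _].
rewrite /W !clamp_id ?J0 ?Jt ?(le_trans J12) ?(le_trans J0)//.
rewrite (le_trans _ (ler_normB _ _))// le_eqVlt; apply/orP; left; apply/eqP.
by congr (`| _ |); ring.
Qed.

(** Jordan decomposition: [F] is the difference of its variation function [V] and of [W = V - F],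
    both nondecreasing and absolutely continuous, so each has a density. *)
Lemma ac_density : exists f : R -> R, leb.-integrable setT (EFin \o f) /\
  forall a b, 0 <= a -> a <= b -> b <= t ->
    F b - F a = \int[leb]_(x in `[a, b]) f x.
Proof.
have cV x : V (clamp t x) = V x by rewrite /V clampK.
have cW x : W (clamp t x) = W x by rewrite /W cV clampK.
have [GV GVE] := monotone_ac_cumulative t0 Vnd cV acV.
have [GW GWE] := monotone_ac_cumulative t0 Wnd cW acW.
have [||f [intf f0 fE]] := stieltjes_density (G := GV) t0; rewrite -?GVE//.
have [||g [intg g0 gE]] := stieltjes_density (G := GW) t0; rewrite -?GWE//.
exists (f \- g); split.
  by apply: eq_integrable (integrableB _ intf intg).
move=> a b a0 ab bt.
have sub h : leb.-integrable setT h -> leb.-integrable `[a, b] h.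
  by apply: integrableS => //.
rewrite RintegralB//; [|exact: sub..].
rewrite /Rintegral fE// gE//= -GVE -GWE /W.
rewrite !clamp_id ?a0 ?bt ?(le_trans ab) ?(le_trans a0)//; lra.
Qed.

(** Near an interior time [F] coincides with [F 0] plus the integral of its density, and Lebesgue's
    differentiation theorem applies to the latter. *)
Lemma ac_derivative : exists f : R -> R, [/\ leb.-integrable setT (EFin \o f),
  forall a b, 0 <= a -> a <= b -> b <= t ->
    F b - F a = \int[leb]_(x in `[a, b]) f x &
  {ae leb, forall s, 0 < s < t -> derivable F s 1 /\ derive1 F s = f s}].
Proof.
have [f [intf fE]] := ac_density; exists f; split => //.
have mf : measurable_fun setT f.
  exact: (measurable_EFinP _ _).1 (measurable_int _ intf).
have lf : locally_integrable setT f.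
  split; [exact: mf|exact: openT|].
  move=> K _ cK; have [_] := integrableP _ _ _ intf.
  apply: le_lt_trans; apply: ge0_subset_integral => //.
  - exact: compact_measurable.
  - by apply/measurable_EFinP; exact: measurableT_comp.
have intfy y : leb.-integrable [set` Interval (BLeft 0) (BRight y)] (EFin \o f).
  by apply: integrableS intf => //; exact: measurable_itv.
have := FTC1 intfy lf.
apply: filterS; first exact: (ae_filter_ringOfSetsType leb).
move=> s H /andP[s0 st]; have [dF F'] := H s0.
have eqF : {near s, (fun y => F 0 + \int[leb]_(x in `[0, y]) f x) =1 F}.
  near=> y; rewrite -fE ?subrKC//.
    by apply: ltW; near: y; exact: lt_nbhsr.
  by apply: ltW; near: y; exact: lt_nbhsl.
by rewrite -F'; exact: near_shift_derivable dF eqF.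
Unshelve. all: by end_near. Qed.

End ac_density.

(** * Joint measurability of paths and of their derivatives *)

Lemma countable_bigcapT_measurable d (T : measurableType d) (U : countType)
    (F : U -> set T) :
  (forall i, measurable (F i)) -> measurable (\bigcap_i F i).
Proof.
move=> mF; rewrite -[X in measurable X]setCK setC_bigcap; apply: measurableC.
apply: countable_bigcupT_measurable; first exact: countableP.
by move=> i; exact: measurableC.
Qed.

Lemma enorm_cvgP {R : realType} {d : nat} {T : Type} (F : set_system T)
    {FF : Filter F} (f : T -> 'rV[R]_d) (l : 'rV[R]_d) :
  f x @[x --> F] --> l <->
  forall e : R, 0 < e -> \forall x \near F, enorm (l - f x) < e.
Proof.
split=> [/cvgrPdist_lt fl e e0|H].
  have d0 : 0 < d%:R + 1 :> R by rewrite ltr_wpDl.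
  have /fl : 0 < e / (d%:R + 1) by rewrite divr_gt0.
  apply: filterS => x; rewrite ltr_pdivlMr// mulrC; apply: le_lt_trans.
  by rewrite (le_trans (enorm_le_norm _))// ler_wpM2r// lerDl.
apply/cvgrPdist_lt => e /H; apply: filterS => x.
by apply: le_lt_trans; exact: norm_le_enorm.
Qed.

Lemma cvg_coord {R : realType} {d : nat} {T : Type} (F : set_system T)
    {FF : Filter F} (f : T -> 'rV[R]_d) (l : 'rV[R]_d) i :
  f x @[x --> F] --> l -> f x ord0 i @[x --> F] --> l ord0 i.
Proof.
move=> /enorm_cvgP fl; apply/cvgrPdist_lt => e /fl; apply: filterS => x.
by apply: le_lt_trans; have := coord_le_enorm (l - f x) i; rewrite !mxE.
Qed.

Section caratheodory.
Context {R : realType} {d' : measure_display} {X : measurableType d'}.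

Let grid (n : nat) (s : R) : R := (Num.floor (s * n.+1%:R))%:~R / n.+1%:R.

Let grid_cvg (s : R) : grid n s @[n --> \oo] --> s.
Proof.
apply/cvgrPdist_lt => e e0; near=> n.
have n0 : (0 : R) < n.+1%:R by rewrite ltr0n.
have := Num.Theory.floor_itv (s * n.+1%:R) => /andP[h1 h2].
have -> : s - grid n s = (s * n.+1%:R - (Num.floor (s * n.+1%:R))%:~R) / n.+1%:R.
  by rewrite /grid mulrBl mulfK// gt_eqF.
rewrite ger0_norm; last by rewrite divr_ge0 ?ler0n// subr_ge0.
rewrite (@le_lt_trans _ _ (1 / n.+1%:R))//.
  rewrite ler_pM2r ?invr_gt0// lerBlDl.
  by move: h2; rewrite intrD => /ltW.
rewrite div1r invf_plt ?posrE//.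
by near: n; exists (Num.bound e^-1) => // m /= em; rewrite (lt_le_trans (archi_boundP _))// ?invr_ge0 ?(ltW e0)// ler_nat (leq_trans em).
Unshelve. all: by end_near. Qed.

(** Freezing the time at the left end of its cell of length [1 / (n + 1)] gives a function that, on
    each of countably many strips, depends on [x] alone and is measurable. Continuity in time makes
    these functions converge pointwise. *)
Lemma caratheodory_measurable (g : X -> R -> R) :
  (forall s, measurable_fun setT (g ^~ s)) -> (forall x, continuous (g x)) ->
  measurable_fun setT (fun z : X * R => g z.1 z.2).
Proof.
move=> mg cg.
apply: (@measurable_fun_cvg _ _ _ setT (fun n (z : X * R) => g z.1 (grid n z.2))); last first.
  by move=> z _; apply: continuous_cvg; [exact: cg|exact: grid_cvg].
move=> n _ B mB; rewrite setTI.
have n0 : (0 : R) < n.+1%:R by rewrite ltr0n.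
rewrite (_ : _ @^-1` B = \bigcup_(k : int)
    ((g ^~ (k%:~R / n.+1%:R) @^-1` B) `*`
     `[(k%:~R / n.+1%:R : R), ((k + 1)%:~R / n.+1%:R)[%classic)); last first.
  apply/seteqP; split => [[x s] /= Bx|[x s] [k _ [/= Bx]]].
    exists (Num.floor (s * n.+1%:R)) => //; split => //=.
    by rewrite in_itv/= ler_pdivrMr// ltr_pdivlMr// Num.Theory.floor_itv.
  rewrite in_itv/= ler_pdivrMr// ltr_pdivlMr// => h.
  by rewrite /grid (Num.Theory.floor_def h).
apply: countable_bigcupT_measurable; first exact: countableP.
move=> k; apply: measurableX; last exact: measurable_itv.
by rewrite -[X in measurable X]setTI; exact: mg.
Qed.

Lemma caratheodory_measurable_rV d (f : X -> R -> 'rV[R]_d) :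
  (forall s, measurable_fun setT (fun x => f x s : borelRd R d)) ->
  (forall x, continuous (f x)) ->
  measurable_fun setT (fun z : X * R => f z.1 z.2 : borelRd R d).
Proof.
move=> mf cf; apply: measurable_fun_rV => i.
apply: (caratheodory_measurable (g := fun x s => f x s ord0 i)) => [s|x].
  exact: measurableT_comp (measurable_coord i) (mf s).
by move=> s; apply: cvg_coord; exact: cf.
Qed.

End caratheodory.

Section measurable_derivative.
Context {R : realType} {d : nat}.
Implicit Types (f : R -> 'rV[R]_d).

Definition growth f (s h : R) := h^-1 *: (f (h + s) - f s).

Let rate k : R := k.+1%:R^-1.

(** Only rational increments are tested, so that the set of points of derivability becomes a
    countable combination of measurable sets. *)
Definition growth_cauchy f s (k n : nat) := forall q r : rat,
  0 < `|ratr q : R| < rate n -> 0 < `|ratr r : R| < rate n ->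
  enorm (growth f s (ratr q) - growth f s (ratr r)) <= rate k.

Lemma growth_continuous f s (h : R) : continuous f -> h != 0 ->
  {for h, continuous (growth f s)}.
Proof.
move=> cf h0; apply: continuousZ; first exact: inv_continuous.
apply: continuousB; last exact: cst_continuous.
by apply: continuous_comp; [apply: continuousD; [exact: cvg_id|exact: cst_continuous]|exact: cf].
Qed.

Lemma dense_rat_le (phi : R -> R) (h r c : R) : {for h, continuous phi} ->
  0 < `|h| < r ->
  (forall q : rat, 0 < `|ratr q : R| < r -> phi (ratr q) <= c) -> phi h <= c.
Proof.
move=> cphi /andP[h0 hr] H; rewrite leNgt; apply/negP => ch.
have /nbhs_ballP[e /= e0 eh] : \forall x \near h, [/\ c < phi x, 0 < `|x| & `|x| < r].
  near=> x; split; near: x.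
  - by apply: (cvgr_gt (phi h)).
  - apply: (cvgr_gt `|h|) => //; exact: norm_continuous.
  - apply: (cvgr_lt `|h|) => //; exact: norm_continuous.
have [|q qin] := @rat_in_itvoo R h (h + e); first by rewrite ltrDl.
have [|cq q0 qr] := eh (ratr q).
  rewrite /ball/= /ball_/= distrC ger0_norm.
    by move: qin; rewrite in_itv/=; lra.
  by move: qin; rewrite in_itv/=; lra.
by have := H q; rewrite q0 qr leNgt cq => /(_ isT).
Unshelve. all: by end_near. Qed.

Lemma derivable_growthE f s : derivable f s 1 = cvg (growth f s h @[h --> 0^']).
Proof.
rewrite /derivable.
have -> : (fun h : R => h^-1 *: ((f \o shift s) (h *: (1 : R^o)) - f s)) = growth f s.
  by apply/funext => h; rewrite /growth/= /shift /GRing.scale/= mulr1.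
by [].
Qed.

(** Difference quotients are continuous in a nonzero increment, so the Cauchy bound extends from
    rational increments to all small ones; completeness provides the limit. *)
Lemma derivable_growth f s : continuous f ->
  derivable f s 1 <-> forall k, exists n, growth_cauchy f s k n.
Proof.
move=> cf; rewrite derivable_growthE; split=> [/cvg_ex[l /= fl] k|H].
  have k0 : 0 < rate k / 2 by rewrite divr_gt0 ?invr_gt0 ?ltr0n.
  have [e /= e0 eh] := (enorm_cvgP (growth f s) l).1 fl _ k0.
  have [n ne] : exists n, rate n < e.
    exists (Num.bound e^-1); rewrite /rate invf_plt ?posrE ?ltr0n//.
    by rewrite (lt_trans (archi_boundP _))// ?invr_ge0 ?(ltW e0)// ltr_nat.
  exists n => q r /andP[q0 qn] /andP[r0 rn].
  have near0 (q' : rat) : 0 < `|ratr q' : R| -> `|ratr q' : R| < rate n ->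
      enorm (l - growth f s (ratr q')) < rate k / 2.
    move=> q'0 q'n; apply: eh; last by rewrite -normr_gt0.
    by rewrite /ball/= sub0r normrN (lt_trans q'n).
  have := near0 q q0 qn; have := near0 r r0 rn; rewrite enormB => h1.
  rewrite enormB => h2; rewrite (le_trans (enorm_triangle l _ _))//.
  by rewrite enormB in h1; lra.
apply/cauchy_cvgP/cauchy_exP => e e0.
have [k ke] : exists k, rate k < e.
  exists (Num.bound e^-1); rewrite /rate invf_plt ?posrE ?ltr0n//.
  by rewrite (lt_trans (archi_boundP _))// ?invr_ge0 ?(ltW e0)// ltr_nat.
have [n Hn] := H k.
have {}Hn (h h' : R) : 0 < `|h| < rate n -> 0 < `|h'| < rate n ->
    enorm (growth f s h - growth f s h') <= rate k.
  move=> hn h'n.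
  have cg u v : v != 0 -> {for v, continuous (fun v => enorm (growth f s v - u))}.
    move=> v0; apply: continuous_comp; last exact: enorm_continuous.
    by apply: continuousB; [exact: growth_continuous|exact: cst_continuous].
  apply: (@dense_rat_le (fun v => enorm (growth f s v - growth f s h')) h (rate n)) => //.
    by apply: cg; rewrite -normr_gt0; case/andP: hn.
  move=> q qn; rewrite enormB.
  apply: (@dense_rat_le (fun v => enorm (growth f s v - growth f s (ratr q))) h' (rate n)) => //.
    by apply: cg; rewrite -normr_gt0; case/andP: h'n.
  by move=> r rn; exact: Hn.
have n0 : 0 < rate n by rewrite invr_gt0.
exists (growth f s (rate n / 2)).
change (\forall h \near 0^', ball (growth f s (rate n / 2)) e (growth f s h)).
near=> h; rewrite mx_norm_ball /ball_/=.
rewrite (le_lt_trans (norm_le_enorm _))// (le_lt_trans _ ke)//; apply: Hn.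
  by rewrite gtr0_norm ?divr_gt0//; lra.
apply/andP; split; first by rewrite normr_gt0; near: h; exact: nbhs_dnbhs_neq.
by near: h; apply: dnbhs0_lt.
Unshelve. all: by end_near. Qed.

Context {d' : measure_display} {X : measurableType d'}.
Variable f : X -> R -> 'rV[R]_d.
Hypothesis mf : forall s, measurable_fun setT (fun x => f x s : borelRd R d).
Hypothesis cf : forall x, continuous (f x).

Let measurable_growth h :
  measurable_fun setT (fun z : X * R => growth (f z.1) z.2 h : borelRd R d).
Proof.
apply: (caratheodory_measurable_rV (f := fun x s => growth (f x) s h)) => [s|x].
  apply: measurable_fun_rV => i.
  rewrite (_ : (fun x => _) = (fun x => h^-1 * (f x (h + s) ord0 i - f x s ord0 i))).
    apply: measurable_funM => //; apply: measurable_funB.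
      exact: measurableT_comp (measurable_coord i) (mf (h + s)).
    exact: measurableT_comp (measurable_coord i) (mf s).
  by apply/funext => x; rewrite !mxE.
move=> s; rewrite /continuous_at /growth; apply: cvgZ; first exact: cvg_cst.
apply: cvgB; last exact: cf.
apply: continuous_comp; last exact: cf.
by apply: continuousD; [exact: cst_continuous|exact: cvg_id].
Qed.

Let derivable_set := [set z : X * R | derivable (f z.1) z.2 1].

Let measurable_derivable_set : measurable derivable_set.
Proof.
have -> : derivable_set = \bigcap_(k : nat) \bigcup_(n : nat)
   \bigcap_(q : rat) \bigcap_(r : rat) [set z : X * R |
     0 < `|ratr q : R| < rate n -> 0 < `|ratr r : R| < rate n ->
  enorm (growth (f z.1) z.2 (ratr q) - growth (f z.1) z.2 (ratr r)) <= rate k].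
  apply/seteqP; split => [z|z H].
    rewrite /derivable_set/= (derivable_growth _ (@cf z.1)) => H k _.
    by have [n Hn] := H k; exists n => // q _ r _; exact: Hn.
  rewrite /derivable_set/= (derivable_growth _ (@cf z.1)) => k.
  by have [n _ Hn] := H k Logic.I; exists n => q r; exact: Hn.
apply: bigcapT_measurable => k; apply: bigcupT_measurable => n.
apply: countable_bigcapT_measurable => q; apply: countable_bigcapT_measurable => r.
have [hq|hq] := pselect (0 < `|ratr q : R| < rate n); last first.
  rewrite (_ : [set z | _] = setT)//.
  by apply/seteqP; split => // z _ /hq.
have [hr|hr] := pselect (0 < `|ratr r : R| < rate n); last first.
  rewrite (_ : [set z | _] = setT)//.
  by apply/seteqP; split => // z _ _ /hr.
rewrite (_ : [set z | _] = (fun z : X * R => enorm (growth (f z.1) z.2 (ratr q) -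
    growth (f z.1) z.2 (ratr r))) @^-1` `]-oo, rate k]); last first.
  by apply/seteqP; split => z /=; rewrite in_itv/= => H; [exact: H|move=> _ _].
rewrite -[X in measurable X]setTI.
apply: (measurableT_comp measurable_enorm) => //.
apply: measurable_fun_rV => i.
rewrite (_ : (fun x => _) = (fun z : X * R => growth (f z.1) z.2 (ratr q) ord0 i -
    growth (f z.1) z.2 (ratr r) ord0 i)).
  by apply: measurable_funB;
    exact: measurableT_comp (measurable_coord i) (measurable_growth _).
by apply/funext => x; rewrite !mxE.
Qed.

Lemma measurable_derive1 :
  measurable_fun setT (fun z : X * R => derive1 (f z.1) z.2 : borelRd R d).
Proof.
apply: measurable_fun_rV => i.
(* Where the path is not derivable, [derive1] is the default value [point] of a divergent limit; the
   approximations take that value there. *)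
apply: (@measurable_fun_cvg _ _ _ setT (fun n (z : X * R) =>
  if z \in derivable_set then growth (f z.1) z.2 (rate n) ord0 i
  else (point : 'rV[R]_d) ord0 i)) => [n|z _].
  apply: measurable_fun_ifT.
  - by apply: (measurable_fun_bool true); rewrite setTI preimage_mem_true.
  - exact: measurableT_comp (measurable_coord i) (measurable_growth _).
  - exact: measurable_cst.
have [dz|dz] := boolP (z \in derivable_set); last first.
  rewrite (_ : derive1 _ _ = point); first exact: cvg_cst.
  apply: dvgP; move: dz => /negP; rewrite inE => dz h; apply: dz.
  by rewrite /derivable_set/= derivable_growthE.
have dl : growth (f z.1) z.2 h @[h --> 0^'] --> derive1 (f z.1) z.2.
  by move: dz; rewrite inE /derivable_set/= derivable_growthE.
apply: cvg_coord; apply/enorm_cvgP => e e0.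
have [r /= r0 H] := (enorm_cvgP (growth (f z.1) z.2) _).1 dl _ e0.
near=> n; apply: H; last by rewrite gt_eqF// invr_gt0.
rewrite /ball/= sub0r normrN gtr0_norm ?invr_gt0//.
near: n; exact: (near_infty_natSinv_lt (PosNum r0)).
Unshelve. all: by end_near. Qed.

End measurable_derivative.

(** * Paths of finite energy *)

Section paths.
Context {R : realType} {d : nat}.
Local Notation leb := (@lebesgue_measure R).
Implicit Types (gamma : R -> 'rV[R]_d) (t : R).

Lemma trivIset_itv_family (s : seq (R * R)) :
  pairwise (fun I J : R * R => (I.2 <= J.1) || (J.2 <= I.1)) s ->
  trivIset [set: 'I_(size s)] (fun k =>
    `](tnth (in_tuple s) k).1, (tnth (in_tuple s) k).2[%classic).
Proof.
move=> ps; move=> j k _ _ [x [/=]]; rewrite !in_itv/= => /andP[jx xj] /andP[kx xk].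
apply: val_inj => /=; apply/eqP; rewrite eq_le !leNgt -negb_or.
apply/negP => jk.
have sym (m n : 'I_(size s)) : (m < n)%N ->
   (tnth (in_tuple s) m).2 <= (tnth (in_tuple s) n).1 \/
   (tnth (in_tuple s) n).2 <= (tnth (in_tuple s) m).1.
  move=> mn; rewrite !(tnth_nth (0, 0))/=; apply/orP.
  by move/(pairwiseP (0, 0)) : ps => /(_ m n); apply; rewrite ?inE ?ltn_ord.
have : (j < k)%N \/ (k < j)%N by move: jk; rewrite orbC => /orP.
by case=> /sym []; lra.
Qed.

Lemma abs_continuous_coord t gamma i :
  abs_continuous t gamma -> ac_on t (fun s => gamma s ord0 i).
Proof.
move=> ac e e0; have [delta delta0 H] := ac e e0; exists delta => // s.
move=> /andP[/allP s0t ps] ls.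
have tI (k : 'I_(size s)) := mem_tnth k (in_tuple s).
have := H (size s) (fun k => (tnth (in_tuple s) k).1) (fun k => (tnth (in_tuple s) k).2).
move=> /(_ (fun k => and3P (s0t _ (tI k)))).
have E (F : R * R -> R) :
    \sum_(J <- s) F J = \sum_(k < size s) F (tnth (in_tuple s) k) by exact: big_tnth.
move: ls; rewrite /total_length /oscillation (E (fun J => J.2 - J.1)) => ls h.
rewrite (E (fun J => `|gamma J.2 ord0 i - gamma J.1 ord0 i|)).
apply: le_trans (ltW (h _ ls)).
  apply: ler_sum => k _.
  set u := tnth _ _; have := coord_le_enorm (gamma u.2 - gamma u.1) i.
  by rewrite !mxE.
exact: trivIset_itv_family.
Qed.

Lemma abs_continuous_density t gamma : 0 <= t -> abs_continuous t gamma ->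
  exists v : R -> 'rV[R]_d,
  [/\ forall i, leb.-integrable setT (fun s => (v s ord0 i)%:E),
      forall i a b, 0 <= a -> a <= b -> b <= t ->
        gamma b ord0 i - gamma a ord0 i = \int[leb]_(s in `[a, b]) v s ord0 i &
      {ae leb, forall s, 0 < s < t -> derivable gamma s 1 /\ derive1 gamma s = v s}].
Proof.
move=> t0 ac.
have /choice[f fP] : forall i : 'I_d, exists f : R -> R,
    [/\ leb.-integrable setT (EFin \o f),
    forall a b, 0 <= a -> a <= b -> b <= t ->
      gamma b ord0 i - gamma a ord0 i = \int[leb]_(x in `[a, b]) f x &
    {ae leb, forall s, 0 < s < t -> derivable (fun s => gamma s ord0 i) s 1 /\
       derive1 (fun s => gamma s ord0 i) s = f s}].
  by move=> i; exact: ac_derivative (abs_continuous_coord i ac).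
exists (fun s => \row_i f i s); split.
- move=> i; have [+ _ _] := fP i.
  by apply: eq_integrable => // s _; rewrite mxE.
- move=> i a b a0 ab bt; have [_ + _] := fP i => /(_ a b a0 ab bt) ->.
  by apply: eq_Rintegral => s _; rewrite mxE.
(* The exceptional null sets are united over [nat], in which the coordinate indices are embedded. *)
- have : {ae leb, forall s, forall n : nat, forall i : 'I_d, n = i -> 0 < s < t ->
      derivable (fun s => gamma s ord0 i) s 1 /\
      derive1 (fun s => gamma s ord0 i) s = f i s}.
    apply: ae_foralln => n; have [nd|dn] := ltnP n d; last first.
      by apply: aeW => s i ni; move: dn; rewrite ni leqNgt ltn_ord.
    have [_ _] := fP (Ordinal nd); apply: filterS.
      exact: (ae_filter_ringOfSetsType leb).
    by move=> s H i ni; rewrite (_ : i = Ordinal nd)//; exact: val_inj.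
  apply: filterS; first exact: (ae_filter_ringOfSetsType leb).
  move=> s H st.
  have dg : derivable gamma s 1.
    apply/derivable_mxP => k i; rewrite ord1.
    by have [] := H i i erefl st.
  split => //; apply/rowP => i; rewrite mxE.
  have [_ <-] := H i i erefl st.
  by rewrite !derive1E derive_mx// mxE.
Qed.

#[local] Instance ae_lebesgue_filter : Filter (nbhs (almost_everywhere leb)).
Proof. exact: (ae_filter_ringOfSetsType leb). Qed.

Lemma integrable_EFin_sum (D : set R) (n : nat) (f : 'I_n -> R -> R) : measurable D ->
  (forall i, leb.-integrable D (fun s => (f i s)%:E)) ->
  leb.-integrable D (fun s => (\sum_(i < n) f i s)%:E).
Proof.
move=> mD intf.
have := @integrable_sum _ _ _ leb _ mD _ (index_enum 'I_n) xpredT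
  (fun i s => (f i s)%:E) (fun i _ => intf i).
by apply: eq_integrable => // s _; rewrite sumEFin.
Qed.

Lemma ae_neq (c : R) : {ae leb, forall s, s != c}.
Proof.
exists [set c]; split; [exact: measurable_set1|exact: lebesgue_measure_set1|].
by move=> s /= /negP; rewrite negbK => /eqP.
Qed.

Lemma integral_cst_itv (a b c : R) : a <= b ->
  (\int[leb]_(s in `[a, b]) c%:E = (c * (b - a))%:E)%E.
Proof.
move=> ab; have E : leb `[a, b]%classic = (b - a)%:E.
  rewrite [LHS]lebesgue_measure_itv/= lte_fin.
  by case: ltgtP ab => // -> _; rewrite subrr.
by rewrite (integral_cst leb (measurable_itv _) c%:E) [X in (_ * X)%E]E -EFinM.
Qed.

Lemma ae_derive1 t gamma (v : R -> 'rV[R]_d) :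
  {ae leb, forall s, 0 < s < t -> derivable gamma s 1 /\ derive1 gamma s = v s} ->
  {ae leb, forall s, 0 <= s <= t -> derive1 gamma s = v s}.
Proof.
move=> H.
apply: (@filterS3 _ _ ae_lebesgue_filter _ _ _ _ _ H (ae_neq 0) (ae_neq t)) => s h s0 st.
move=> /andP[s0' st']; apply h.
by rewrite !lt_neqAle s0' st' eq_sym s0 st.
Qed.

Lemma measurable_enorm_derive1 t gamma :
  measurable_fun `[0, t] (derive1 gamma : R -> borelRd R d) ->
  measurable_fun `[0, t] (fun s => enorm (derive1 gamma s)).
Proof. by move=> mg; exact: measurableT_comp measurable_enorm mg. Qed.

Lemma sub_itv t (a b : R) : 0 <= a -> b <= t ->
  [set` `[a, b]] `<=` [set` `[0, t]].
Proof.
by move=> a0 bt s /=; rewrite !in_itv/= => /andP[h1 h2]; rewrite (le_trans a0 h1) (le_trans h2).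
Qed.

(** The density [v] of [gamma] is tested against the total increment [D]: [|D|^2] is the integral of
    the product of [D] and [v], at most [|D|] times the integral of [|v|] by Cauchy-Schwarz. *)
Lemma path_increment_le t gamma a b : abs_continuous t gamma ->
  measurable_fun `[0, t] (derive1 gamma : R -> borelRd R d) ->
  0 <= a -> a <= b -> b <= t ->
  ((enorm (gamma b - gamma a))%:E <=
    \int[leb]_(s in `[a, b]) (enorm (derive1 gamma s))%:E)%E.
Proof.
move=> ac mg a0 ab bt; have t0 : 0 <= t by rewrite (le_trans a0)// (le_trans ab).
have [v [iv vE /ae_derive1 v'E]] := abs_continuous_density t0 ac.
have mv : measurable_fun setT (v : R -> borelRd R d).
  apply: measurable_fun_rV => i.
  exact: (measurable_EFinP _ _).1 (measurable_int _ (iv i)).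
have mev : measurable_fun setT (fun s => enorm (v s)).
  exact: measurableT_comp measurable_enorm mv.
have -> : (\int[leb]_(s in `[a, b]) (enorm (derive1 gamma s))%:E =
    \int[leb]_(s in `[a, b]) (enorm (v s))%:E)%E.
  apply: ae_eq_integral => //.
  - apply/measurable_EFinP; apply: measurable_funS (measurable_enorm_derive1 mg) => //.
    exact: sub_itv.
  - by apply/measurable_EFinP; exact: measurable_funTS.
  - apply: filterS v'E => s H /(sub_itv a0 bt); rewrite /= in_itv/= => /H -> //.
set D := gamma b - gamma a.
have [->|D0] := eqVneq (enorm D) 0.
  by apply: integral_ge0 => s _; rewrite lee_fin enorm_ge0.
have {}D0 : 0 < enorm D by rewrite lt_neqAle eq_sym D0 enorm_ge0.
rewrite -(@lee_pmul2l _ (enorm D)%:E) ?lte_fin// -EFinM -expr2 sqr_enorm.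
have iva i : leb.-integrable `[a, b] (fun s => (v s ord0 i)%:E).
  by apply: (integrableS measurableT _ _ (iv i)).
have ivD (i : 'I_d) : leb.-integrable `[a, b] (fun s => (D ord0 i * v s ord0 i)%:E).
  have := @integrableZl _ _ _ leb _ (measurable_itv `[a, b]) (D ord0 i) _ (iva i).
  by apply: eq_integrable.
have <- : (\int[leb]_(s in `[a, b]) ((enorm D)%:E * (enorm (v s))%:E) =
    (enorm D)%:E * \int[leb]_(s in `[a, b]) (enorm (v s))%:E)%E.
  rewrite ge0_integralZl//; try by apply/measurable_EFinP; exact: measurable_funTS.
    by move=> s _; rewrite lee_fin enorm_ge0.
  by rewrite lee_fin enorm_ge0.
have -> : (\sum_(i < d) D ord0 i ^+ 2)%:E =
    (\int[leb]_(s in `[a, b]) (\sum_(i < d) D ord0 i * v s ord0 i)%:E)%E.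
  under [RHS]eq_integral do rewrite -sumEFin.
  rewrite integral_sum// -sumEFin; apply: eq_bigr => i _.
  have DE : D ord0 i = \int[leb]_(s in `[a, b]) v s ord0 i by rewrite /D !mxE -vE.
  transitivity ((D ord0 i)%:E * \int[leb]_(s in `[a, b]) (v s ord0 i)%:E)%E.
    by rewrite expr2 {2}DE /Rintegral EFinM fineK//; exact: integrable_fin_num.
  by rewrite -integralZl.
apply: le_integral => //.
- exact: integrable_EFin_sum.
- apply: (@integrableZl _ _ _ leb _ (measurable_itv _) (enorm D) (fun s => (enorm (v s))%:E)).
  apply: (@le_integrable _ _ _ leb _ (measurable_itv _) (fun s => (enorm (v s))%:E)
    (fun s => (\sum_(i < d) `|v s ord0 i|)%:E)) => //.
  + by apply/measurable_EFinP; exact: measurable_funTS.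
  + move=> s _ /=; rewrite lee_fin ger0_norm ?enorm_ge0// ger0_norm ?sumr_ge0//.
    exact: enorm_le_sum.
  + apply: (integrable_EFin_sum (f := fun i s => `|v s ord0 i|)) => // i.
    exact: (integrable_abse (iva i)).
- by move=> s _; rewrite lee_fin dot_le_enorm.
Qed.

Definition path_energy (p t : R) gamma : \bar R :=
  (\int[leb]_(s in `[0%R, t]) (enorm (derive1 gamma s) `^ p)%:E)%E.

(** Energy of the uniform motion between the two positions, which is the least energy of a path
    joining them in that time. It vanishes on a degenerate interval, where the increment is zero. *)
Definition itv_energy (p : R) gamma (I : R * R) : R :=
  (I.2 - I.1) `^ (1 - p) * enorm (gamma I.2 - gamma I.1) `^ p.

Lemma itv_energy_ge0 p gamma I : 0 <= itv_energy p gamma I.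
Proof. by rewrite mulr_ge0// powR_ge0. Qed.

Lemma itv_energy_le p t gamma a b : 1 < p -> abs_continuous t gamma ->
  measurable_fun `[0, t] (derive1 gamma : R -> borelRd R d) ->
  0 <= a -> a <= b -> b <= t ->
  ((itv_energy p gamma (a, b))%:E <=
   \int[leb]_(s in `]a, b[) (enorm (derive1 gamma s) `^ p)%:E)%E.
Proof.
move=> p1 ac mg a0 ab bt.
have mgab : measurable_fun `[a, b] (fun s => enorm (derive1 gamma s)).
  by apply: measurable_funS (measurable_enorm_derive1 mg) => //; exact: sub_itv.
have mgpab : measurable_fun `[a, b] (fun s => enorm (derive1 gamma s) `^ p).
  exact: (measurableT_comp (measurable_powR _)).
have -> : (\int[leb]_(s in `]a, b[) (enorm (derive1 gamma s) `^ p)%:E =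
    \int[leb]_(s in `[a, b]) (enorm (derive1 gamma s) `^ p)%:E)%E.
  apply/esym/integral_itv_bndoo; apply/measurable_EFinP.
  by apply: measurable_funS mgpab => //; exact: subset_itv_oo_cc.
move: ab; rewrite le_eqVlt => /predU1P[<-|ab].
  rewrite /itv_energy/= !subrr enorm0 [X in _ * X]powR0 ?mulr0; last by rewrite gt_eqF//; lra.
  by apply: integral_ge0 => s _; rewrite lee_fin powR_ge0.
have ba0 : 0 < b - a by rewrite subr_gt0.
have i1 : (\int[leb]_(s in `[a, b]) (cst 1 s)%:E = (b - a)%:E)%E.
  by rewrite integral_cst_itv ?mul1r// ltW.
have := @weighted_jensen R p p1 _ _ leb `[a, b]%classic
  (fun s => enorm (derive1 gamma s)) (cst 1) (b - a).
move=> /(_ (measurable_itv _) mgab (measurable_cst _)).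
move=> /(_ (fun s _ => enorm_ge0 _) (fun s _ => ltr01) ba0).
move=> /(_ i1).
under [X in (_ * X)%E]eq_integral do rewrite powR1 mul1r.
move=> h; rewrite -(@lee_pmul2l _ ((b - a) `^ (p - 1))%:E) ?lte_fin ?powR_gt0//.
apply: le_trans h.
rewrite /itv_energy/= -EFinM mulrA -powRD; last by rewrite (gt_eqF ba0) implybT.
have -> : p - 1 + (1 - p) = 0 by ring.
rewrite powRr0 mul1r -poweR_EFin.
apply: gt0_ler_poweR; rewrite ?in_itv/= ?leey ?lee_fin ?enorm_ge0 ?andbT//.
- by lra.
- by apply: integral_ge0 => s _; rewrite lee_fin enorm_ge0.
- exact: path_increment_le ac mg a0 (ltW ab) bt.
Qed.

(** For a path of class [ACp] that is constant outside [[0, t]], the supremum over families is the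
    energy: [family_energy_le] gives one inequality and [path_energy_le_bound] the other. *)
Definition family_energy p gamma (s : seq (R * R)) := \sum_(I <- s) itv_energy p gamma I.

Lemma family_integral_le t s (f : R -> R) : measurable_fun `[0, t] f ->
  (forall x, 0 <= f x) -> itv_family t s ->
  (\sum_(I <- s) \int[leb]_(x in `]I.1, I.2[) (f x)%:E <=
   \int[leb]_(x in `[0%R, t]) (f x)%:E)%E.
Proof.
move=> mf f0 /andP[/allP s0t ps]; rewrite big_tnth.
pose F (k : 'I_(size s)) := `](tnth (in_tuple s) k).1, (tnth (in_tuple s) k).2[%classic.
have F0t : \big[setU/set0]_(k < size s) F k `<=` `[0, t].
  rewrite -bigcup_seq => x [k _] /=; rewrite /F/= !in_itv/= => /andP[h1 h2].
  have /and3P[? ? ?] := s0t _ (mem_tnth k (in_tuple s)).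
  by apply/andP; split; lra.
have mfE : measurable_fun `[0, t] (fun x => (f x)%:E) by exact/measurable_EFinP.
rewrite (_ : (\sum_(k < size s) _)%E =
    (\sum_(k < size s) \int[leb]_(x in F k) (f x)%:E)%E)//.
rewrite -ge0_integral_bigsetU//=.
- apply: ge0_subset_integral => //.
    by apply: bigsetU_measurable => k _; exact: measurable_itv.
  by move=> x _; rewrite lee_fin.
- by move=> k; exact: measurable_itv.
- exact: index_enum_uniq.
- by apply: sub_trivIset (trivIset_itv_family ps).
- by apply: measurable_funS mfE.
- by move=> x _; rewrite lee_fin.
Qed.

Lemma family_energy_le p t gamma s : 1 < p -> abs_continuous t gamma ->
  measurable_fun `[0, t] (derive1 gamma : R -> borelRd R d) ->
  itv_family t s -> ((family_energy p gamma s)%:E <= path_energy p t gamma)%E.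
Proof.
move=> p1 ac mg fs.
have mf : measurable_fun `[0, t] (fun s => enorm (derive1 gamma s) `^ p).
  apply/(measurableT_comp (measurable_powR _)).
  exact: measurable_enorm_derive1.
apply: le_trans (family_integral_le mf (fun x => powR_ge0 _ _) fs).
rewrite /family_energy -sumEFin big_seq [leRHS]big_seq.
apply: lee_sum => -[a b] abs.
have /andP[/allP /(_ _ abs)/and3P[a0 ab bt] _] := fs.
exact: itv_energy_le ac mg _ _ _.
Qed.

Lemma total_length_le t s : 0 <= t -> itv_family t s -> total_length s <= t.
Proof.
move=> t0 fs; have := family_integral_le (measurable_cst (1 : R)) (fun _ => ler01) fs.
rewrite integral_cst_itv// mul1r subr0 -lee_fin; apply: le_trans.
rewrite /total_length -sumEFin big_seq [leRHS]big_seq; apply: lee_sum => -[a b] abs.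
have /andP[/allP /(_ _ abs)/and3P[/= a0 ab bt] _] := fs.
rewrite -(integral_itv_bndoo (f := fun=> 1%E) true false); last exact: measurable_cst.
by rewrite integral_cst_itv// mul1r.
Qed.

End paths.

(** * Paths characterized by the energy of their increments *)

Section energy_bounds.
Context {R : realType} {d : nat} (p t : R) (gamma : R -> 'rV[R]_d) (C : R).
Local Notation leb := (@lebesgue_measure R).
Hypothesis p1 : 1 < p.
Hypothesis t0 : 0 <= t.

Lemma powR_small (e : R) : 0 <= C -> 0 < e -> exists2 M : R, 0 < M & M `^ (1 - p) * C <= e.
Proof.
move=> C0 e0; have Ce0 : 0 < (C + 1) / e by rewrite divr_gt0//; lra.
have q0 : p - 1 != 0 by rewrite gt_eqF// subr_gt0.
exists (((C + 1) / e) `^ (p - 1)^-1); first exact: powR_gt0.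
rewrite -powRrM -(opprB p 1) mulrN mulVf// powR_inv1 ?(ltW Ce0)//.
by rewrite invf_div mulrAC ler_pdivrMr ?ler_pM2l//; lra.
Qed.

(** The bound [powR_le_linear] for the mean speed over [[a, b]], multiplied by [b - a]. Summed over
    a family, it controls oscillations by length and energy, which gives both continuity and
    absolute continuity. *)
Lemma increment_le_linear (M a b : R) : 0 < M -> a <= b ->
  enorm (gamma b - gamma a) <= M * (b - a) + M `^ (1 - p) * itv_energy p gamma (a, b).
Proof.
move=> M0; rewrite le_eqVlt => /predU1P[<-|ab].
  rewrite !subrr enorm0 mulr0 add0r mulr_ge0 ?powR_ge0//; exact: itv_energy_ge0.
have ba0 : 0 < b - a by rewrite subr_gt0.
have := powR_le_linear p1 M0 (divr_ge0 (enorm_ge0 (gamma b - gamma a)) (ltW ba0)).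
rewrite -(ler_pM2l ba0) mulrCA divff ?mulr1; last by rewrite gt_eqF.
move=> /le_trans; apply; rewrite mulrDr mulrC lerD2l mulrCA ler_pM2l ?powR_gt0//.
rewrite /itv_energy/= powRM ?enorm_ge0 ?invr_ge0 ?(ltW ba0)//.
rewrite -powR_inv1 ?(ltW ba0)// -powRrM mulN1r mulrCA mulrC ler_wpM2r ?powR_ge0//.
by rewrite -{1}(powRr1 (ltW ba0)) -powRD// (gt_eqF ba0) implybT.
Qed.

Hypothesis clampG : forall s, gamma (clamp t s) = gamma s.
Hypothesis energyG : forall s, itv_family t s -> family_energy p gamma s <= C.

Lemma energy_bound_ge0 : 0 <= C.
Proof. by have := energyG (s := [::]) isT; rewrite /family_energy big_nil. Qed.

Lemma energy_bound_oscillation (M : R) s : 0 < M -> itv_family t s ->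
  \sum_(I <- s) enorm (gamma I.2 - gamma I.1) <= M * total_length s + M `^ (1 - p) * C.
Proof.
move=> M0 fs; rewrite (@le_trans _ _ (M * total_length s + M `^ (1 - p) * family_energy p gamma s))//.
  rewrite /total_length /family_energy !mulr_sumr -big_split/= big_seq [leRHS]big_seq.
  apply: ler_sum => -[a b] abs; apply: increment_le_linear => //=.
  by move: fs => /andP[/allP /(_ _ abs)/and3P[]].
by rewrite lerD2l ler_pM2l ?powR_gt0// energyG.
Qed.

Lemma energy_bound_increment (M a b : R) : 0 < M -> a <= b ->
  enorm (gamma b - gamma a) <= M * (b - a) + M `^ (1 - p) * C.
Proof.
move=> M0 ab; rewrite -(clampG a) -(clampG b).
have /andP[a0 aT] := clamp_itv a t0; have /andP[b0 bT] := clamp_itv b t0.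
have cab := le_clamp t ab.
have := @energy_bound_oscillation M [:: (clamp t a, clamp t b)] M0.
rewrite /total_length !big_seq1/= => h; rewrite (le_trans (h _))//.
  by rewrite /itv_family/= a0 cab bT.
by rewrite lerD2r ler_pM2l// clampB_le.
Qed.

Lemma energy_bound_continuous : continuous gamma.
Proof.
move=> a; apply/(enorm_cvgP (F := nbhs a)) => e e0.
have [M M0 Me] := powR_small energy_bound_ge0 (divr_gt0 e0 (ltr0n _ 2)).
apply/nbhs_ballP; exists (e / 2 / M) => /=; first by rewrite !divr_gt0.
move=> b; rewrite /ball/= ltr_pdivlMr// mulrC => ab.
have [lab|lba] := leP a b.
  rewrite enormB (le_lt_trans (energy_bound_increment M0 lab))//.
  by move: ab; rewrite ler0_norm ?subr_le0//; lra.
rewrite (le_lt_trans (energy_bound_increment M0 (ltW lba)))//.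
by move: ab; rewrite ger0_norm ?subr_ge0 ?(ltW lba)//; lra.
Qed.

Lemma energy_bound_abs_continuous : abs_continuous t gamma.
Proof.
move=> e e0.
have [M M0 Me] := powR_small energy_bound_ge0 (divr_gt0 e0 (ltr0n _ 2)).
exists (e / 2 / M) => [|n a b ab tab lab]; first by rewrite !divr_gt0.
(* Degenerate intervals are dropped: having no interior, they are not separated from the others by
   disjointness. They contribute zero to both sums. *)
pose s := [seq (a i, b i) | i <- enum 'I_n & a i < b i].
have sE (F : R * R -> R) : (forall x, F (x, x) = 0) ->
    \sum_(i < n) F (a i, b i) = \sum_(I <- s) F I.
  move=> F0; rewrite /s big_map big_filter big_enum_cond/=.
  rewrite (bigID (fun i => a i < b i))/= addrC big1 ?add0r// => i.
  by rewrite -leNgt => bai; have [_ abi _] := ab i; rewrite (@le_anti _ _ (a i) (b i)) ?abi.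
have fs : itv_family t s.
  apply/andP; split.
    by apply/allP => _ /mapP[i _ ->] /=; have [-> -> ->] := ab i.
  rewrite /s pairwise_map.
  have : uniq [seq i <- enum 'I_n | a i < b i] by rewrite filter_uniq ?enum_uniq.
  rewrite uniq_pairwise; apply: (@sub_in_pairwise _ [pred i | a i < b i]).
    move=> i j; rewrite !inE => abi abj /= ij; have h := tab i j Logic.I Logic.I.
    apply/negP => /negP; rewrite negb_or -!ltNge => /andP[h1 h2].
    move/eqP: ij; apply; apply: h.
    exists ((Num.max (a i) (a j) + Num.min (b i) (b j)) / 2).
    by split; rewrite /= in_itv/= !maxEle !minEle; do 2 case: ifPn;
      rewrite -?ltNge => ? ?; apply/andP; split; lra.
  by apply/allP => i; rewrite mem_filter => /andP[].
rewrite (sE (fun I => enorm (gamma I.2 - gamma I.1))); last by move=> x; rewrite subrr enorm0.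
move: lab; rewrite (sE (fun I => I.2 - I.1)); last by move=> x; rewrite subrr.
rewrite -/(total_length s) ltr_pdivlMr// mulrC => ls.
by rewrite (le_lt_trans (energy_bound_oscillation M0 fs))//; lra.
Qed.

Lemma continuous_measurable_derive1 : continuous gamma ->
  measurable_fun setT (derive1 gamma : R -> borelRd R d).
Proof.
move=> cg; have := @measurable_derive1 R d _ unit (fun _ => gamma)
  (fun s => measurable_cst _) (fun _ => cg).
by move=> /(measurable_fun_pair2 tt).
Qed.

Lemma limn_einf_le (u : (\bar R)^nat) (c : \bar R) :
  (forall n, u n <= c)%E -> (limn_einf u <= c)%E.
Proof.
move=> uc; rewrite limn_einf_lim; apply: lime_le; first exact: is_cvg_einfs.
by apply: nearW => n; apply: le_trans (uc n); apply: ereal_inf_lbound; exists n => /=.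
Qed.

Lemma limn_einf_ge0 (u : (\bar R)^nat) : (forall n, 0 <= u n)%E -> (0 <= limn_einf u)%E.
Proof.
move=> u0; rewrite limn_einf_lim; apply: lime_ge; first exact: is_cvg_einfs.
by apply: nearW => n; apply: le_ereal_inf_tmp => _ [m /= _ <-].
Qed.

Lemma measurable_fun_limn_einf d' (T : measurableType d') (D : set T) (f : (T -> \bar R)^nat) :
  (forall n, measurable_fun D (f n)) ->
  measurable_fun D (fun x => limn_einf (f ^~ x)).
Proof.
move=> mf; rewrite (_ : (fun x => _) = (fun x => - limn_esup (fun n => - f n x))%E).
  by apply: measurableT_comp => //; apply: measurable_fun_limn_esup => n; exact: measurableT_comp.
apply/funext => x; rewrite -limn_einfN; congr limn_einf.
by apply/funext => n /=; rewrite oppeK.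
Qed.

Let dt (n : nat) : R := t / n.+1%:R.
Let node (n k : nat) : R := k%:R * dt n.
Let piece (n k : nat) : set R := `[node n k, node n k.+1[%classic.

Hypothesis tgt0 : 0 < t.

Let dt0 n : 0 < dt n. Proof. by rewrite divr_gt0// ltr0n. Qed.

Let nodeS n k : node n k.+1 = node n k + dt n.
Proof. by rewrite /node -natr1 mulrDl mul1r. Qed.

Let node_le n k j : (k <= j)%N -> node n k <= node n j.
Proof. by move=> kj; rewrite ler_wpM2r ?(ltW (dt0 n))// ler_nat. Qed.

Let node_last n : node n n.+1 = t.
Proof. by rewrite /node /dt mulrC divfK// pnatr_eq0. Qed.

(** Energy density of the affine interpolation of [gamma] at the nodes. Its integral is a family
    energy, hence at most [C]. *)
Let step (n : nat) (s : R) : R :=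
  let k := Num.truncn (s / dt n) in
  (enorm (gamma (node n k.+1) - gamma (node n k)) / dt n) `^ p.

Let step_piece n k s : piece n k s ->
  step n s = (enorm (gamma (node n k.+1) - gamma (node n k)) / dt n) `^ p.
Proof.
rewrite /piece/= in_itv/= => /andP[h1 h2]; rewrite /step.
rewrite (@truncn_def _ _ k)//.
by rewrite ler_pdivlMr// ltr_pdivrMr// h1 h2.
Qed.

Let pieces n : \big[setU/set0]_(k <- iota 0 n.+1) piece n k = `[0, t[%classic.
Proof.
apply/seteqP; split => s; rewrite -bigcup_seq.
  move=> [k]; rewrite /mkset mem_iota => /andP[_ kn]; rewrite add0n in kn; rewrite /piece/= !in_itv/= => /andP[h1 h2].
  apply/andP; split.
    by rewrite (le_trans _ h1)// mulr_ge0 ?ler0n// ltW.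
  by rewrite (lt_le_trans h2)// -(node_last n) node_le.
rewrite /= in_itv/= => /andP[s0 st]; exists (Num.truncn (s / dt n)).
  change (is_true (Num.truncn (s / dt n) \in iota 0 n.+1)).
  rewrite mem_iota add0n leq0n /= truncn_lt_nat ?divr_ge0 ?(ltW (dt0 _))//.
  by rewrite ltr_pdivrMr//; rewrite -/(node n n.+1) node_last.
rewrite /piece/= in_itv/= /node -ler_pdivlMr// -ltr_pdivrMr//.
by apply: truncn_itv; rewrite divr_ge0// ltW.
Qed.

Let piece_disjoint n j k x : piece n j x -> piece n k x -> j = k.
Proof.
rewrite /piece/= !in_itv/= => /andP[j1 j2] /andP[k1 k2].
have [/(node_le n) h|/(node_le n) h|//] := ltngtP j k.
  by have := lt_le_trans j2 (le_trans h k1); rewrite ltxx.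
by have := lt_le_trans k2 (le_trans h j1); rewrite ltxx.
Qed.

Let measurable_step n : measurable_fun `[0, t[ (step n).
Proof.
rewrite -(pieces n) -bigcup_seq bigcup_mkcond; apply/measurable_fun_bigcup => [k|k].
  by case: ifPn => // _; exact: measurable_itv.
case: ifPn => _; last exact: measurable_fun_set0.
apply: (eq_measurable_fun (cst ((enorm (gamma (node n k.+1) - gamma (node n k)) / dt n) `^ p))).
  by move=> s; rewrite inE => /step_piece ->.
exact: measurable_cst.
Qed.

Let integral_step n : (\int[leb]_(s in `[0%R, t[) (step n s)%:E <= C%:E)%E.
Proof.
have mstep := measurable_step n.
rewrite -(pieces n) ge0_integral_bigsetU//; last 5 first.
- by move=> k; exact: measurable_itv.
- exact: iota_uniq.
- by move=> j k _ _ [x [xj xk]]; exact: piece_disjoint xj xk.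
- by rewrite pieces; apply/measurable_EFinP.
- by move=> s _; rewrite lee_fin powR_ge0.
pose s := [seq (node n k, node n k.+1) | k <- iota 0 n.+1].
have fs : itv_family t s.
  apply/andP; split.
    apply/allP => _ /mapP[k + ->]; rewrite mem_iota add0n => /andP[_ kn] /=.
    by rewrite mulr_ge0 ?ler0n ?(ltW (dt0 n))// node_le// -(node_last n) node_le.
  rewrite /s pairwise_map; have : pairwise ltn (iota 0 n.+1).
    by rewrite -sorted_pairwise ?iota_ltn_sorted//; exact: ltn_trans.
  apply: sub_pairwise => j k /= jk; by rewrite node_le.
apply: le_trans (_ : ((family_energy p gamma s)%:E <= C%:E)%E); last first.
  by rewrite lee_fin energyG.
rewrite /family_energy /s big_map -sumEFin; apply: lee_sum => k _.
rewrite (eq_integral (cst ((enorm (gamma (node n k.+1) - gamma (node n k)) / dt n) `^ p)%:E)); last first.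
  by move=> x; rewrite inE => /step_piece ->.
rewrite integral_cst; last exact: measurable_itv.
rewrite [X in (_ * X)%E]lebesgue_measure_itv/= lte_fin nodeS ltrDl dt0 -EFinB -EFinM lee_fin.
rewrite /itv_energy/= addrAC subrr add0r.
rewrite powRM ?enorm_ge0 ?invr_ge0 ?(ltW (dt0 n))// -powR_inv1 ?(ltW (dt0 n))// -powRrM mulN1r.
rewrite -mulrA mulrC ler_wpM2r ?powR_ge0//.
by rewrite -{2}(powRr1 (ltW (dt0 n))) -powRD ?(gt_eqF (dt0 n)) ?implybT// addrC.
Qed.

(** A time falls between two nodes, so its difference quotients are taken over intervals that
    contain it without starting there; the increment is split at [s]. *)
Lemma straddle_derivative (s e : R) : derivable gamma s 1 -> 0 < e ->
  exists2 delta, 0 < delta & forall a b, a <= s -> s <= b -> b - a < delta ->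
    enorm (gamma b - gamma a - (b - a) *: derive1 gamma s) <= e * (b - a).
Proof.
move=> dg e0.
have dl : growth gamma s h @[h --> 0^'] --> derive1 gamma s.
  by move: dg; rewrite derivable_growthE.
have [delta /= delta0 H] := (enorm_cvgP (growth gamma s) _).1 dl _ e0.
have {}H h : `|h| < delta ->
    enorm (gamma (h + s) - gamma s - h *: derive1 gamma s) <= e * `|h|.
  move=> hd; have [->|h0] := eqVneq h 0.
    by rewrite add0r scale0r !subrr enorm0 normr0 mulr0.
  have := H h; rewrite /ball/= sub0r normrN => /(_ hd h0)/ltW.
  have n0 : 0 < `|h| by rewrite normr_gt0.
  rewrite -(ler_pM2l n0) -enormZ mulrC enormB; apply: le_trans.
  by rewrite scalerBr /growth scalerA divff// scale1r enormB enormB.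
exists delta => // a b as_ sb bad.
have hb := H (b - s); have ha := H (a - s).
rewrite !subrK ger0_norm ?subr_ge0// in hb.
rewrite !subrK ler0_norm ?subr_le0// in ha.
have -> : gamma b - gamma a - (b - a) *: derive1 gamma s =
   (gamma b - gamma s - (b - s) *: derive1 gamma s) -
   (gamma a - gamma s - (a - s) *: derive1 gamma s).
  by apply/rowP => i; rewrite !mxE; ring.
rewrite (le_trans (enormD _ _))// enormN.
have /ha : - (a - s) < delta by lra.
have /hb : b - s < delta by lra.
lra.
Qed.

Let step_cvg s : 0 < s < t -> derivable gamma s 1 ->
  (enorm (gamma (node n (Num.truncn (s / dt n)).+1) -
    gamma (node n (Num.truncn (s / dt n)))) / dt n) @[n --> \oo] --> enorm (derive1 gamma s).
Proof.
move=> /andP[s0 st] dg; apply/cvgrPdist_le => e e0.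
have [delta delta0 H] := straddle_derivative dg e0.
near=> n; set k := Num.truncn _.
have := truncn_itv (divr_ge0 (ltW s0) (ltW (dt0 n))); rewrite -/k.
rewrite ler_pdivlMr// ltr_pdivrMr// => /andP[ks sk].
have := H (node n k) (node n k.+1) ks (ltW sk).
have -> : node n k.+1 - node n k = dt n by rewrite nodeS addrAC subrr add0r.
have dn : dt n < delta.
  rewrite /dt ltr_pdivrMr ?ltr0n// -ltr_pdivrMl// mulrC.
  near: n; exists (Num.truncn (t / delta)) => // m /= hm.
  have := truncn_itv (divr_ge0 (ltW tgt0) (ltW delta0)) => /andP[_ h].
  by rewrite (lt_le_trans h)// ler_nat ltnS.
move=> /(_ dn) h.
have -> : enorm (derive1 gamma s) = enorm (dt n *: derive1 gamma s) / dt n.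
  by rewrite enormZ gtr0_norm// mulrC mulKf// gt_eqF.
rewrite -mulrBl normrM normfV (gtr0_norm (dt0 n)) ler_pdivrMr//.
by rewrite (le_trans (enorm_lip _ _))// enormB.
Unshelve. all: by end_near. Qed.

(** Fatou's lemma: the densities of the interpolations converge to [|gamma'|^p] almost everywhere,
    and their integrals are at most [C]. *)
Lemma path_energy_le_bound : (path_energy p t gamma <= C%:E)%E.
Proof.
have mder : measurable_fun setT (fun s => (enorm (derive1 gamma s) `^ p)%:E).
  apply/measurable_EFinP/(measurableT_comp (measurable_powR _)).
  exact: measurableT_comp measurable_enorm (continuous_measurable_derive1 energy_bound_continuous).
rewrite /path_energy -integral_itv_bndo_bndc; last exact: measurable_funTS.
have mstep n : measurable_fun `[0, t[ (fun s => (step n s)%:E).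
  by apply/measurable_EFinP; exact: measurable_step.
apply: (@le_trans _ _ (\int[leb]_(s in `[0%R, t[) limn_einf (fun n => (step n s)%:E))%E).
  have [v [_ _ H]] := abs_continuous_density t0 energy_bound_abs_continuous.
  apply: ae_ge0_le_integral => //.
  - by move=> s _; rewrite lee_fin powR_ge0.
  - exact: measurable_funTS.
  - by move=> s _; apply: limn_einf_ge0 => n; rewrite lee_fin powR_ge0.
  - exact: measurable_fun_limn_einf.
  - apply: (@filterS2 _ _ (@ae_lebesgue_filter R) _ _ _ _ H (ae_neq 0)) => s {}H s0.
    rewrite /= in_itv/= => /andP[s0' st].
    have [|dg _] := H; first by rewrite lt_neqAle eq_sym s0 s0' st.
    have sc : 0 < s < t by rewrite lt_neqAle eq_sym s0 s0' st.
    (* The continuity of the power is taken from its derivability at a positive base; where the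
       derivative vanishes, the lower limit only has to be nonnegative. *)
    have [->|l0] := eqVneq (enorm (derive1 gamma s)) 0.
      rewrite powR0; last by rewrite gt_eqF// (lt_trans ltr01).
      by apply: limn_einf_ge0 => n; rewrite lee_fin powR_ge0.
    have {}l0 : 0 < enorm (derive1 gamma s) by rewrite lt_neqAle eq_sym l0 enorm_ge0.
    suff : (step n s)%:E @[n --> \oo] --> (enorm (derive1 gamma s) `^ p)%:E.
      by move=> /cvg_limn_einf_sup[-> _].
    apply: cvg_EFin; first exact: nearW.
    change (step n s @[n --> \oo] --> enorm (derive1 gamma s) `^ p).
    have cp : {for enorm (derive1 gamma s), continuous (fun x : R => x `^ p)}.
      apply: differentiable_continuous; apply/derivable1_diffP.
      by apply: derivable_powR; rewrite in_itv/= l0.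
    exact: (cvg_comp _ _ (step_cvg sc dg) cp).
apply: (le_trans (fatou leb (measurable_itv `[0, t[) mstep (fun n s _ => _))) => [n s _|].
  by rewrite lee_fin powR_ge0.
exact: limn_einf_le.
Qed.

End energy_bounds.

(** The criterion by which truncations, concatenations and pointwise limits of paths are recognized
    as paths of finite energy, with the right bound. *)
Lemma energy_bound_ACp {R : realType} {d : nat} (p t C : R) (gamma : R -> 'rV[R]_d) :
  1 < p -> 0 <= t -> (forall s, gamma (clamp t s) = gamma s) ->
  (forall s, itv_family t s -> family_energy p gamma s <= C) ->
  ACp p t gamma /\ (path_energy p t gamma <= C%:E)%E.
Proof.
move=> p1 t0 cg eg; have C0 := energy_bound_ge0 eg.
have mg : measurable_fun setT (derive1 gamma : R -> borelRd R d).
  apply: continuous_measurable_derive1; exact: energy_bound_continuous p1 t0 cg eg.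
have E : (path_energy p t gamma <= C%:E)%E.
  have [tgt0|t00] : 0 < t \/ t = 0 by move: t0; rewrite le_eqVlt => /predU1P[<-|]; auto.
    exact: path_energy_le_bound p1 t0 cg eg tgt0.
  by rewrite /path_energy t00 set_itv1 integral_set1 lee_fin.
split => //; split.
- exact: energy_bound_abs_continuous p1 eg.
- exact: measurable_funTS.
- split.
    by apply: measurable_funTS; exact: measurableT_comp measurable_enorm mg.
  apply: le_lt_trans (ltry C); apply: le_trans E; rewrite /path_energy.
  by under eq_integral do rewrite ger0_norm ?enorm_ge0//.
Qed.

(** * The value function *)

Section growth_bounds.
Context {R : realType} {d : nat} (p : R) (V : 'rV[R]_d -> R).
Hypothesis p1 : 1 < p.
Hypothesis cV : continuous V.
Let p0 : 0 < p. Proof. exact: lt_trans p1. Qed.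

Lemma enorm_ball_compact (rho : R) : compact [set x : 'rV[R]_d | enorm x <= rho].
Proof.
apply: bounded_closed_compact.
  exists rho; split; first exact: num_real.
  by move=> M rM x /= xr; rewrite (le_trans (norm_le_enorm x))// (le_trans xr)// ltW.
rewrite (_ : mkset _ = @enorm R d @^-1` [set r | r <= rho])//.
apply: closed_comp; last exact: closed_le.
by move=> x _; exact: enorm_continuous.
Qed.

(** Compactness bounds [V] on the ball outside which the growth assumption takes over. *)
Lemma bigO_power_bound : bigO_power p V ->
  exists2 K : R, 0 < K & forall x, `|V x| <= K * (1 + enorm x `^ p).
Proof.
move=> [C [M HV]].
have [|B [_ HB]] := @compact_bounded R R^o (V @` [set x | enorm x <= M]).
  apply: continuous_compact; last exact: (@enorm_ball_compact M).
  exact: continuous_subspaceT.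
pose B' := `|B| + 1; have B'0 : 0 <= B' by rewrite /B' addr_ge0.
exists (`|C| + B' + 1); first by rewrite ltr_wpDl// addr_ge0.
move=> x; have xp := powR_ge0 (enorm x) p.
have [xM|Mx] := leP (enorm x) M.
  rewrite (@le_trans _ _ B')//.
    by apply: (HB B'); [rewrite /B' ltr_pwDr// ler_norm|exists x].
  rewrite (@le_trans _ _ (`|C| + B' + 1))//.
    by rewrite -addrA ler_wpDl// lerDl.
  by rewrite ler_peMr ?lerDl// addr_ge0// addr_ge0.
rewrite (le_trans (HV _ (ltW Mx)))//.
apply: (@le_trans _ _ (`|C| * enorm x `^ p)).
  by rewrite ler_wpM2r// ler_norm.
apply: ler_pM => //; last by rewrite lerDr.
by rewrite -addrA lerDl addr_ge0.
Qed.

(** Uniform continuity near a compact ball, by the covering form of compactness; only [x] is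
    confined to the ball. *)
Lemma ball_unif_continuous (rho e : R) : 0 < e -> exists2 eta : R, 0 < eta &
  forall x z, enorm x <= rho -> enorm (z - x) < eta -> `|V z - V x| <= e.
Proof.
move=> e0; have := @enorm_ball_compact rho; rewrite compact_near_coveringP.
move=> /(_ R (0^'+) (fun eta x => forall z, enorm (z - x) < eta -> `|V z - V x| <= e) _).
move=> [x xr|r /= r0 H].
  have /cvgrPdist_lt/(_ (e / 2)) := @cV x; rewrite divr_gt0// => /(_ isT).
  move=> /nbhs_ballP[r /= r0 rV].
  have rV' y : enorm (x - y) < r -> `|V x - V y| < e / 2.
    by move=> xy; apply: rV; rewrite mx_norm_ball /ball_/= (le_lt_trans (norm_le_enorm _)).
  exists ([set y | enorm (x - y) < r / 2], [set eta | eta < r / 2]).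
    split; first by apply: (enorm_cvgP (F := nbhs x) id x).1; [exact: cvg_id|rewrite divr_gt0].
    by apply: nbhs_right_lt; rewrite divr_gt0.
  move=> [y eta] /= [xy er] z zy.
  have h1 : `|V x - V y| < e / 2 by apply: rV'; lra.
  have h2 : `|V x - V z| < e / 2.
    by apply: rV'; rewrite (le_lt_trans (enorm_triangle y _ _))// (enormB y); lra.
  rewrite (_ : V z - V y = (V x - V y) - (V x - V z)); last by ring.
  by rewrite (le_trans (ler_normB _ _))//; lra.
exists (r / 2); first by rewrite divr_gt0.
move=> x z xr zx; apply: (H (r / 2)) => //.
- by rewrite /ball/= sub0r normrN gtr0_norm ?divr_gt0//; lra.
- by rewrite divr_gt0.
Qed.

Definition tail (rho : R) (x : 'rV[R]_d) : R :=
  if enorm x <= rho then 0 else 1 + enorm x `^ p.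

Lemma tail_ge0 rho x : 0 <= tail rho x.
Proof. by rewrite /tail; case: ifPn => // _; rewrite addr_ge0 ?powR_ge0. Qed.

Let num_le (q y : R) : 0 < q -> 0 <= y -> 2 + (q + 1) * y <= (q + 2) * (1 + y).
Proof. by move=> q0 y0; nra. Qed.

Let num_le2 (k q x y z : R) : 0 <= k -> z <= q * (x + y) ->
  k * (1 + z) + k * (1 + x) <= k * (2 + (q + 1) * x) + k * q * y.
Proof. by move=> k0 h; nra. Qed.

Lemma enorm_powRD_le (x y : 'rV[R]_d) : enorm (x + y) `^ p <= 2 `^ p * (enorm x `^ p + enorm y `^ p).
Proof.
apply: le_trans (powRD_le p1 (enorm_ge0 x) (enorm_ge0 y)).
by apply: ge0_ler_powR; rewrite ?nnegrE ?addr_ge0 ?enorm_ge0 ?enormD// ltW.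
Qed.

(* Only the tail at [x] appears, so that along a coupling the error depends on
   a single, fixed, marginal. *)
Lemma continuity_modulus (K : R) : 0 < K -> (forall x, `|V x| <= K * (1 + enorm x `^ p)) ->
  forall e rho, 0 < e -> exists2 K', 0 <= K' & forall x z,
  `|V z - V x| <= e + K' * enorm (z - x) `^ p + K * (2 `^ p + 2) * tail rho x.
Proof.
move=> K0 VK e rho e0; have [eta eta0 H] := ball_unif_continuous rho e0.
have q0 : 0 < 2 `^ p :> R by rewrite powR_gt0.
have Vzx x z : `|V z - V x| <= K * (2 + (2 `^ p + 1) * enorm x `^ p) +
    K * 2 `^ p * enorm (z - x) `^ p.
  rewrite (le_trans (ler_normB _ _))// (le_trans (lerD (VK z) (VK x)))//.
  have : enorm z `^ p <= 2 `^ p * (enorm x `^ p + enorm (z - x) `^ p).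
    by rewrite -{1}(subrKC x z); exact: enorm_powRD_le.
  by move=> h; apply: (num_le2 (ltW K0) h).
(* For [|x| <= rho] and [|z - x| >= eta], the quotient [|z - x|^p / eta^p] is at least [1] and
   absorbs a bound that depends on [rho] only. *)
pose K1 := K * (2 + (2 `^ p + 1) * `|rho| `^ p) / (eta `^ p) + K * 2 `^ p.
have ep0 : 0 < eta `^ p by rewrite powR_gt0.
have K1ge : K * 2 `^ p <= K1.
  rewrite /K1 lerDr divr_ge0 ?(ltW ep0)//.
  by rewrite mulr_ge0 ?(ltW K0)// addr_ge0// mulr_ge0 ?powR_ge0// addr_ge0// ltW.
have K10 : 0 <= K1.
  rewrite /K1 addr_ge0 ?(mulr_ge0 (ltW K0) (ltW q0))// divr_ge0 ?(ltW ep0)//.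
  by rewrite mulr_ge0 ?(ltW K0)// addr_ge0// mulr_ge0 ?powR_ge0// addr_ge0// ltW.
exists K1 => // x z.
have zx0 := powR_ge0 (enorm (z - x)) p; have x0 := powR_ge0 (enorm x) p.
have [xr|rx] := leP (enorm x) rho; last first.
  rewrite /tail ifN -?ltNge// (le_trans (Vzx x z))//.
  have h1 : K * 2 `^ p * enorm (z - x) `^ p <= K1 * enorm (z - x) `^ p.
    by rewrite ler_wpM2r.
  have h2 : K * (2 + (2 `^ p + 1) * enorm x `^ p) <= K * (2 `^ p + 2) * (1 + enorm x `^ p).
    by rewrite -mulrA ler_pM2l//; apply: num_le.
  by rewrite (le_trans (lerD h2 h1))// [leRHS]addrC lerD2l lerDr ltW.
rewrite /tail xr mulr0 addr0.
have [zx|zx] := ltP (enorm (z - x)) eta.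
  by rewrite (le_trans (H x z xr zx))// lerDl mulr_ge0.
rewrite (le_trans (Vzx x z))// (@le_trans _ _ (K1 * enorm (z - x) `^ p))//; last first.
  by rewrite lerDr ltW.
rewrite /K1 [leRHS]mulrDl lerD2r.
have : enorm x `^ p <= `|rho| `^ p.
  apply: ge0_ler_powR; rewrite ?nnegrE ?enorm_ge0 ?(ltW p0)//.
  by rewrite (le_trans xr)// ler_norm.
have : eta `^ p <= enorm (z - x) `^ p.
  by apply: ge0_ler_powR; rewrite ?nnegrE ?enorm_ge0 ?(ltW p0) ?(ltW eta0).
move: ep0; set A := eta `^ p; set B := enorm _ `^ p; set D := enorm x `^ p.
set E := `|rho| `^ p => A0 AB DE.
have XY : 2 + (2 `^ p + 1) * D <= 2 + (2 `^ p + 1) * E.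
  by rewrite lerD2l ler_wpM2l// addr_ge0// ltW.
have Y0 : 0 <= 2 + (2 `^ p + 1) * E.
  by rewrite addr_ge0// mulr_ge0 ?powR_ge0// addr_ge0// ltW.
move: XY Y0; move: (2 + _) (2 + _) => X Y XY Y0.
rewrite -!mulrA ler_pM2l// (le_trans XY)// ler_peMr// mulrC ler_pdivlMr// mul1r.
exact: AB.
Qed.

End growth_bounds.

(** * Energy and action as real numbers *)

Section actions.
Context {R : realType} {d : nat} (p : R).
Local Notation leb := (@lebesgue_measure R).
Implicit Types (gamma zeta : R -> 'rV[R]_d).
Hypothesis p1 : 1 < p.
Let p0 : 0 < p. Proof. exact: lt_trans p1. Qed.

(** Fixes the values outside [[0, t]], so that the path is determined by its restriction; with
    finite energy it is then continuous on the whole line. *)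
Definition clamped t gamma := forall s, gamma (clamp t s) = gamma s.

Definition energy t gamma := fine (path_energy p t gamma).

Lemma path_energy_fin t gamma : ACp p t gamma -> path_energy p t gamma = (energy t gamma)%:E.
Proof.
move=> [_ _ [_ E]]; rewrite /energy fineK// ge0_fin_numE.
  apply: le_lt_trans E; rewrite /path_energy.
  by under [leRHS]eq_integral do rewrite ger0_norm ?enorm_ge0//.
by apply: integral_ge0 => s _; rewrite lee_fin powR_ge0.
Qed.

Lemma energy_ge0 t gamma : 0 <= energy t gamma.
Proof. by rewrite fine_ge0// integral_ge0// => s _; rewrite lee_fin powR_ge0. Qed.

Lemma ACp_family_energy_le t gamma s : ACp p t gamma -> itv_family t s ->
  family_energy p gamma s <= energy t gamma.
Proof.
move=> ac fs; rewrite -lee_fin -path_energy_fin//.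
by case: ac => ac mg _; exact: family_energy_le.
Qed.

Lemma energy_bound_energy t C gamma : 0 <= t -> clamped t gamma ->
  (forall s, itv_family t s -> family_energy p gamma s <= C) ->
  ACp p t gamma /\ energy t gamma <= C.
Proof.
move=> t0 cg eg; have [ac E] := energy_bound_ACp p1 t0 cg eg.
by split => //; move: E; rewrite path_energy_fin// lee_fin.
Qed.

Lemma clamp_family_energy t gamma s : itv_family t s ->
  family_energy p (gamma \o clamp t) s = family_energy p gamma s.
Proof.
move=> /andP[/allP s0t _]; apply: eq_big_seq => J /s0t/and3P[a0 ab bt]; rewrite /itv_energy/=.
by rewrite !clamp_id ?a0 ?bt ?(le_trans a0) ?(le_trans ab).
Qed.

Lemma clamped_clamp t gamma : 0 <= t -> clamped t (gamma \o clamp t).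
Proof. by move=> t0 s /=; rewrite clampK. Qed.

Lemma ACp_clamp t gamma : 0 <= t -> ACp p t gamma ->
  ACp p t (gamma \o clamp t) /\ energy t (gamma \o clamp t) <= energy t gamma.
Proof.
move=> t0 ac; apply: energy_bound_energy => //; first exact: clamped_clamp.
by move=> s fs; rewrite clamp_family_energy//; exact: ACp_family_energy_le.
Qed.

Lemma ACp_clamped_continuous t gamma : 0 <= t -> ACp p t gamma -> clamped t gamma ->
  continuous gamma.
Proof.
move=> t0 ac cg; apply: (energy_bound_continuous p1 t0 cg (C := energy t gamma)).
by move=> s; exact: ACp_family_energy_le.
Qed.

Lemma ACp_clamp_continuous t gamma : 0 <= t -> ACp p t gamma ->
  continuous (gamma \o clamp t).
Proof.
move=> t0 ac; have [ac' _] := ACp_clamp t0 ac.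
exact: ACp_clamped_continuous ac' (clamped_clamp _ t0).
Qed.

Lemma ACp_increment t gamma a b : ACp p t gamma -> 0 <= a -> a <= b -> b <= t ->
  enorm (gamma b - gamma a) `^ p <= t `^ (p - 1) * energy t gamma.
Proof.
move=> ac a0 ab bt; have t0 : 0 <= t by rewrite (le_trans a0)// (le_trans ab).
have h : itv_energy p gamma (a, b) <= energy t gamma.
  have := @ACp_family_energy_le t gamma [:: (a, b)] ac.
  by rewrite /family_energy big_seq1; apply; rewrite /itv_family/= a0 ab bt.
move: ab; rewrite le_eqVlt => /predU1P[<-|ab].
  by rewrite subrr enorm0 powR0 ?(gt_eqF p0)// mulr_ge0 ?powR_ge0 ?energy_ge0.
have ba0 : 0 < b - a by rewrite subr_gt0.
rewrite (@le_trans _ _ ((b - a) `^ (p - 1) * energy t gamma))//.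
  rewrite -(ler_pM2l (powR_gt0 (p - 1) ba0)) in h.
  apply: le_trans h; rewrite /itv_energy/= mulrA -powRD ?(gt_eqF ba0) ?implybT//.
  by rewrite (_ : p - 1 + (1 - p) = 0) ?powRr0 ?mul1r//; ring.
rewrite ler_wpM2r ?energy_ge0//; apply: ge0_ler_powR; rewrite ?nnegrE ?subr_ge0 ?(ltW p1) ?(ltW ab)//.
lra.
Qed.

Variables (V : 'rV[R]_d -> R).
Hypothesis cV : continuous V.

Lemma clamped_integrable (a b : R) (gamma : R -> 'rV[R]_d) : continuous gamma ->
  leb.-integrable `[a, b] (fun s => (V (gamma s))%:E).
Proof.
move=> cg; apply: continuous_compact_integrable; first exact: segment_compact.
apply: continuous_subspaceT => s.
by apply: continuous_comp; [exact: cg|exact: cV].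
Qed.

Lemma ACp_integrable t gamma : 0 <= t -> ACp p t gamma ->
  leb.-integrable `[0, t] (fun s => (V (gamma s))%:E).
Proof.
move=> t0 ac; have := @clamped_integrable 0 t _ (ACp_clamp_continuous t0 ac).
apply: eq_integrable => // s; rewrite inE/= in_itv/= => st.
by rewrite clamp_id.
Qed.

Definition potential_cost t gamma := \int[leb]_(s in `[0, t]) V (gamma s).

Lemma potential_cost_clamp t gamma :
  potential_cost t (gamma \o clamp t) = potential_cost t gamma.
Proof.
by apply: eq_Rintegral => s; rewrite inE/= in_itv/= => st; rewrite clamp_id.
Qed.

Definition real_action (g : 'rV[R]_d -> R) t gamma : R :=
  g (gamma 0) + p^-1 * energy t gamma - potential_cost t gamma.

Lemma actionE (g : 'rV[R]_d -> R) t gamma : 0 <= t -> ACp p t gamma ->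
  action p g V t gamma = (real_action g t gamma)%:E.
Proof.
move=> t0 ac; rewrite /action /real_action -addrA EFinD; congr (_ + _)%E.
have iV := ACp_integrable t0 ac.
have mE : measurable_fun `[0, t] (fun s => enorm (derive1 gamma s) `^ p).
  case: (ac) => _ _ [mg _].
  exact: measurableT_comp (measurable_powR _) mg.
have iE : leb.-integrable `[0, t] (fun s => (enorm (derive1 gamma s) `^ p)%:E).
  apply/integrableP; split; first exact/measurable_EFinP.
  have := path_energy_fin ac; rewrite /path_energy => E.
  under eq_integral do rewrite gee0_abs ?lee_fin ?powR_ge0//.
  by rewrite E ltry.
under eq_integral do rewrite EFinB.
rewrite integralB//=; last first.
  exact: (@integrableZl _ _ _ leb _ (measurable_itv `[0, t]) p^-1 _ iE).
under eq_integral do rewrite EFinM.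
rewrite integralZl// -/(path_energy p t gamma) path_energy_fin//.
rewrite EFinB EFinM; congr (_ - _)%E.
by rewrite /potential_cost /Rintegral fineK//; exact: integrable_fin_num iV.
Qed.

Let act_le (a e e' c : R) : e <= e' -> a + e - c <= a + e' - c.
Proof. by move=> ee'; rewrite lerD2r lerD2l. Qed.

Lemma real_action_clamp g t gamma : 0 <= t -> ACp p t gamma ->
  real_action g t (gamma \o clamp t) <= real_action g t gamma.
Proof.
move=> t0 ac; have [_ E] := ACp_clamp t0 ac.
have E' : p^-1 * energy t (gamma \o clamp t) <= p^-1 * energy t gamma.
  by rewrite ler_pM2l ?invr_gt0.
have c0 : (gamma \o clamp t) 0 = gamma 0 by rewrite /= clamp_id ?lexx ?t0.
rewrite /real_action potential_cost_clamp c0.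
exact: act_le E'.
Qed.

Lemma derive1_shift gamma v s : derive1 (fun r => gamma r + v) s = derive1 gamma s.
Proof.
rewrite /derive1.
rewrite (_ : (fun h => h^-1 *: _) = (fun h => h^-1 *: ((gamma \o shift s) h - gamma s)))//.
by apply/funext => h /=; rewrite opprD addrACA subrr addr0.
Qed.

Lemma ACp_shift t gamma v : ACp p t gamma -> ACp p t (fun r => gamma r + v).
Proof.
have E : derive1 (fun r => gamma r + v) = derive1 gamma.
  by apply/funext => s; exact: derive1_shift.
move=> [ac mg lg]; split; last 2 first.
- by rewrite E.
- by rewrite E.
move=> e e0; have [delta delta0 H] := ac e e0; exists delta => // n a b ab tab lab.
have := H n a b ab tab lab.
by under [in X in _ -> X]eq_bigr do rewrite opprD addrACA subrr addr0.
Qed.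

Lemma energy_shift t gamma v : energy t (fun r => gamma r + v) = energy t gamma.
Proof.
have E : derive1 (fun r => gamma r + v) = derive1 gamma.
  by apply/funext => s; exact: derive1_shift.
by rewrite /energy /path_energy E.
Qed.

End actions.

(** * Coercivity of the action and growth of the value function *)

Section value_bounds.
Context {R : realType} {d : nat} (p : R) (V g : 'rV[R]_d -> R) (K L T : R).
Local Notation leb := (@lebesgue_measure R).
Implicit Types (gamma : R -> 'rV[R]_d) (x : 'rV[R]_d).
Hypotheses (p1 : 1 < p) (cV : continuous V) (K0 : 0 < K) (L0 : 0 <= L) (T0 : 0 < T).
Hypothesis VK : forall x, `|V x| <= K * (1 + enorm x `^ p).
Hypothesis gL : forall x y, `|g x - g y| <= L * enorm (x - y).
Hypothesis KT : K * 2 `^ p * T `^ p <= (4 * p)^-1.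
Let p0 : 0 < p. Proof. exact: lt_trans p1. Qed.

Lemma potential_cost_le t gamma B : 0 <= t -> ACp p t gamma ->
  (forall s, 0 <= s <= t -> V (gamma s) <= B) -> potential_cost V t gamma <= t * B.
Proof.
move=> t0 ac VB; rewrite /potential_cost.
have <- : \int[leb]_(s in `[0, t]) B = t * B.
  by rewrite /Rintegral integral_cst_itv//= subr0 mulrC.
apply: le_Rintegral; [by []|exact: ACp_integrable ac| |].
  apply: continuous_compact_integrable; first exact: segment_compact.
  by apply: continuous_subspaceT; exact: cst_continuous.
move=> s /=; rewrite in_itv/=; exact: VB.
Qed.

Lemma enorm_le_powR x : enorm x <= 1 + enorm x `^ p.
Proof.
by have := powR_le_linear p1 (@ltr01 R) (enorm_ge0 x); rewrite powR1 mul1r.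
Qed.

Let powRS t : 0 <= t -> t * t `^ (p - 1) = t `^ p.
Proof.
rewrite le_eqVlt => /predU1P[<-|t0]; first by rewrite mul0r powR0 ?gt_eqF.
by rewrite -[X in X * _](powRr1 (ltW t0)) -powRD ?(gt_eqF t0) ?implybT//; congr (_ `^ _); ring.
Qed.

Let p4 : (4 * p)^-1 + (4 * p)^-1 = (2 * p)^-1.
Proof. by field; rewrite gt_eqF. Qed.

Let p2 : p^-1 = (2 * p)^-1 + (2 * p)^-1.
Proof. by field; rewrite gt_eqF. Qed.

Let collect (a b e q x c1 c2 c3 c4 l : R) :
  0 <= x -> 0 <= c1 -> 0 <= c2 -> 0 <= c3 -> 0 <= c4 ->
  a >= - c3 - c4 * (1 + x) - (c2 + q * e) ->
  b <= c1 * (1 + x) + q * e -> l = q + q ->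
  l * e <= a + (l + l) * e - b + (c1 + c2 + c3 + c4) * (1 + x).
Proof. by move=> x0 a1 a2 a3 a4 h1 h2 ->; nra. Qed.

(** Half of the coefficient [1 / p] of the energy survives. Along the path, [|gamma s - gamma t|^p]
    is at most [t^(p - 1)] times the energy, so by [KT] the potential takes at most [1 / (4p)] of
    it. The variation of [g] is linear in the displacement, and a large [M] lets another [1 / (4p)]
    absorb it, whatever [L] is. *)
Lemma action_coercive : exists2 C, 0 <= C & forall t gamma, 0 <= t <= T -> ACp p t gamma ->
  (2 * p)^-1 * energy p t gamma <=
    real_action p V g t gamma + C * (1 + enorm (gamma t) `^ p).
Proof.
have q0 : 0 <= (4 * p)^-1 by rewrite invr_ge0 mulr_ge0// ltW.
have LT0 : 0 <= L * T `^ (p - 1) by rewrite mulr_ge0// powR_ge0.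
have [M M0 HM] : exists2 M : R, 0 < M & M `^ (1 - p) * (L * T `^ (p - 1)) <= (4 * p)^-1.
  by apply: powR_small => //; rewrite invr_gt0 mulr_gt0.
pose c1 := T * K * (1 + 2 `^ p).
have c10 : 0 <= c1 by rewrite !mulr_ge0// ?(ltW T0) ?(ltW K0)// addr_ge0// powR_ge0.
exists (c1 + L * M + `|g 0| + L).
  by rewrite !addr_ge0// mulr_ge0// ltW.
move=> t gamma /andP[t0 tT] ac; set x := gamma t; set e := energy p t gamma.
have e0 : 0 <= e := energy_ge0 _ _ _.
have x0 : 0 <= enorm x `^ p := powR_ge0 _ _.
have inc s : 0 <= s <= t -> enorm (gamma s - x) `^ p <= t `^ (p - 1) * e.
  by move=> /andP[s0 st]; rewrite enormB; apply: ACp_increment.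
have tT1 : t `^ (p - 1) <= T `^ (p - 1).
  by apply: ge0_ler_powR; rewrite ?nnegrE ?subr_ge0// ?(ltW p1) ?(ltW T0).
rewrite /real_action {1}p2; apply: (@collect _ _ e (4 * p)^-1) => //.
- by rewrite mulr_ge0// ltW.
- have h1 : `|g (gamma 0) - g 0| <= L * enorm (gamma 0 - x) + L * (1 + enorm x `^ p).
    rewrite (le_trans (gL _ _))// subr0 -mulrDr ler_wpM2l//.
    rewrite -{1}(subrK x (gamma 0)) (le_trans (enormD _ _))// lerD2l; exact: enorm_le_powR.
  have h2 : L * enorm (gamma 0 - x) <= L * M + (4 * p)^-1 * e.
    have := powR_le_linear p1 M0 (enorm_ge0 (gamma 0 - x)) => h.
    rewrite (le_trans (ler_wpM2l L0 h))// mulrDr lerD2l.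
    apply: (@le_trans _ _ (M `^ (1 - p) * (L * T `^ (p - 1)) * e)); last by rewrite ler_wpM2r.
    rewrite mulrCA -!mulrA ler_wpM2l ?powR_ge0// ler_wpM2l//.
    rewrite (le_trans (inc 0 _)) ?lexx ?t0//; exact: ler_wpM2r.
  have h3 := ler_norm (g 0); have := ler_norm (- g 0); rewrite normrN => h4.
  move: h1; rewrite ler_norml => /andP[h1 _].
  move: h1 h2; move: (L * enorm _) (L * M) (L * (1 + _)) (_^-1 * e) => A B D F h1 h2.
  lra.
- have VB s : 0 <= s <= t -> V (gamma s) <= K * (1 + 2 `^ p * (enorm x `^ p + t `^ (p - 1) * e)).
    move=> st; rewrite (le_trans (ler_norm _))// (le_trans (VK _))// ler_pM2l// lerD2l.
    rewrite -{1}(subrKC x (gamma s)) (le_trans (enorm_powRD_le p1 _ _))// ler_wpM2l ?powR_ge0//.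
    by rewrite lerD2l inc.
  rewrite (le_trans (potential_cost_le t0 ac VB))//.
  rewrite (_ : t * _ = t * K * (1 + 2 `^ p * enorm x `^ p) + K * 2 `^ p * (t * t `^ (p - 1)) * e); last by ring.
  apply: lerD.
    rewrite /c1 -[leRHS]mulrA; apply: ler_pM; rewrite ?mulr_ge0 ?(ltW K0)//.
    - by rewrite addr_ge0// mulr_ge0// powR_ge0.
    - by rewrite ler_wpM2r// ltW.
    - have := powR_ge0 2 p; set w := 2 `^ p => w0; nra.
  rewrite powRS// ler_wpM2r// (le_trans _ KT)// ler_wpM2l//.
    by rewrite mulr_ge0 ?powR_ge0 ?(ltW K0).
  by apply: ge0_ler_powR; rewrite ?nnegrE// ?(ltW T0) ?(ltW p0).
Qed.

Lemma ACp_cst t x : 0 <= t -> ACp p t (fun=> x) /\ energy p t (fun=> x) <= 0.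
Proof.
move=> t0; apply: energy_bound_energy => // s _.
rewrite /family_energy big1// => J _; rewrite /itv_energy/= subrr enorm0 powR0 ?mulr0// gt_eqF//.
Qed.

Definition uval x t := fine (value p g V x t).

(** Coercivity bounds the value from below, the constant path from above. *)
Lemma value_fin : exists2 C, 0 <= C & forall x t, 0 <= t <= T ->
  value p g V x t = (uval x t)%:E /\ `|uval x t| <= C * (1 + enorm x `^ p).
Proof.
have [C C0 HC] := action_coercive.
have c0 : 0 <= C + `|g 0| + L + T * K by rewrite !addr_ge0// mulr_ge0// ltW.
exists (C + `|g 0| + L + T * K) => // x t /andP[t0 tT].
have x0 : 0 <= enorm x `^ p := powR_ge0 _ _.
have lb : ((- (C * (1 + enorm x `^ p)))%:E <= value p g V x t)%E.
  apply: le_ereal_inf_tmp => _ [gamma [ac gx] <-]; rewrite actionE// lee_fin.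
  have := HC t gamma; rewrite t0 tT gx => /(_ isT ac).
  have := @energy_ge0 _ _ p t gamma => e0.
  have : 0 <= (2 * p)^-1 * energy p t gamma.
    by rewrite mulr_ge0// invr_ge0 mulr_ge0// ltW.
  lra.
have ub : (value p g V x t <= (g x - t * V x)%:E)%E.
  have [ac e0] := ACp_cst x t0.
  apply: ereal_inf_lbound; exists (fun=> x) => //; rewrite actionE// /real_action.
  have -> : energy p t (fun=> x) = 0 by apply/le_anti; rewrite e0 energy_ge0.
  rewrite mulr0 addr0 /potential_cost /Rintegral integral_cst_itv//= subr0.
  by rewrite [V x * t]mulrC.
have vf : value p g V x t \is a fin_num.
  by rewrite fin_numE -ltNye -ltey (lt_le_trans _ lb) ?ltNyr//= (le_lt_trans ub) ?ltry.
have vE : value p g V x t = (uval x t)%:E by rewrite /uval fineK.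
split => //; move: lb ub; rewrite vE !lee_fin => lb ub.
have gx : `|g x| <= `|g 0| + L * (1 + enorm x `^ p).
  rewrite -[g x](subrKC (g 0)) (le_trans (ler_normD _ _))// lerD2l.
  rewrite (le_trans (gL _ _))// subr0 ler_wpM2l//; exact: enorm_le_powR.
have tV : `|t * V x| <= T * K * (1 + enorm x `^ p).
  by rewrite normrM (ger0_norm t0) -mulrA; apply: ler_pM.
move: x0 gx tV lb ub; move: (enorm x `^ p) (uval x t) (T * K) c0 (g x) (t * V x) (`|g 0|) (normr_ge0 (g 0)).
move=> X u TK _ a b g0 g00 X0 /ler_normlP[a1 a2] /ler_normlP[b1 b2] h1 h2.
have : 0 <= g0 * X by rewrite mulr_ge0.
have : 0 <= C * X by rewrite mulr_ge0.
by move=> CX gX; rewrite ler_norml; apply/andP; split; nra.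
Qed.

Lemma uval_le x t gamma : 0 <= t <= T -> ACp p t gamma -> gamma t = x ->
  uval x t <= real_action p V g t gamma.
Proof.
move=> tT ac gx; have [C _ /(_ x t tT)[vE _]] := value_fin.
case/andP: (tT) => t0 _.
by rewrite -lee_fin -vE -actionE//; apply: ereal_inf_lbound; exists gamma.
Qed.

Lemma uval_approx x t e : 0 <= t <= T -> 0 < e -> exists gamma,
  [/\ ACp p t gamma, clamped t gamma, gamma t = x &
      real_action p V g t gamma < uval x t + e].
Proof.
move=> tT e0; have [C _ /(_ x t tT)[vE _]] := value_fin.
case/andP: (tT) => t0 _.
have [|_ [gamma [ac gx] <-] H] := @lb_ereal_inf_adherent _ [set action p g V t gamma | gamma in admissible p x t] e e0.
  by rewrite -/(value p g V x t) vE.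
exists (gamma \o clamp t); split.
- exact: (ACp_clamp p1 t0 ac).1.
- exact: clamped_clamp.
- by rewrite /= clamp_id ?lexx ?t0.
- rewrite (le_lt_trans (real_action_clamp p1 V g t0 ac))//.
  by move: H; rewrite -/(value p g V x t) vE actionE// -EFinD lte_fin.
Qed.

End value_bounds.

(** * Semicontinuity of the value function and dynamic programming *)

Section clamp_theory.
Context {R : realType}.
Implicit Types t s h r : R.

Lemma clampP (t r : R) : 0 <= t ->
  [\/ r <= 0 /\ clamp t r = 0, 0 <= r <= t /\ clamp t r = r | t <= r /\ clamp t r = t].
Proof.
move=> t0; have [r0|/ltW r0] := leP r 0.
  by apply: Or31; rewrite /clamp max_l// min_r.
have [rt|/ltW tr] := leP r t.
  by apply: Or32; rewrite r0 clamp_id ?r0.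
by apply: Or33; rewrite /clamp max_r// min_l.
Qed.

Lemma clampDE s h r : 0 <= s -> 0 <= h -> clamp (s + h) r - clamp s r = clamp h (r - s).
Proof.
move=> s0 h0; have sh0 : 0 <= s + h by exact: addr_ge0.
by case: (clampP r sh0) => -[? ->]; case: (clampP r s0) => -[? ->];
  case: (clampP (r - s) h0) => -[? ->]; lra.
Qed.

Lemma clamp_clamp s t r : 0 <= s -> s <= t -> clamp s (clamp t r) = clamp s r.
Proof.
move=> s0 st; have t0 := le_trans s0 st.
case: (clampP r t0) => -[r1 ->] //.
- by case: (clampP r s0) => -[r2 ->]; rewrite clamp_id ?lexx//; lra.
- case: (clampP r s0) => -[r2 ->]; case: (clampP t s0) => -[t2 ->]; lra.
Qed.

End clamp_theory.

Section value_regularity.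
Context {R : realType} {d : nat} (p : R) (V g : 'rV[R]_d -> R) (K L T : R).
Local Notation leb := (@lebesgue_measure R).
Implicit Types (gamma : R -> 'rV[R]_d) (x : 'rV[R]_d).
Hypotheses (p1 : 1 < p) (cV : continuous V) (K0 : 0 < K) (L0 : 0 <= L) (T0 : 0 < T).
Hypothesis VK : forall x, `|V x| <= K * (1 + enorm x `^ p).
Hypothesis gL : forall x y, `|g x - g y| <= L * enorm (x - y).
Hypothesis KT : K * 2 `^ p * T `^ p <= (4 * p)^-1.
Let p0 : 0 < p. Proof. exact: lt_trans p1. Qed.

Lemma potential_cost_close rho e : 0 < e -> exists2 eta : R, 0 < eta &
  forall t gamma gamma', 0 <= t -> ACp p t gamma -> ACp p t gamma' ->
  (forall s, 0 <= s <= t -> enorm (gamma s) <= rho /\ enorm (gamma' s - gamma s) < eta) ->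
  `|potential_cost V t gamma' - potential_cost V t gamma| <= t * e.
Proof.
move=> e0; have [eta eta0 H] := ball_unif_continuous cV rho e0.
exists eta => // t gamma gamma' t0 ac ac' cl.
have i1 := ACp_integrable p1 cV t0 ac; have i2 := ACp_integrable p1 cV t0 ac'.
rewrite /potential_cost -RintegralB//.
have <- : \int[leb]_(s in `[0, t]) e = t * e.
  by rewrite /Rintegral integral_cst_itv//= subr0 mulrC.
have iB : leb.-integrable `[0, t] (EFin \o (fun s => V (gamma' s) - V (gamma s))).
  by rewrite (_ : _ \o _ = (EFin \o (V \o gamma')) \- (EFin \o (V \o gamma)))%E//; exact: integrableB.
apply: le_trans (@le_normr_Rintegral _ _ _ leb _ _ (measurable_itv `[0, t]) iB) _.
apply: le_Rintegral => //.
- by have := integrable_abse iB; apply: eq_integrable.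
- apply: continuous_compact_integrable; first exact: segment_compact.
  by apply: continuous_subspaceT; exact: cst_continuous.
- by move=> s /=; rewrite in_itv/= => /cl[h1 h2]; exact: H.
Qed.

Lemma ACp_bounded t gamma : 0 <= t -> ACp p t gamma ->
  exists rho, forall s, 0 <= s <= t -> enorm (gamma s) <= rho.
Proof.
move=> t0 ac; exists (1 + 2 `^ p * (enorm (gamma t) `^ p + t `^ (p - 1) * energy p t gamma)).
move=> s /andP[s0 st]; rewrite (le_trans (enorm_le_powR p1 _))// lerD2l.
rewrite -{1}(subrKC (gamma t) (gamma s)) (le_trans (enorm_powRD_le p1 _ _))//.
rewrite ler_wpM2l ?powR_ge0// lerD2l enormB.
exact: (ACp_increment p1 ac).
Qed.

Lemma enorm_open (A : set 'rV[R]_d) :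
  (forall x, A x -> exists2 delta : R, 0 < delta & forall y, enorm (y - x) < delta -> A y) ->
  open A.
Proof.
move=> H; rewrite openE => x /H[delta delta0 Hd].
have : \forall y \near x, enorm (x - y) < delta.
  by apply: (enorm_cvgP (F := nbhs x) id x).1 => //; exact: cvg_id.
by apply: filterS => y xy; apply: Hd; rewrite enormB.
Qed.

Lemma real_action_shift_close t gamma v e : 0 <= t -> ACp p t gamma -> 0 < e ->
  exists2 delta : R, 0 < delta & forall w, enorm (w - v) < delta ->
  `|real_action p V g t (fun s => gamma s + w) - real_action p V g t (fun s => gamma s + v)| <= e.
Proof.
move=> t0 ac e0; have [rho Hrho] := ACp_bounded t0 ac.
have te0 : 0 < e / 2 / (t + 1) by rewrite !divr_gt0//; lra.
have [eta eta0 H] := potential_cost_close (rho + enorm v) te0.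
have L1 : 0 < e / 2 / (L + 1) by rewrite !divr_gt0// ltr_wpDl.
exists (Num.min eta (e / 2 / (L + 1))); first by rewrite lt_min eta0.
move=> w; rewrite lt_min => /andP[w1 w2].
have : `|potential_cost V t (fun s => gamma s + w) - potential_cost V t (fun s => gamma s + v)| <= e / 2.
  apply: (@le_trans _ _ (t * (e / 2 / (t + 1)))).
    apply: (H t _ _ t0 (ACp_shift v ac) (ACp_shift w ac)).
    move=> s /Hrho h; split; first by rewrite (le_trans (enormD _ _))// lerD2r.
    by rewrite opprD addrACA subrr add0r.
  by rewrite mulrCA ler_piMr ?divr_ge0 ?(ltW e0)// ler_pdivrMr; lra.
have : `|g (gamma 0 + w) - g (gamma 0 + v)| <= e / 2.
  rewrite (le_trans (gL _ _))// opprD addrACA subrr add0r.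
  rewrite (le_trans (ler_wpM2l L0 (ltW w2)))// mulrCA ler_piMr ?divr_ge0 ?(ltW e0)//.
  by rewrite ler_pdivrMr ?ltr_wpDl// mul1r lerDl.
rewrite /real_action !energy_shift.
move: (energy _ _ _) (potential_cost _ _ _) (potential_cost _ _ _) (g _) (g _) => E a b c f h1 h2.
rewrite (_ : f + _ - b - _ = (f - c) - (b - a)); last by ring.
by rewrite (le_trans (ler_normB _ _))//; lra.
Qed.

(** An almost optimal path for [x0] is translated so as to end at [x]: its energy is unchanged, and
    the two other terms of the action change little. The Borel measurability of the value
    follows. *)
Lemma uval_usc t c : 0 <= t <= T -> open [set x | uval p V g x t < c].
Proof.
move=> tT; apply: enorm_open => x0 /= ux; have /andP[t0 _] := tT.
have e0 : 0 < c - uval p V g x0 t by rewrite subr_gt0.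
have [gamma [ac cg gx]] := uval_approx p1 cV K0 L0 T0 VK gL KT x0 tT e0.
rewrite subrKC => H.
have ac' : ACp p t (fun s => gamma s - x0) by exact: ACp_shift.
have e1 : 0 < (c - real_action p V g t gamma) / 2 by rewrite divr_gt0// subr_gt0.
have [delta delta0 Hd] := real_action_shift_close x0 t0 ac' e1.
exists delta => // x /Hd.
have E : (fun s => gamma s - x0 + x0) = gamma by apply/funext => s; rewrite subrK.
rewrite E => h.
have : uval p V g x t <= real_action p V g t (fun s => gamma s - x0 + x).
  apply: (uval_le p1 cV K0 L0 T0 VK gL KT tT); first exact: ACp_shift.
  by rewrite gx subrr add0r.
move: h H; move: (real_action _ _ _ _ _) (real_action _ _ _ _ _) (uval _ _ _ _ _) => a b u.
by move=> /ler_normlP[h1 h2] h3 h4; lra.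
Qed.

Lemma itv_family_image (t' t : R) (f : R -> R) s : {homo f : a b / a <= b} ->
  (forall r, 0 <= f r <= t') -> itv_family t s ->
  itv_family t' [seq (f J.1, f J.2) | J <- s].
Proof.
move=> hf f01 /andP[/allP s0t ps]; apply/andP; split.
  apply/allP => _ /mapP[J /s0t/and3P[a0 ab bt] ->] /=.
  by have /andP[-> _] := f01 J.1; have /andP[_ ->] := f01 J.2; rewrite hf.
rewrite pairwise_map; by apply: sub_pairwise ps => I' J' /= /orP[h|h]; apply/orP; [left|right]; exact: hf.
Qed.

Section concatenation.
Variables (s h : R) (gamma : R -> 'rV[R]_d) (y : 'rV[R]_d).
Hypotheses (s0 : 0 <= s) (h0 : 0 < h) (ac : ACp p s gamma) (cg : clamped s gamma).
Let x := gamma s.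
Let w r : R := clamp (s + h) r - clamp s r.

(** [gamma] up to time [s], then the segment to [y] at constant speed. As [w r] is the time spent in
    [[s, s + h]] up to [r] and [gamma] stays at [x] after [s], one formula covers both pieces. *)
Definition extend_path r := gamma r + (w r / h) *: (y - x).

Let sh0 : 0 <= s + h. Proof. by rewrite addr_ge0// ltW. Qed.

Let w_homo : {homo w : a b / a <= b}.
Proof. by move=> a b ab; rewrite /w !clampDE ?(ltW h0)// le_clamp// lerB. Qed.

Let w_itv r : 0 <= w r <= h.
Proof. by rewrite /w clampDE ?(ltW h0)// clamp_itv// ltW. Qed.

Let clamp_split a b : 0 <= a -> a <= b -> b <= s + h ->
  (clamp s b - clamp s a) + (w b - w a) = b - a.
Proof.
move=> a0 ab bh; rewrite /w (@clamp_id _ (s + h) b) ?(@clamp_id _ (s + h) a).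
- by move: (clamp _ _) (clamp _ _) => *; ring.
- by rewrite a0 (le_trans ab).
- by rewrite bh (le_trans a0).
Qed.

Let clamp_ge r : s <= r -> clamp s r = s.
Proof. by move=> sr; rewrite /clamp (max_r (le_trans s0 sr)) min_l. Qed.

Let w_end : w (s + h) = h.
Proof. by rewrite /w clamp_id ?sh0 ?lexx// clamp_ge ?lerDl ?(ltW h0)// addrC addKr. Qed.

Lemma extend_clamped : clamped (s + h) extend_path.
Proof.
move=> r; rewrite /extend_path -[in LHS]cg -[in RHS]cg.
have E : clamp s (clamp (s + h) r) = clamp s r.
  by apply: clamp_clamp => //; rewrite lerDl ltW.
by rewrite /w E clampK.
Qed.

Lemma extend_path_end : extend_path (s + h) = y.
Proof.
rewrite /extend_path -cg w_end divff ?gt_eqF// scale1r.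
by rewrite clamp_ge ?subrKC// lerDl ltW.
Qed.

Lemma extend_path_start : extend_path 0 = gamma 0.
Proof.
rewrite /extend_path (_ : w 0 = 0) ?mul0r ?scale0r ?addr0//.
by rewrite /w !clamp_id ?subrr// ?lexx ?s0 ?sh0.
Qed.

(** An interval across [s] is cut there into lengths [w1] and [w2]; by the subadditivity of
    [w^(1 - p) a^p] its energy is at most the sum of the energies of the two parts. *)
Lemma extend_itv_energy a b : 0 <= a -> a <= b -> b <= s + h ->
  itv_energy p extend_path (a, b) <= itv_energy p gamma (clamp s a, clamp s b) +
    (w b - w a) * (h `^ (- p) * enorm (y - x) `^ p).
Proof.
move=> a0 ab bh; rewrite /itv_energy/=.
have cab : clamp s a <= clamp s b by exact: le_clamp.
have wab := w_homo ab; have E := clamp_split a0 ab bh.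
set A := enorm (gamma (clamp s b) - gamma (clamp s a)); have A0 : 0 <= A := enorm_ge0 _.
pose Y := enorm (y - x); have Y0 : 0 <= Y := enorm_ge0 _.
have inc : enorm (extend_path b - extend_path a) <= A + (w b - w a) * (Y / h).
  rewrite /extend_path opprD addrACA -scalerBl -mulrBl (le_trans (enormD _ _))//.
  apply: lerD; first by rewrite /A !cg.
  rewrite enormZ ger0_norm; last by rewrite divr_ge0 ?subr_ge0// ltW.
  by rewrite mulrAC mulrA.
have hY : (Y / h) `^ p = h `^ (- p) * Y `^ p.
  by rewrite powRM ?invr_ge0 ?(ltW h0)// -powR_inv1 ?(ltW h0)// -powRrM mulN1r mulrC.
have Yh0 : 0 <= Y / h by rewrite divr_ge0// ltW.
rewrite -/Y -hY.
move: inc E; set w1 := clamp s b - clamp s a; set w2 := w b - w a => inc E.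
have w10 : 0 <= w1 by rewrite subr_ge0. have w20 : 0 <= w2 by rewrite subr_ge0.
rewrite -E; apply: (@le_trans _ _ ((w1 + w2) `^ (1 - p) * (A + w2 * (Y / h)) `^ p)).
  rewrite ler_wpM2l ?powR_ge0//; apply: ge0_ler_powR; rewrite ?nnegrE ?enorm_ge0 ?(ltW p0)//.
  by rewrite addr_ge0// mulr_ge0.
have pw (v : R) : 0 < v -> v `^ (1 - p) * (v * (Y / h)) `^ p = v * (Y / h) `^ p.
  move=> v0; rewrite powRM ?(ltW v0)// mulrA -powRD ?(gt_eqF v0) ?implybT//.
  by rewrite subrK powRr1// ltW.
have [w1e|w1n] := eqVneq w1 0.
  have -> : A = 0.
    rewrite /A (_ : clamp s b = clamp s a) ?subrr ?enorm0//.
    by apply/eqP; rewrite -subr_eq0 -/w1 w1e.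
  rewrite w1e add0r add0r [0 `^ p]powR0 ?gt_eqF// mulr0 add0r.
  have [->|w2n] := eqVneq w2 0; first by rewrite !mul0r [0 `^ p]powR0 ?gt_eqF// mulr0.
  by rewrite pw// lt_neqAle eq_sym w2n.
have w1p : 0 < w1 by rewrite lt_neqAle eq_sym w1n.
have [->|w2n] := eqVneq w2 0; first by rewrite !mul0r !addr0.
have w2p : 0 < w2 by rewrite lt_neqAle eq_sym w2n.
have two : (A + w2 * (Y / h)) `^ p <= (w1 + w2) `^ (p - 1) *
    (w1 `^ (1 - p) * A `^ p + w2 `^ (1 - p) * (w2 * (Y / h)) `^ p).
  have B0 : 0 <= w2 / 2 * (Y / h) by rewrite mulr_ge0// divr_ge0.
  have w2h : 0 < w2 / 2 by rewrite divr_gt0.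
  (* The second part is halved, so that the inequality for three terms gives the one for two. *)
  have := powR3_le p1 A0 B0 B0 w1p w2h w2h.
  rewrite !pw// -!addrA -splitr -mulrDl -[w2 / 2 * _ + _]mulrDl -splitr (addrA (clamp s b)).
  exact.
rewrite pw// in two; rewrite (le_trans (ler_wpM2l (powR_ge0 _ _) two))//.
rewrite mulrA -powRD ?(gt_eqF (addr_gt0 w1p w2p)) ?implybT//.
by rewrite (_ : 1 - p + (p - 1) = 0) ?powRr0 ?mul1r//; ring.
Qed.

Lemma extend_energy : ACp p (s + h) extend_path /\
  energy p (s + h) extend_path <= energy p s gamma + h `^ (1 - p) * enorm (y - x) `^ p.
Proof.
apply: energy_bound_energy => //.
- exact: extend_clamped.
move=> S fS; have /andP[/allP S0t _] := fS.
have hs := le_clamp s.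
have f1 : itv_family s [seq (clamp s J.1, clamp s J.2) | J <- S].
  apply: itv_family_image fS; first exact: le_clamp.
  by move=> r; apply: clamp_itv.
have f2 : itv_family h [seq (w J.1, w J.2) | J <- S].
  exact: itv_family_image fS.
have := total_length_le (ltW h0) f2; have := ACp_family_energy_le p1 ac f1.
rewrite /family_energy /total_length !big_map/= => h1 h2.
apply: (@le_trans _ _ (\sum_(J <- S) (itv_energy p gamma (clamp s J.1, clamp s J.2) +
    (w J.2 - w J.1) * (h `^ (- p) * enorm (y - x) `^ p)))).
  rewrite big_seq [leRHS]big_seq; apply: ler_sum => -[a b] /S0t/and3P[a0 ab bt].
  exact: extend_itv_energy.
rewrite big_split/= -mulr_suml lerD//.
rewrite (_ : h `^ (1 - p) = h * h `^ (- p)); last first.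
  by rewrite powRD ?(gt_eqF h0) ?implybT// powRr1// ltW.
by rewrite -mulrA ler_wpM2r// mulr_ge0 ?powR_ge0.
Qed.

Lemma extend_potential m : (forall l, 0 <= l <= 1 -> m <= V (x + l *: (y - x))) ->
  potential_cost V s gamma + h * m <= potential_cost V (s + h) extend_path.
Proof.
move=> mV; have [aE _] := extend_energy.
have iE := ACp_integrable p1 cV sh0 aE.
have U : `[0, s + h]%classic = `[0, s]%classic `|` `]s, s + h]%classic.
  by rewrite -(@itv_bndbnd_setU _ _ _ (BRight s)) ?bnd_simp//= lerDl ltW.
rewrite /potential_cost U Rintegral_setU//; last 2 first.
- by rewrite -U.
- apply/disj_setPS => r [] /=; rewrite !in_itv/= => /andP[_ rs] /andP[sr _].
  by have := lt_le_trans sr rs; rewrite ltxx.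
apply: lerD.
  rewrite le_eqVlt; apply/orP; left; apply/eqP/eq_Rintegral => r; rewrite inE/= in_itv/= => /andP[r0 rs].
  rewrite /extend_path (_ : w r = 0) ?mul0r ?scale0r ?addr0//.
  by rewrite /w !clamp_id ?subrr ?r0// (le_trans rs)// lerDl ltW.
rewrite Rintegral_itv_obnd_cbnd; last first.
  by apply: integrableS iE => // r /=; rewrite !in_itv/= => /andP[/ltW sr ->]; rewrite (le_trans s0 sr).
have -> : h * m = \int[leb]_(r in `[s, s + h]) m.
  by rewrite /Rintegral integral_cst_itv ?lerDl ?(ltW h0)//= addrAC subrr add0r mulrC.
apply: le_Rintegral => //.
- apply: continuous_compact_integrable; first exact: segment_compact.
  by apply: continuous_subspaceT; exact: cst_continuous.
- by apply: integrableS iE => //; apply: sub_itv.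
move=> r /=; rewrite in_itv/= => /andP[sr rh].
rewrite /extend_path (_ : gamma r = x); last first.
  by rewrite /x -(cg r) clamp_ge.
by apply: mV; have /andP[w0 wh] := w_itv r; rewrite divr_ge0 ?(ltW h0)//= ler_pdivrMr// mul1r.
Qed.

End concatenation.

Let step_num (P P' e1 e2 D u u' G hm e : R) : P + hm <= P' -> e2 <= e1 + D ->
  u' <= G + e2 - P' -> G + e1 - P < u + e -> u' <= u + D - hm + e.
Proof. by move=> *; lra. Qed.

(** An almost optimal path for [(x, s)] is extended by a segment. The lower bound [m] of [V] on the
    segment stands for its time average there, which suits the modulus of continuity used later. *)
Lemma uval_step x y s h m : 0 <= s -> 0 < h -> s + h <= T ->
  (forall l, 0 <= l <= 1 -> m <= V (x + l *: (y - x))) ->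
  uval p V g y (s + h) <=
    uval p V g x s + p^-1 * (h `^ (1 - p) * enorm (y - x) `^ p) - h * m.
Proof.
move=> s0 h0 shT mV; apply/ler_addgt0Pr => e e0.
have sT : 0 <= s <= T by rewrite s0 (le_trans _ shT)// lerDl ltW.
have [gamma [ac cg gx H]] := uval_approx p1 cV K0 L0 T0 VK gL KT x sT e0.
rewrite -gx in mV *.
have [ac' E] := extend_energy y s0 h0 ac cg.
have hP := extend_potential s0 h0 ac cg mV.
have hA : uval p V g y (s + h) <= real_action p V g (s + h) (extend_path s h gamma y).
  apply: (uval_le p1 cV K0 L0 T0 VK gL KT) => //; last exact: extend_path_end.
  by rewrite shT addr_ge0// ltW.
rewrite gx in hP E *.
move: hA H; rewrite /real_action extend_path_start//.
have : p^-1 * energy p (s + h) (extend_path s h gamma y) <=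
   p^-1 * energy p s gamma + p^-1 * (h `^ (1 - p) * enorm (y - x) `^ p).
  by rewrite -mulrDr ler_pM2l ?invr_gt0.
move: hP.
exact: step_num.
Qed.

End value_regularity.

(** * Images and gluing of probability measures *)

Section pushforward_probability.
Context d1 d2 (T1 : measurableType d1) (T2 : measurableType d2) {R : realType}.
Local Open Scope ereal_scope.

(** Normalization leaves a measure of total mass [1] unchanged; it provides the structure of a
    probability. *)
Definition probability_of (m : {measure set T1 -> \bar R}) : probability T1 R :=
  mnormalize m (dirac point).

Lemma probability_ofE (m : {measure set T1 -> \bar R}) A :
  m setT = 1 -> probability_of m A = m A.
Proof.
move=> m1; rewrite /probability_of /= /mnormalize; set e := m _.
by have -> : e = 1 by []; rewrite onee_eq0/= invr1 mule1.
Qed.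

End pushforward_probability.

Section image_probability.
Context d1 d2 (T1 : measurableType d1) (T2 : measurableType d2) {R : realType}.
Local Open Scope ereal_scope.
Variables (f : T1 -> T2) (mf : measurable_fun setT f) (mu : probability T1 R).

Definition image_probability : probability T2 R := probability_of (giry_map mf mu).

Lemma image_probabilityE A : image_probability A = mu (f @^-1` A).
Proof.
rewrite /image_probability probability_ofE//; exact: probability_setT.
Qed.

Lemma ge0_integral_image (h : T2 -> \bar R) : measurable_fun setT h -> (forall x, 0 <= h x) ->
  \int[image_probability]_x h x = \int[mu]_x h (f x).
Proof.
move=> mh h0.
rewrite (eq_measure_integral (giry_map mf mu)); last by move=> A mA _; exact: image_probabilityE.
exact: (@giry_int_map _ _ _ _ _ _ mf mu h mh h0).
Qed.

End image_probability.

Section discrete_gluing.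
Context d1 d2 (X : measurableType d1) (Y : measurableType d2) {R : realType}.
Local Open Scope ereal_scope.
Variables (P : probability X R) (Q : probability Y R) (a : X -> nat) (b : Y -> nat).
Hypotheses (ma : forall k, measurable (a @^-1` [set k])) (mb : forall k, measurable (b @^-1` [set k])).
Hypothesis ab : forall k, P (a @^-1` [set k]) = Q (b @^-1` [set k]).

Let D k := b @^-1` [set k].

(** [Q] conditioned on the cell [k]. On a cell of mass zero the normalization defaults to [Q],
    without effect, because [P] gives no mass to the corresponding cell. *)
Let kappa k : probability Y R := mnormalize (mrestr Q (mb k)) Q.

Let kappaE k B : measurable B -> kappa k B * P (a @^-1` [set k]) = Q (B `&` D k).
Proof.
move=> mB; rewrite ab /kappa /= /mnormalize /=; set e := mrestr _ _ _.
have -> : e = Q (b @^-1` [set k]) by rewrite /e /mrestr setTI.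
rewrite /mrestr; case: ifPn => [/orP[/eqP|/eqP]|].
- move=> D0; rewrite D0 mule0; apply/esym/eqP; rewrite -measure_le0 -D0.
  by apply: le_measure; rewrite ?inE//; exact: measurableI mB (mb k).
- by move=> D1; have := probability_le1 Q (mb k); rewrite D1.
- rewrite negb_or => /andP[D0 D1].
  have fD : Q (b @^-1` [set k]) \is a fin_num by rewrite fin_num_measure.
  by rewrite -muleA -[X in _ * (_ * X)](@fineK _ (Q (b @^-1` [set k])))// -EFinM mulVf ?mule1// fine_eq0.
Qed.

Let f x : giry (X * Y)%type R := giry_map (pair1_measurable x) (kappa (a x)).

Let cover : \bigcup_k a @^-1` [set k] = setT.
Proof. by apply/seteqP; split => // x _; exists (a x). Qed.

Let fE x B : f x B = kappa (a x) (xsection B x).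
Proof. by rewrite /f/= /pushforward; congr (kappa _ _); apply/seteqP; split => y; rewrite /xsection/= inE. Qed.

Let mf : measurable_fun setT f.
Proof.
apply: measurable_giry_codensity => // B mB.
rewrite -cover; apply/measurable_fun_bigcup => // k.
have := @measurable_fun_xsection _ _ X Y R (kappa k) B mB.
move=> /(@measurable_funS _ _ _ _ _ (a @^-1` [set k]) _ measurableT (@subsetT _ _)).
by apply: eq_measurable_fun => x; rewrite inE/= => <-; rewrite fE.
Qed.

Let G := giry_bind P mf.

Let GI B : measurable B -> G B = \int[P]_x kappa (a x) (xsection B x).
Proof.
move=> mB; have -> : G B = \int[P]_x f x B.
  by rewrite /G /giry_bind/= [LHS]giry_int_map//; exact: measurable_giry_ev.
by apply: eq_integral => x _; exact: fE.
Qed.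

Let GE B (C : nat -> set Y) : measurable B -> (forall k, measurable (C k)) ->
  (forall x, xsection B x = C (a x)) -> G B = \sum_(0 <= k <oo) Q (C k `&` D k).
Proof.
move=> mB mC BC; rewrite GI// -cover ge0_integral_bigcup//.
- apply: eq_eseriesr => k _; rewrite -kappaE// -integral_cst//.
  by apply: eq_integral => x; rewrite inE/= BC => <-.
- rewrite cover; have := measurableT_comp (measurable_giry_ev mB) mf.
  by apply: eq_measurable_fun => x _ /=; rewrite /giry_ev fE.
- by move=> i j _ _ [x [/= <- <-]].
Qed.

(* The two measures are glued independently over each cell of a countable
   partition, which avoids disintegration. *)
Lemma discrete_gluing : exists G : probability (X * Y)%type R,
  [/\ forall A, measurable A -> G (A `*` setT) = P A,
      forall B, measurable B -> G (setT `*` B) = Q B &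
      G [set z | a z.1 != b z.2] = 0].
Proof.
have G1 A : measurable A -> G (A `*` setT) = P A.
  move=> mA; rewrite GI; last exact: measurableX.
  rewrite -[in RHS](setIT A) -integral_indic//; apply: eq_integral => x _.
  rewrite indicE; case: (boolP (x \in A)) => xA.
    rewrite (_ : xsection _ _ = setT) ?probability_setT//.
    by apply/seteqP; split => // y _; rewrite /xsection/= inE; split => //; rewrite inE in xA.
  rewrite (_ : xsection _ _ = set0) ?measure0//.
  by apply/seteqP; split => // y; rewrite /xsection/= inE => -[/= /mem_set]; rewrite (negPf xA).
have coverb : \bigcup_k D k = setT by apply/seteqP; split => // y _; exists (b y).
have G2 B : measurable B -> G (setT `*` B) = Q B.
  move=> mB; rewrite (GE (C := fun=> B)) => [|||x]; last 3 first.
  - exact: measurableX.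
  - by [].
  - by apply/seteqP; split => y; rewrite /xsection/= inE/=; [case|split].
  rewrite -[in RHS](setIT B) -coverb setI_bigcupr measure_bigcup//.
  - by apply: eq_eseriesl => k; rewrite in_setT.
  - by move=> k _; exact: measurableI mB (mb k).
  - by move=> i j _ _ [x [[/= _ <-] [_ <-]]].
exists (probability_of G).
have E A : probability_of G A = G A.
  apply: probability_ofE; have := G1 setT measurableT.
  by rewrite probability_setT setXTT.
have mN : measurable [set z | a z.1 != b z.2].
  rewrite (_ : mkset _ = ~` \bigcup_k ((a @^-1` [set k]) `*` (b @^-1` [set k]))).
    by apply: measurableC; apply: bigcup_measurable => k _; apply: measurableX.
  apply/seteqP; split => -[x y] /=.
    by move=> /eqP xy [k _ [/= ax bx]]; apply: xy; rewrite ax bx.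
  by move=> H; apply/eqP => xy; apply: H; exists (a x) => //; split => /=.
split.
- by move=> A mA; rewrite E G1.
- by move=> B mB; rewrite E G2.
rewrite E (GE (C := fun k => ~` D k)) ?eseries0//.
- by move=> k _ _; rewrite setICl measure0.
- by move=> k; exact: measurableC (mb k).
- move=> x; apply/seteqP; split => y; rewrite /xsection/= inE /D/=.
    by move=> /eqP h1 h2; apply: h1.
  by move=> h; apply/eqP => h2; apply: h.
Qed.

End discrete_gluing.

Section marginals.
Context d1 d2 (X : measurableType d1) (Y : measurableType d2) {R : realType}.
Local Open Scope ereal_scope.
Variables (G : probability (X * Y)%type R).

Lemma ge0_integral_marginal1 (P : probability X R) (h : X -> \bar R) :
  (forall A, measurable A -> G (A `*` setT) = P A) ->
  measurable_fun setT h -> (forall x, 0 <= h x) -> \int[G]_z h z.1 = \int[P]_x h x.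
Proof.
move=> GP mh h0; rewrite -(ge0_integral_image (@measurable_fst _ _ X Y) G mh h0).
apply: eq_measure_integral => A mA _; apply: etrans (GP _ mA); rewrite [LHS]image_probabilityE.
by congr (G _); apply/seteqP; split => -[x y] //= [].
Qed.

Lemma ge0_integral_marginal2 (P : probability Y R) (h : Y -> \bar R) :
  (forall A, measurable A -> G (setT `*` A) = P A) ->
  measurable_fun setT h -> (forall x, 0 <= h x) -> \int[G]_z h z.2 = \int[P]_x h x.
Proof.
move=> GP mh h0; rewrite -(ge0_integral_image (@measurable_snd _ _ X Y) G mh h0).
apply: eq_measure_integral => A mA _; apply: etrans (GP _ mA); rewrite [LHS]image_probabilityE.
by congr (G _); apply/seteqP; split => -[x y] //= [].
Qed.

End marginals.

Lemma measurable_affine d (T : measurableType d) {R : realType} (f g : T -> R) (k l c : R) :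
  measurable_fun setT f -> measurable_fun setT g ->
  measurable_fun setT (fun x => (k * f x + c + l * g x)%:E).
Proof.
move=> mf mg; apply/measurable_EFinP; apply: measurable_funD; last exact: measurable_funM.
by apply: measurable_funD => //; exact: measurable_funM.
Qed.

Lemma integral_affine_le d (T : measurableType d) {R : realType} (P : probability T R)
    (f g : T -> R) (k l c A B : R) :
  measurable_fun setT f -> measurable_fun setT g ->
  (forall x, 0 <= f x) -> (forall x, 0 <= g x) -> 0 <= k -> 0 <= l -> 0 <= c ->
  (\int[P]_x (f x)%:E <= A%:E)%E -> (\int[P]_x (g x)%:E <= B%:E)%E ->
  (\int[P]_x (k * f x + c + l * g x)%:E <= (k * A + c + l * B)%:E)%E.
Proof.
move=> mf mg f0 g0 k0 l0 c0 fA gB.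
have mE (h : T -> R) : measurable_fun setT h -> measurable_fun setT (EFin \o h).
  by move=> ?; apply/measurable_EFinP.
have mk : measurable_fun setT (fun x => k * f x) by exact: measurable_funM.
have ml : measurable_fun setT (fun x => l * g x) by exact: measurable_funM.
rewrite (eq_integral (fun x => ((k * f x)%:E + c%:E) + (l * g x)%:E)%E)//.
rewrite ge0_integralD//; last 4 first.
- by move=> x _; rewrite -EFinD lee_fin addr_ge0// mulr_ge0.
- by apply: emeasurable_funD => //; exact: mE.
- by move=> x _; rewrite lee_fin mulr_ge0.
- exact: mE.
rewrite ge0_integralD//; last 2 first.
- by move=> x _; rewrite lee_fin mulr_ge0.
- exact: mE.
under eq_integral do rewrite EFinM.
under [X in (_ + X <= _)%E]eq_integral do rewrite EFinM.
rewrite !ge0_integralZl//; try by [exact: mE | move=> x _; rewrite lee_fin].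
have -> : (\int[P]__ c%:E = c%:E)%E.
  by rewrite [LHS]integral_cst//= [X in (_ * X)%E]probability_setT mule1.
rewrite !EFinD !EFinM.
by rewrite leeD// ?leeD2r// lee_wpmul2l// lee_fin.
Qed.

(** * The Wasserstein distance *)

Section wasserstein_theory.
Context {R : realType} {d : nat} (p : R).
Local Notation prob := (probability (borelRd R d) R).
Implicit Types mu nu : prob.
Hypothesis p1 : 1 < p.
Let p0 : 0 < p. Proof. exact: lt_trans p1. Qed.

(** The cells are cubes, labelled by the integer parts of the scaled coordinates; [pickle] turns
    these finite vectors of integers into natural numbers. *)
Lemma cell_fun (e : R) : 0 < e -> exists c : 'rV[R]_d -> nat,
  (forall k, measurable (c @^-1` [set k] : set (borelRd R d))) /\
  (forall y z, c y = c z -> enorm (y - z) <= e).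
Proof.
(* The Euclidean norm is at most the sum of the [d] coordinates, so this side suffices; the
   successor keeps the division meaningful for [d = 0]. *)
move=> e0; pose eta := e / d.+1%:R; have eta0 : 0 < eta by rewrite divr_gt0.
pose fl (y : 'rV[R]_d) : {ffun 'I_d -> int} := [ffun i => Num.floor (y ord0 i / eta)].
have flE (y : 'rV[R]_d) i (n : int) : (fl y i == n) = (n%:~R <= y ord0 i / eta < (n + 1)%:~R).
  by rewrite ffunE floor_eq.
exists (pickle \o fl); split => [k|y z /= /(pcan_inj pickleK) yz].
  have [[z zk]|nz] := pselect (exists z : {ffun 'I_d -> int}, pickle z = k); last first.
    rewrite (_ : _ @^-1` _ = set0); first exact: measurable0.
    by apply/seteqP; split => // y /= yk; case: nz; exists (fl y).
  rewrite (_ : _ @^-1` _ = \bigcap_(i : 'I_d)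
      ((fun y : 'rV[R]_d => y ord0 i / eta) @^-1` `[(z i)%:~R, (z i + 1)%:~R[)).
    apply: countable_bigcapT_measurable => i; rewrite -[X in measurable X]setTI.
    apply: (measurable_funM (measurable_coord i) (measurable_cst _)) => //.
  apply/seteqP; split => y /=.
    rewrite -zk => /(pcan_inj pickleK) yz i _ /=; rewrite in_itv/=.
    by rewrite -flE yz.
  move=> H; rewrite -zk; congr (pickle _); apply/ffunP => i; apply/eqP; rewrite flE.
  by have := H i Logic.I; rewrite /= in_itv.
apply: le_trans (enorm_le_sum _) _.
apply: (@le_trans _ _ (\sum_(i < d) eta)); last first.
  rewrite sumr_const card_ord -mulr_natr /eta -mulrA ler_piMr ?(ltW e0)//.
  by rewrite mulrC ler_pdivrMr ?ltr0n// mul1r ler_nat.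
apply: ler_sum => i _; rewrite !mxE.
have /eqP := erefl (fl y i); rewrite flE => /andP[y1 y2].
have /eqP := erefl (fl y i); rewrite {1}yz flE => /andP[z1 z2].
have E (x : R) : x = x / eta * eta by rewrite divfK// gt_eqF.
rewrite (E (y _ _)) (E (z _ _)) -mulrBl normrM (gtr0_norm eta0) ler_piMl ?(ltW eta0)//.
move: y1 y2 z1 z2; rewrite intrD; move: (y _ _ / _) (z _ _ / _) (_%:~R) => a b c *.
by rewrite ler_norml; apply/andP; split; lra.
Qed.

Definition transport_cost (pi : probability (borelRd R d * borelRd R d)%type R) :=
  (\int[pi]_z (enorm (z.1 - z.2 : 'rV[R]_d) `^ p)%:E)%E.

Lemma transport_cost_ge0 pi : (0 <= transport_cost pi)%E.
Proof. by apply: integral_ge0 => z _; rewrite lee_fin powR_ge0. Qed.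

Lemma measurable_displacement :
  measurable_fun setT (fun z : borelRd R d * borelRd R d => enorm (z.1 - z.2 : 'rV[R]_d)).
Proof.
have msub : measurable_fun setT
    (fun z : borelRd R d * borelRd R d => (z.1 - z.2 : 'rV[R]_d) : borelRd R d).
  apply: measurable_fun_rV => i; under eq_fun do rewrite !mxE.
  apply: measurable_funB.
    exact: measurableT_comp (measurable_coord i) measurable_fst.
  exact: measurableT_comp (measurable_coord i) measurable_snd.
exact: measurableT_comp measurable_enorm msub.
Qed.

Lemma wasserstein_ge0 mu nu : (0 <= wasserstein p mu nu)%E.
Proof. exact: poweR_ge0. Qed.

Lemma wasserstein_le mu nu pi (r : R) : 0 <= r -> coupling mu nu pi ->
  (transport_cost pi <= (r `^ p)%:E)%E -> (wasserstein p mu nu <= r%:E)%E.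
Proof.
move=> r0 cpi cost; have E : r%:E = ((r `^ p)%:E `^ p^-1)%E.
  by rewrite poweR_EFin -powRrM divff ?gt_eqF// powRr1.
rewrite E; apply: gt0_ler_poweR; rewrite ?invr_ge0 ?(ltW p0)//.
- rewrite in_itv/= leey andbT; apply: le_ereal_inf_tmp => _ [pi' _ <-].
  exact: transport_cost_ge0.
- by rewrite in_itv/= leey andbT lee_fin powR_ge0.
- by apply: le_trans cost; apply: ereal_inf_lbound; exists pi.
Qed.

(** The strict margin above the distance is what lets a coupling be extracted from the infimum. *)
Lemma wasserstein_approx mu nu (r : R) : (wasserstein p mu nu < r%:E)%E ->
  exists2 pi, coupling mu nu pi & (transport_cost pi <= (r `^ p)%:E)%E.
Proof.
move=> H; have r0 : 0 < r by rewrite -lte_fin (le_lt_trans (wasserstein_ge0 mu nu)).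
set I := ereal_inf [set transport_cost pi | pi in coupling mu nu].
have I0 : (0 <= I)%E by apply: le_ereal_inf_tmp => _ [pi' _ <-]; exact: transport_cost_ge0.
have Ir : (I < (r `^ p)%:E)%E.
  rewrite ltNge; apply/negP => rI.
  have : ((r `^ p)%:E `^ p^-1 <= I `^ p^-1)%E.
    apply: gt0_ler_poweR => //; rewrite ?invr_ge0 ?(ltW p0)//.
    - by rewrite in_itv/= leey andbT lee_fin powR_ge0.
    - by rewrite in_itv/= leey andbT.
  rewrite poweR_EFin -powRrM divff ?gt_eqF// powRr1 ?(ltW r0)// => /(lt_le_trans H).
  by rewrite ltxx.
have If : I \is a fin_num by rewrite ge0_fin_numE// (lt_trans Ir)// ltry.
have e0 : 0 < r `^ p - fine I by rewrite subr_gt0 -lte_fin fineK.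
have [_ [pi cpi <-]] := lb_ereal_inf_adherent e0 If.
rewrite EFinB fineK// -/I addeCA subee// adde0 => /ltW cost.
by exists pi.
Qed.

Lemma swap_coupling mu nu pi : coupling mu nu pi -> exists2 pi', coupling nu mu pi' &
  transport_cost pi' = transport_cost pi.
Proof.
move=> [c1 c2]; have ms : measurable_fun setT (fun z : borelRd R d * borelRd R d => (z.2, z.1)).
  exact: measurable_fun_pair.
exists (image_probability ms pi).
  split => A mA; rewrite [LHS]image_probabilityE.
    by rewrite -c2//; congr (pi _); apply/seteqP; split => z /= [].
  by rewrite -c1//; congr (pi _); apply/seteqP; split => z /= [].
rewrite /transport_cost ge0_integral_image/=.
- by apply: eq_integral => z _; rewrite enormB.
- apply/measurable_EFinP; apply: measurableT_comp (measurable_powR _) _.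
  exact: measurable_displacement.
- by move=> z; rewrite lee_fin powR_ge0.
Qed.

Lemma wasserstein_le_sym mu nu : (wasserstein p nu mu <= wasserstein p mu nu)%E.
Proof.
have [|W1] := leP +oo%E (wasserstein p mu nu).
  by rewrite leye_eq => /eqP ->; rewrite leey.
have Wf : wasserstein p mu nu \is a fin_num by rewrite ge0_fin_numE// wasserstein_ge0.
rewrite -(fineK Wf); apply/lee_addgt0Pr => e e0; rewrite -EFinD.
have [|pi cpi cost] := @wasserstein_approx mu nu (fine (wasserstein p mu nu) + e).
  by rewrite EFinD fineK// lteDl// lte_fin.
have [pi' cpi' E] := swap_coupling cpi.
apply: (wasserstein_le (pi := pi')) => //; last by rewrite E.
by rewrite addr_ge0 ?(ltW e0)// fine_ge0// wasserstein_ge0.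
Qed.

Lemma wassersteinC mu nu : wasserstein p nu mu = wasserstein p mu nu.
Proof. by apply/le_anti/andP; split; exact: wasserstein_le_sym. Qed.

(** The two couplings are glued over cells of diameter at most [e], so that their middle points,
    which need not agree, are almost surely within [e]. The pointwise triangle inequality then has a
    third term, which vanishes with [e]. *)
Lemma wasserstein_triangle mu1 mu2 mu3 (a b : R) :
  (wasserstein p mu1 mu2 <= a%:E)%E -> (wasserstein p mu2 mu3 <= b%:E)%E ->
  (wasserstein p mu1 mu3 <= (a + b)%:E)%E.
Proof.
move=> Wa Wb.
have a0 : 0 <= a by rewrite -lee_fin (le_trans (wasserstein_ge0 mu1 mu2)).
have b0 : 0 <= b by rewrite -lee_fin (le_trans (wasserstein_ge0 mu2 mu3)).
apply/lee_addgt0Pr => e' e'0; rewrite -EFinD.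
(* The slack is spent three times: on each of the two couplings and on the cells. *)
pose e := e' / 3; have e0 : 0 < e by rewrite divr_gt0.
have ae0 : 0 < a + e by rewrite ltr_wpDl.
have be0 : 0 < b + e by rewrite ltr_wpDl.
have [|pi [c1 c2] cost] := @wasserstein_approx mu1 mu2 (a + e).
  by rewrite (le_lt_trans Wa)// lte_fin ltrDl.
have [|rho [c3 c4] cost'] := @wasserstein_approx mu2 mu3 (b + e).
  by rewrite (le_lt_trans Wb)// lte_fin ltrDl.
have [c [mc Hc]] := cell_fun e0.
have m1 k : measurable ((c \o snd : borelRd R d * borelRd R d -> nat) @^-1` [set k]).
  by rewrite comp_preimage -[X in measurable X]setTI; exact: measurable_snd.
have m2 k : measurable ((c \o fst : borelRd R d * borelRd R d -> nat) @^-1` [set k]).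
  by rewrite comp_preimage -[X in measurable X]setTI; exact: measurable_fst.
have ab k : pi ((c \o snd) @^-1` [set k]) = rho ((c \o fst) @^-1` [set k]).
  transitivity (mu2 (c @^-1` [set k])); [rewrite -c2//|rewrite -c3//];
    by congr (_ _); apply/seteqP; split => z //= [].
have [G [G1 G2 G3]] := discrete_gluing m1 m2 ab.
have mpr : measurable_fun setT
    (fun w : (borelRd R d * borelRd R d) * (borelRd R d * borelRd R d) => (w.1.1, w.2.2)).
  by apply: measurable_fun_pair; apply: measurableT_comp => //.
apply: (wasserstein_le (pi := image_probability mpr G)).
- by rewrite addr_ge0 ?(ltW e'0)// addr_ge0.
- split => A mA; rewrite [LHS]image_probabilityE.
    rewrite -c1// -G1; last exact: measurableX.
    by congr (G _); apply/seteqP; split => w /= [] //= [].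
  rewrite -c4// -G2; last exact: measurableX.
  by congr (G _); apply/seteqP; split => w /= [] //= _ [].
have mcost : measurable_fun setT
    (fun z : borelRd R d * borelRd R d => (enorm (z.1 - z.2 : 'rV[R]_d) `^ p)%:E).
  apply/measurable_EFinP; apply: measurableT_comp (measurable_powR _) _.
  exact: measurable_displacement.
rewrite /transport_cost ge0_integral_image//=; last by move=> z; rewrite lee_fin powR_ge0.
have dpow0 (z : 'rV[R]_d) : (0 <= (enorm z `^ p)%:E)%E by rewrite lee_fin powR_ge0.
have int1 : (\int[G]_w (enorm (w.1.1 - w.1.2 : 'rV[R]_d) `^ p)%:E <= ((a + e) `^ p)%:E)%E.
  apply: le_trans cost; rewrite /transport_cost.
  by rewrite -(ge0_integral_marginal1 G1 mcost).
have int2 : (\int[G]_w (enorm (w.2.1 - w.2.2 : 'rV[R]_d) `^ p)%:E <= ((b + e) `^ p)%:E)%E.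
  apply: le_trans cost'; rewrite /transport_cost.
  by rewrite -(ge0_integral_marginal2 G2 mcost).
have mdisp := measurable_displacement.
have mf1 : measurable_fun setT (fun w : (borelRd R d * borelRd R d) * (borelRd R d * borelRd R d) =>
    enorm (w.1.1 - w.1.2 : 'rV[R]_d) `^ p).
  apply: measurableT_comp (measurable_powR _) _.
  exact: measurableT_comp mdisp measurable_fst.
have mf2 : measurable_fun setT (fun w : (borelRd R d * borelRd R d) * (borelRd R d * borelRd R d) =>
    enorm (w.2.1 - w.2.2 : 'rV[R]_d) `^ p).
  apply: measurableT_comp (measurable_powR _) _.
  exact: measurableT_comp mdisp measurable_snd.
pose W := a + e + e + (b + e).
have W0 : 0 < W by rewrite /W addr_gt0// addr_gt0.
have WE : a + b + e' = W by rewrite /W (_ : e' = e + e + e); [ring|rewrite /e; field].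
rewrite WE.
(* The three terms are combined by [powR3_le] with weights equal to their bounds [a + e], [e] and
   [b + e], of total [W]; the integrated bound is then exactly [W^p], as in Minkowski's
   inequality. *)
pose k := W `^ (p - 1) * (a + e) `^ (1 - p).
pose l := W `^ (p - 1) * (b + e) `^ (1 - p).
pose m := W `^ (p - 1) * (e `^ (1 - p) * e `^ p).
have pw (v : R) : 0 < v -> v `^ (1 - p) * v `^ p = v.
  by move=> v0; rewrite -powRD ?(gt_eqF v0) ?implybT// subrK powRr1// ltW.
have kl : k * (a + e) `^ p + m + l * (b + e) `^ p = W `^ p.
  rewrite /k /l /m -!mulrA !pw// -!mulrDr -/W -[X in _ * X](powRr1 (ltW W0)) -powRD.
    by rewrite subrK.
  by rewrite (gt_eqF W0) implybT.
have k0 : 0 <= k by rewrite mulr_ge0 ?powR_ge0.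
have l0 : 0 <= l by rewrite mulr_ge0 ?powR_ge0.
have m0 : 0 <= m by rewrite mulr_ge0 ?powR_ge0// mulr_ge0 ?powR_ge0.
rewrite -kl; apply: le_trans (integral_affine_le mf1 mf2 _ _ _ _ _ int1 int2).
- apply: ae_ge0_le_integral => //.
  + exact: measurableT_comp mcost mpr.
  + by move=> w _; rewrite lee_fin addr_ge0 ?mulr_ge0 ?powR_ge0// addr_ge0 ?mulr_ge0 ?powR_ge0.
  + exact: (measurable_affine k l m mf1 mf2).
  exists [set z | (c \o snd) z.1 != (c \o fst) z.2]; split => //.
    rewrite (_ : mkset _ = ~` \bigcup_k (((c \o snd) @^-1` [set k]) `*` ((c \o fst) @^-1` [set k]))).
      by apply: measurableC; apply: bigcup_measurable => n _; apply: measurableX.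
    apply/seteqP; split => -[x y] /=.
      by move=> /eqP xy [n _ [/= ax bx]]; apply: xy; rewrite ax bx.
    by move=> H; apply/eqP => xy; apply: H; exists (c x.2) => //; split => /=.
  move=> w; apply: contra_notP => /negP; rewrite negbK => /eqP/= /Hc cw _.
  rewrite lee_fin /k /l /m -!mulrA -!mulrDr.
  have := powR3_le p1 (enorm_ge0 (w.1.1 - w.1.2 : 'rV[R]_d)) (ltW e0) (enorm_ge0 (w.2.1 - w.2.2 : 'rV[R]_d)) ae0 e0 be0.
  apply: le_trans; apply: ge0_ler_powR; rewrite ?nnegrE ?(ltW p0) ?enorm_ge0//.
    by rewrite !addr_ge0 ?enorm_ge0 ?(ltW e0).
  rewrite (le_trans (enorm_triangle w.1.2 _ _))// -addrA lerD2l.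
  by rewrite (le_trans (enorm_triangle w.2.1 _ _))// lerD2r.
- by move=> w; rewrite powR_ge0.
- by move=> w; rewrite powR_ge0.
- exact: k0.
- exact: l0.
- exact: m0.
Qed.

End wasserstein_theory.

(** * Existence of the metric derivative *)

Section speed.
Context {R : realType}.
Local Notation leb := (@lebesgue_measure R).

Lemma monotone_derivative_ge0 (F : R -> R) (a t s : R) : a < s < t ->
  (forall x y, a <= x -> x <= y -> y <= t -> F x <= F y) ->
  derivable F s 1 -> 0 <= derive1 F s.
Proof.
move=> /andP[as_ st] mF dF; rewrite /derive1; apply: limr_ge.
  by move: dF; rewrite /derivable; under eq_fun do rewrite [_%:A]mulr1.
have : \forall h \near (0 : R)^', h != 0 /\ (a < h + s < t).
  near=> h; split; first by near: h; exact: nbhs_dnbhs_neq.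
  have : `|h| < Num.min (s - a) (t - s).
    by near: h; apply: dnbhs0_lt; rewrite lt_min !subr_gt0 as_.
  by rewrite lt_min !ltr_norml => /andP[/andP[? ?] /andP[? ?]]; apply/andP; split; lra.
apply: filterS => h [h0 /andP[h1 h2]].
move: h0; rewrite neq_lt => /orP[h0|h0]; rewrite /GRing.scale/=.
  by rewrite mulr_le0// ?invr_le0 ?(ltW h0)// subr_le0 mF ?(ltW h1) ?(ltW st)//; lra.
by rewrite mulr_ge0// ?invr_ge0 ?(ltW h0)// subr_ge0 mF ?(ltW h2) ?(ltW as_)//; lra.
Unshelve. all: by end_near. Qed.

(** The primitive of [f] is nondecreasing, and its derivative is [f] almost everywhere. *)
Lemma ae_ge0_of_integral (a t : R) (f : R -> R) : 0 <= a ->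
  leb.-integrable `[0, t] (EFin \o f) ->
  (forall r s, a <= r -> r <= s -> s <= t -> 0 <= \int[leb]_(x in `[r, s]) f x) ->
  {ae leb, forall s, a <= s <= t -> 0 <= f s}.
Proof.
move=> a0 intf f0; pose g := f \_ `[0, t].
have intg : leb.-integrable setT (EFin \o g).
  rewrite (_ : _ \o _ = (EFin \o f) \_ `[0, t]); last first.
    by apply/funext => x /=; rewrite /g /patch; case: ifP.
  by have [H _] := @integrable_mkcond _ _ R leb `[0, t] (EFin \o f) (measurable_itv _); exact: H.
have mg : measurable_fun setT g.
  exact: (measurable_EFinP _ _).1 (measurable_int _ intg).
have lg : locally_integrable setT g.
  split; [exact: mg|exact: openT|].
  move=> K _ cK; have [_] := integrableP _ _ _ intg.
  apply: le_lt_trans; apply: ge0_subset_integral => //.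
  - exact: compact_measurable.
  - by apply/measurable_EFinP; exact: measurableT_comp.
have intgy y : leb.-integrable [set` Interval (BLeft a) (BRight y)] (EFin \o g).
  by apply: integrableS intg => //; exact: measurable_itv.
have := FTC1 intgy lg.
have := ae_neq a; have := ae_neq t.
apply: (@filterS3 _ _ (@ae_lebesgue_filter R)) => s st sa H /andP[as_ st'].
have a1 : a < s by rewrite lt_neqAle eq_sym sa.
have s1 : s < t by rewrite lt_neqAle st.
have [dF F'] := H a1.
have -> : f s = g s by rewrite /g patchE mem_set//= in_itv/= st' (le_trans a0).
rewrite -F'; apply: monotone_derivative_ge0 (dF); first by apply/andP; split; [exact: a1|exact: s1].
move=> x y ax xy yt; rewrite -subr_ge0.
have ay : leb.-integrable [set` Interval (BLeft a) (BRight y)] (EFin \o g) by exact: intgy.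
rewrite (Rintegral_itvB ay) ?bnd_simp//.
rewrite Rintegral_itv_obnd_cbnd; last first.
  by apply: integrableS intg => //; exact: measurable_itv.
rewrite (_ : \int[leb]_(x0 in _) _ = \int[leb]_(z in `[x, y]) f z); first exact: f0.
apply: eq_Rintegral => z; rewrite inE/= in_itv/= => /andP[xz zy].
by rewrite /g patchE mem_set//= in_itv/= (le_trans a0 (le_trans ax xz)) (le_trans zy).
Qed.

Section Lp.
Variables (p t : R).
Hypothesis p1 : 1 < p.

Lemma Lp_integrable h : Lp_on p t h -> leb.-integrable `[0, t] (fun s => (`|h s| `^ p)%:E).
Proof.
move=> [mh hp]; apply/integrableP; split.
  apply/measurable_EFinP; apply: measurableT_comp (measurable_powR _) _.
  exact: measurableT_comp mh.
by under eq_integral do rewrite gee0_abs ?lee_fin ?powR_ge0//.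
Qed.

Lemma Lp_integrable1 h : Lp_on p t h -> leb.-integrable `[0, t] (EFin \o h).
Proof.
move=> Lh; have i1 : leb.-integrable `[0, t] (fun s => (1 + `|h s| `^ p)%:E).
  have i0 : leb.-integrable `[0, t] (fun=> (1 : R)%:E).
    apply: continuous_compact_integrable; first exact: segment_compact.
    by apply: continuous_subspaceT; exact: cst_continuous.
  have := @integrableD _ _ _ leb _ (measurable_itv `[0, t]) _ _ i0 (Lp_integrable Lh).
  by apply: eq_integrable.
apply: le_integrable i1 => //; first by apply/measurable_EFinP; exact: Lh.1.
move=> s _ /=; rewrite lee_fin (@ger0_norm _ (1 + _)); last by rewrite addr_ge0// powR_ge0.
by have := powR_le_linear p1 (@ltr01 R) (normr_ge0 (h s)); rewrite powR1 mul1r.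
Qed.

(** Uniform absolute continuity of the integral: [|h| <= M + M^(1 - p) |h|^p], where [M] makes the
    second part at most [e / 2], after which [delta] bounds the first. *)
Lemma Lp_family_small h e : Lp_on p t h -> 0 < e -> exists2 delta : R, 0 < delta &
  forall s, itv_family t s -> total_length s < delta ->
    \sum_(J <- s) \int[leb]_(x in `[J.1, J.2]) `|h x| <= e.
Proof.
move=> Lh e0; pose C := fine (\int[leb]_(s in `[0%R, t]) (`|h s| `^ p)%:E)%E.
have C0 : 0 <= C by rewrite fine_ge0// integral_ge0// => s _; rewrite lee_fin powR_ge0.
have CE : (\int[leb]_(s in `[0%R, t]) (`|h s| `^ p)%:E)%E = C%:E.
  rewrite fineK// ge0_fin_numE; first exact: Lh.2.
  by apply: integral_ge0 => s _; rewrite lee_fin powR_ge0.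
have e20 : 0 < e / 2 by rewrite divr_gt0.
have [M M0 Me] := powR_small p1 C0 e20.
exists (e / 2 / M) => [|s fs ls]; first by rewrite divr_gt0.
have /andP[/allP s0t _] := fs.
have mhp : measurable_fun `[0, t] (fun s => `|h s| `^ p).
  apply: measurableT_comp (measurable_powR _) _; exact: measurableT_comp Lh.1.
have bound J : J \in s -> ((\int[leb]_(x in `[J.1, J.2]) `|h x|)%:E <=
    (M * (J.2 - J.1))%:E + (M `^ (1 - p))%:E * \int[leb]_(x in `]J.1, J.2[) (`|h x| `^ p)%:E)%E.
  move=> /s0t/and3P[a0 ab bt]; have sub := sub_itv a0 bt.
  have ih : leb.-integrable `[J.1, J.2] (EFin \o h).
    by apply: integrableS (Lp_integrable1 Lh) => //; exact: measurable_itv.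
  have iha : leb.-integrable `[J.1, J.2] (EFin \o (fun x => `|h x|)).
    by have := integrable_abse ih; apply: eq_integrable.
  rewrite /Rintegral fineK; last by apply: integrable_fin_num iha => //; exact: measurable_itv.
  have mp : measurable_fun `[J.1, J.2] (fun x => (`|h x| `^ p)%:E).
    by apply/measurable_EFinP; exact: measurable_funS mhp.
  rewrite -integral_cst_itv// -(@integral_itv_bndoo _ _ _ (fun x => (`|h x| `^ p)%:E) true false); last first.
    by apply: measurable_funS mp => // x /=; rewrite !in_itv/= => /andP[/ltW-> /ltW->].
  have pE (x : R) : (0 <= (`|h x| `^ p)%:E)%E by rewrite lee_fin powR_ge0.
  have Mp0 : (0 <= (M `^ (1 - p))%:E)%E by rewrite lee_fin powR_ge0.
  rewrite -(ge0_integralZl leb (measurable_itv _) mp (fun x _ => pE x) Mp0).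
  rewrite -ge0_integralD//; last first.
  - exact: measurable_funeM.
  - by move=> x _; rewrite mule_ge0.
  - by move=> x _; rewrite lee_fin ltW.
  apply: ge0_le_integral => //.
  - by move: (measurable_int _ iha).
  - by apply: emeasurable_funD => //; exact: measurable_funeM.
  by move=> x _; rewrite -EFinM -EFinD lee_fin powR_le_linear.
rewrite -lee_fin -sumEFin big_seq.
apply: le_trans (lee_sum _ bound) _; rewrite -big_seq big_split/= sumEFin -mulr_sumr.
rewrite -ge0_sume_distrr; last first.
  by move=> J _; apply: integral_ge0 => x _; rewrite lee_fin powR_ge0.
have := family_integral_le mhp (fun x => powR_ge0 _ _) fs.
rewrite CE => /(lee_wpmul2l (x := (M `^ (1 - p))%:E)); rewrite lee_fin powR_ge0 => /(_ isT) h2.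
apply: le_trans (leeD2l _ h2) _; rewrite -EFinM -EFinD lee_fin.
have : M * total_length s <= e / 2.
  by rewrite -ler_pdivlMl// mulrC ltW.
by rewrite /total_length => h1; move: h1 Me; move: (M * _) (M `^ _ * _) => x y *; lra.
Qed.

Lemma density_le (a : R) (F g k : R -> R) : 0 <= a -> leb.-integrable `[0, t] (EFin \o g) ->
  leb.-integrable `[0, t] (EFin \o k) ->
  (forall r s, a <= r -> r <= s -> s <= t -> F s - F r = \int[leb]_(x in `[r, s]) g x) ->
  (forall r s, a <= r -> r <= s -> s <= t -> F s - F r <= \int[leb]_(x in `[r, s]) k x) ->
  {ae leb, forall s, a <= s <= t -> g s <= k s}.
Proof.
move=> a0 ig ik Fg Fk.
have ikg : leb.-integrable `[0, t] (EFin \o (k \- g)).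
  by have := @integrableB _ _ _ leb _ (measurable_itv `[0, t]) _ _ ik ig; apply: eq_integrable.
have H r s : a <= r -> r <= s -> s <= t -> 0 <= \int[leb]_(x in `[r, s]) (k \- g) x.
  move=> ar rs st; have sub := sub_itv (le_trans a0 ar) st.
  rewrite RintegralB//; last 2 first.
  - by apply: integrableS ik => //; exact: measurable_itv.
  - by apply: integrableS ig => //; exact: measurable_itv.
  by rewrite subr_ge0 -Fg// Fk.
have := ae_ge0_of_integral a0 ikg H.
by apply: (@filterS _ _ (@ae_lebesgue_filter R)) => s h /h; rewrite subr_ge0.
Qed.

End Lp.

End speed.

(** * Distance functions along a path of measures *)

Section metric_derivative.
Context {R : realType} {d : nat} (p t : R).
Local Notation leb := (@lebesgue_measure R).
Local Notation prob := (probability (borelRd R d) R).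
Variable sigma : R -> prob.
Hypotheses (p1 : 1 < p).

Lemma ae_le_Rintegral (D : set R) (f g : R -> R) : measurable D ->
  leb.-integrable D (EFin \o f) -> leb.-integrable D (EFin \o g) ->
  {ae leb, forall s, D s -> f s <= g s} ->
  \int[leb]_(s in D) f s <= \int[leb]_(s in D) g s.
Proof.
move=> mD intf intg fg; rewrite -subr_ge0 -RintegralB//.
have iB : leb.-integrable D (EFin \o (g \- f)).
  by have := @integrableB _ _ _ leb _ mD _ _ intg intf; apply: eq_integrable.
rewrite (_ : \int[leb]_(s in D) _ = \int[leb]_(s in D) `|(g \- f) s|); first exact: Rintegral_ge0.
congr fine; apply: ae_eq_integral => //.
- exact: measurable_int iB.
- by apply/measurable_EFinP; apply: measurableT_comp => //; apply/measurable_EFinP; exact: measurable_int iB.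
by move: fg; apply: (@filterS _ _ (@ae_lebesgue_filter R)) => s fg /fg h /=; rewrite ger0_norm// subr_ge0.
Qed.

Lemma Rintegral_itv_split (k : R -> R) (r m s : R) : leb.-integrable `[r, s] (EFin \o k) ->
  r <= m -> m <= s ->
  \int[leb]_(x in `[r, s]) k x = \int[leb]_(x in `[r, m]) k x + \int[leb]_(x in `[m, s]) k x.
Proof.
move=> ik rm ms; apply/eqP; rewrite addrC -subr_eq; apply/eqP.
rewrite (Rintegral_itvB ik) ?bnd_simp// Rintegral_itv_obnd_cbnd//.
apply: integrableS ik => //.
by move=> x /=; rewrite !in_itv/= => /andP[/ltW mx ->]; rewrite (le_trans rm mx).
Qed.

Let w a b : R := fine (wasserstein p (sigma a) (sigma b)).

Let w_ge0 a b : 0 <= w a b. Proof. by rewrite fine_ge0// wasserstein_ge0. Qed.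

Section bounds.
Variable k : R -> R.
Hypothesis sk : speed_bound p t sigma k.

Lemma speed_bound_integrable a b : 0 <= a -> b <= t -> leb.-integrable `[a, b] (EFin \o k).
Proof.
move=> a0 bt; apply: integrableS (Lp_integrable1 p1 sk.1) => //; exact: sub_itv.
Qed.

Let wE a b : 0 <= a -> a <= b -> b <= t ->
  wasserstein p (sigma a) (sigma b) = (w a b)%:E /\ w a b <= \int[leb]_(x in `[a, b]) k x.
Proof.
move=> a0 ab bt; have ik := speed_bound_integrable a0 bt.
have := sk.2 a b a0 ab bt.
have If : (\int[leb]_(x in `[a, b]) (k x)%:E)%E \is a fin_num.
  exact: integrable_fin_num ik.
have -> : (\int[leb]_(x in `[a, b]) (k x)%:E)%E = (\int[leb]_(x in `[a, b]) k x)%:E.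
  by rewrite /Rintegral fineK.
move=> W; have Wf : wasserstein p (sigma a) (sigma b) \is a fin_num.
  by rewrite ge0_fin_numE ?wasserstein_ge0// (le_lt_trans W)// ltry.
have E : wasserstein p (sigma a) (sigma b) = (w a b)%:E by rewrite /w fineK.
by split => //; rewrite -lee_fin -E.
Qed.

Lemma wasserstein_fin a b : 0 <= a -> a <= b -> b <= t ->
  wasserstein p (sigma a) (sigma b) = (w a b)%:E.
Proof. by move=> a0 ab bt; have [] := wE a0 ab bt. Qed.

Lemma wasserstein_le_Rintegral a b : 0 <= a -> a <= b -> b <= t ->
  w a b <= \int[leb]_(x in `[a, b]) k x.
Proof. by move=> a0 ab bt; have [] := wE a0 ab bt. Qed.

Lemma speed_bound_Rintegral_ge0 a b : 0 <= a -> a <= b -> b <= t ->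
  0 <= \int[leb]_(x in `[a, b]) k x.
Proof. by move=> a0 ab bt; apply: le_trans (wasserstein_le_Rintegral a0 ab bt). Qed.

Lemma distance_triangle a b c : 0 <= a -> a <= b -> b <= c -> c <= t -> w a c <= w a b + w b c.
Proof.
move=> a0 ab bc ct; have bt := le_trans bc ct; have b0 := le_trans a0 ab.
rewrite -lee_fin -wasserstein_fin// ?(le_trans ab)//.
by apply: (wasserstein_triangle p1 (mu2 := sigma b)); rewrite wasserstein_fin.
Qed.

Let wD' a b c : 0 <= a -> a <= b -> b <= c -> c <= t -> w a b <= w a c + w b c.
Proof.
move=> a0 ab bc ct; have bt := le_trans bc ct; have b0 := le_trans a0 ab.
rewrite -lee_fin -wasserstein_fin//.
apply: (wasserstein_triangle p1 (mu2 := sigma c)); first by rewrite wasserstein_fin ?(le_trans ab).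
by rewrite (wassersteinC p1) wasserstein_fin.
Qed.

Lemma distance_increment a r s : 0 <= a <= t -> 0 <= r -> r <= s -> s <= t ->
  `|w a (Num.max a s) - w a (Num.max a r)| <= \int[leb]_(x in `[r, s]) k x.
Proof.
move=> /andP[a0 at_] r0 rs st; have [sa|as_] := leP s a.
  by rewrite !max_l ?(le_trans rs)// subrr normr0; exact: speed_bound_Rintegral_ge0.
set r' := Num.max a r.
have rr' : r <= r' by rewrite /r' le_max lexx orbT.
have ar' : a <= r' by rewrite /r' le_max lexx.
have r's : r' <= s by rewrite /r' ge_max (ltW as_).
have r'0 : 0 <= r' := le_trans r0 rr'. have r't : r' <= t := le_trans r's st.
rewrite (Rintegral_itv_split (speed_bound_integrable r0 st) rr' r's).
apply: (@le_trans _ _ (w r' s)); last first.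
  by rewrite (le_trans (wasserstein_le_Rintegral r'0 r's st))// lerDr speed_bound_Rintegral_ge0.
have := distance_triangle a0 ar' r's st; have := wD' a0 ar' r's st.
by rewrite ler_norml => *; apply/andP; split; lra.
Qed.

Lemma speed_bound_ae_ge0 : {ae leb, forall s, 0 <= s <= t -> 0 <= k s}.
Proof.
have i0 : leb.-integrable `[0, t] (EFin \o cst (0 : R)).
  by have := integrable0 leb (`[0, t]); apply: eq_integrable.
have := @density_le _ t 0 (cst 0) (cst 0) k (lexx _) i0 (Lp_integrable1 p1 sk.1).
apply => [r s r0 rs st|r s r0 rs st]; rewrite subrr.
  by rewrite /Rintegral integral0.
exact: speed_bound_Rintegral_ge0.
Qed.

End bounds.

Hypothesis t0 : 0 <= t.
Variable h : R -> R.
Hypothesis sh : speed_bound p t sigma h.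

(** Distance from [sigma a], frozen before the time [a], so that distances are always taken between
    ordered times, as in [speed_bound]. *)
Let F a s := w a (Num.max a s).

Let iabs a b : 0 <= a -> b <= t -> leb.-integrable `[a, b] (EFin \o (fun s => `|h s|)).
Proof.
move=> a0 bt; have := integrable_abse (speed_bound_integrable sh a0 bt).
by apply: eq_integrable.
Qed.

Let le_abs a b : 0 <= a -> b <= t ->
  \int[leb]_(x in `[a, b]) h x <= \int[leb]_(x in `[a, b]) `|h x|.
Proof.
move=> a0 bt; apply: le_Rintegral => //; first exact: speed_bound_integrable.
  exact: iabs.
by move=> x _; exact: ler_norm.
Qed.

Let F_ac a : 0 <= a <= t -> ac_on t (F a).
Proof.
move=> a0t e e0; have [delta delta0 H] := Lp_family_small p1 sh.1 e0.
exists delta => // s fs ls; apply: le_trans (H s fs ls).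
have /andP[/allP s0t _] := fs.
rewrite /oscillation big_seq [leRHS]big_seq; apply: ler_sum => J /s0t/and3P[a0 ab bt].
by apply: le_trans (distance_increment sh a0t a0 ab bt) _; exact: le_abs.
Qed.

Let q n : R := clamp t (if unpickle n is Some q then ratr (q : rat) else 0).

Let q_itv n : 0 <= q n <= t. Proof. exact: clamp_itv. Qed.

(* The density is the supremum over rational [q] of the derivatives of the
   distance functions [s |-> W(sigma q, sigma s)]. *)
Lemma metric_derivative_exists : exists f, is_metric_derivative p t sigma f.
Proof.
have /choice[G HG] n : exists g : R -> R, leb.-integrable setT (EFin \o g) /\
    forall a b, 0 <= a -> a <= b -> b <= t ->
      F (q n) b - F (q n) a = \int[leb]_(x in `[a, b]) g x.
  by have [g [ig gE]] := ac_density t0 (F_ac (q_itv n)); exists g.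
have iG n : leb.-integrable `[0, t] (EFin \o G n).
  by apply: integrableS (HG n).1 => //; exact: measurable_itv.
have Gk k n : speed_bound p t sigma k -> {ae leb, forall s, 0 <= s <= t -> G n s <= k s}.
  move=> sk; apply: (density_le (F := F (q n)) (lexx _) (iG n) (Lp_integrable1 p1 sk.1)).
    exact: (HG n).2.
  move=> r s r0 rs st; apply: le_trans (ler_norm _) _.
  exact: distance_increment.
(* Truncation by [|h|] makes the supremum finite at every time, and not just almost everywhere. As
   [G n <= h] almost everywhere on [[0, t]], it only removes negative values there. *)
pose u n s := Num.min `|h s| (Num.max 0 (G n s)).
have u0 n s : 0 <= u n s by rewrite le_min normr_ge0 le_max lexx.
have mu n : measurable_fun `[0, t] (u n).
  apply: measurable_minr; first by apply: measurableT_comp => //; exact: sh.1.1.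
  apply: measurable_maxr => //; apply/measurable_EFinP; exact: measurable_int (iG n).
pose f s := fine (esups (fun n => (u n s)%:E) 0%N).
have us s : (esups (fun n => (u n s)%:E) 0%N <= (`|h s|)%:E)%E.
  by apply: ge_ereal_sup => _ [n _ <-]; rewrite lee_fin ge_min lexx.
have us0 s : (0 <= esups (fun n => (u n s)%:E) 0%N)%E.
  by apply: le_ereal_sup_tmp; exists (u 0%N s)%:E; [exists 0%N|rewrite lee_fin].
have usE s : esups (fun n => (u n s)%:E) 0%N = (f s)%:E.
  by rewrite /f fineK// ge0_fin_numE// (le_lt_trans (us s))// ltry.
have f0 s : 0 <= f s by rewrite -lee_fin -usE.
have fh s : f s <= `|h s| by rewrite -lee_fin -usE.
have uf n s : u n s <= f s.
  by rewrite -lee_fin -usE; apply: ereal_sup_ubound; exists n.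
have mf : measurable_fun `[0, t] f.
  apply/measurable_EFinP; rewrite (_ : _ \o _ = (fun s => esups (fun n => (u n s)%:E) 0%N)).
    by apply: measurable_fun_esups => n; apply/measurable_EFinP.
  by apply/funext => s; rewrite usE.
have Lf : Lp_on p t f.
  split => //; apply: le_lt_trans sh.1.2; apply: ge0_le_integral => //.
  - apply/measurable_EFinP; apply: measurableT_comp (measurable_powR _) _.
    exact: measurableT_comp mf.
  - apply/measurable_EFinP; apply: measurableT_comp (measurable_powR _) _.
    exact: measurableT_comp sh.1.1.
  - move=> s _; rewrite lee_fin; apply: ge0_ler_powR; rewrite ?nnegrE//.
      by rewrite (le_trans ler01)// ltW.
    by rewrite (ger0_norm (f0 s)).
have if_ a b : 0 <= a -> b <= t -> leb.-integrable `[a, b] (EFin \o f).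
  move=> a0 bt; apply: integrableS (Lp_integrable1 p1 Lf) => //; exact: sub_itv.
exists f; split.
  split => // a b a0 ab bt.
  rewrite (wasserstein_fin sh a0 ab bt).
  have -> : (\int[leb]_(r in `[a, b]) (f r)%:E = (\int[leb]_(r in `[a, b]) f r)%:E)%E.
    by rewrite /Rintegral fineK//; exact: integrable_fin_num (if_ a b a0 bt).
  rewrite lee_fin.
  have at_ := le_trans ab bt; move: ab; rewrite le_eqVlt => /predU1P[<-|ab].
    apply: le_trans (wasserstein_le_Rintegral sh a0 (lexx _) at_) _.
    by rewrite set_itv1 /Rintegral !integral_set1.
  apply/ler_addgt0Pr => e e0; have [delta delta0 H] := Lp_family_small p1 sh.1 e0.
  (* A rational time just after [a] replaces it, at a cost of at most [e] in distance; from there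
     on, the density of the distance to [sigma r] applies. *)
  have [r] : exists r : rat, ratr r \in `]a, Num.min b (a + delta)[.
    by apply: rat_in_itvoo; rewrite lt_min ab ltrDl.
  rewrite in_itv/= lt_min => /and3P[ar rb rd].
  have qr : q (pickle r) = ratr r.
    by rewrite /q pickleK clamp_id// (le_trans a0 (ltW ar)) (le_trans (ltW rb)).
  have r0 : 0 <= ratr r :> R := le_trans a0 (ltW ar).
  have rt : ratr r <= t := le_trans (ltW rb) bt.
  apply: le_trans (distance_triangle sh a0 (ltW ar) (ltW rb) bt) _; rewrite addrC; apply: lerD.
    have wrr : w (ratr r) (ratr r) <= 0.
      apply: le_trans (wasserstein_le_Rintegral sh r0 (lexx _) rt) _.
      by rewrite set_itv1 /Rintegral !integral_set1.
    have := (HG (pickle r)).2 (ratr r) b r0 (ltW rb) bt.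
    rewrite qr /F maxxx [Num.max _ b]max_r ?(ltW rb)// => wE'.
    apply: (@le_trans _ _ (\int[leb]_(x in `[ratr r, b]) G (pickle r) x)); first by rewrite -wE' lerDl oppr_ge0.
    apply: (@le_trans _ _ (\int[leb]_(x in `[ratr r, b]) f x)).
      apply: ae_le_Rintegral => //; last first.
        move: (Gk h (pickle r) sh); apply: (@filterS _ _ (@ae_lebesgue_filter R)) => s Gh.
        rewrite /= in_itv/= => /andP[rs sb]; apply: le_trans (uf (pickle r) s).
        rewrite le_min le_max lexx orbT andbT (le_trans _ (ler_norm _))// Gh//.
        by rewrite (le_trans r0 rs) (le_trans sb).
      - exact: if_.
      - by apply: integrableS (iG (pickle r)) => //; exact: sub_itv.
    rewrite (Rintegral_itv_split (if_ a b a0 bt) (ltW ar) (ltW rb)) lerDr.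
    exact: Rintegral_ge0.
  apply: le_trans (wasserstein_le_Rintegral sh a0 (ltW ar) rt) _.
  apply: le_trans (le_abs a0 rt) _.
  have := H [:: (a, ratr r)]; rewrite /itv_family /total_length !big_seq1/= a0 (ltW ar) rt/=.
  by apply => //; rewrite ltrBlDl.
(* Minimality: outside one null set, any other bound [k] is nonnegative and dominates every [G n],
   hence their truncated supremum. *)
move=> k sk; have := ae_foralln (fun n => Gk k n sk); have := speed_bound_ae_ge0 sk.
apply: (@filterS2 _ _ (@ae_lebesgue_filter R)) => s k0 Gks st.
rewrite -lee_fin -usE; apply: ge_ereal_sup => _ [n _ <-].
by rewrite lee_fin ge_min ge_max (k0 st) (Gks n st) orbT.
Qed.

Lemma metric_derivativeP : is_metric_derivative p t sigma (metric_derivative p t sigma).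
Proof. exact: xgetPex metric_derivative_exists. Qed.

End metric_derivative.

(** * Lower bound *)

Section signed_marginals.
Context d1 d2 (X : measurableType d1) (Y : measurableType d2) {R : realType}.
Local Open Scope ereal_scope.
Variables (G : probability (X * Y)%type R).

Lemma integral_marginal1 (P : probability X R) (h : X -> \bar R) :
  (forall A, measurable A -> G (A `*` setT) = P A) ->
  measurable_fun setT h -> \int[G]_z h z.1 = \int[P]_x h x.
Proof.
move=> GP mh; rewrite integralE [RHS]integralE.
rewrite -(ge0_integral_marginal1 GP (measurable_funepos mh))//.
rewrite -(ge0_integral_marginal1 GP (measurable_funeneg mh))//.
by rewrite (funepos_comp h fst) (funeneg_comp h fst).
Qed.

Lemma integral_marginal2 (P : probability Y R) (h : Y -> \bar R) :
  (forall A, measurable A -> G (setT `*` A) = P A) ->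
  measurable_fun setT h -> \int[G]_z h z.2 = \int[P]_x h x.
Proof.
move=> GP mh; rewrite integralE [RHS]integralE.
rewrite -(ge0_integral_marginal2 GP (measurable_funepos mh))//.
rewrite -(ge0_integral_marginal2 GP (measurable_funeneg mh))//.
by rewrite (funepos_comp h snd) (funeneg_comp h snd).
Qed.

Lemma integrable_marginal1 (P : probability X R) (h : X -> \bar R) :
  (forall A, measurable A -> G (A `*` setT) = P A) ->
  P.-integrable setT h -> G.-integrable setT (fun z => h z.1).
Proof.
move=> GP ih; have mh := measurable_int _ ih.
apply/integrableP; split; first exact: measurableT_comp mh measurable_fst.
have := integrableP _ _ _ ih => -[_]; apply: le_lt_trans.
have mha : measurable_fun setT (fun x => `|h x|) by exact: measurableT_comp mh.
by rewrite -(integral_marginal1 GP mha).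
Qed.

Lemma integrable_marginal2 (P : probability Y R) (h : Y -> \bar R) :
  (forall A, measurable A -> G (setT `*` A) = P A) ->
  P.-integrable setT h -> G.-integrable setT (fun z => h z.2).
Proof.
move=> GP ih; have mh := measurable_int _ ih.
apply/integrableP; split; first exact: measurableT_comp mh measurable_snd.
have := integrableP _ _ _ ih => -[_]; apply: le_lt_trans.
have mha : measurable_fun setT (fun x => `|h x|) by exact: measurableT_comp mh.
by rewrite -(integral_marginal2 GP mha).
Qed.

End signed_marginals.

(** * Moments and tails of measures *)

Section moments.
Context {R : realType} {d : nat} (p : R).
Local Notation prob := (probability (borelRd R d) R).
Implicit Types mu : prob.

Lemma measurable_enorm_powR : measurable_fun setT (fun x : borelRd R d => enorm (x : 'rV[R]_d) `^ p).
Proof. exact: measurableT_comp (measurable_powR _) measurable_enorm. Qed.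

Lemma Mp_integrable1 mu : Mp p mu -> mu.-integrable setT (fun x => (1 + enorm (x : 'rV[R]_d) `^ p)%:E).
Proof.
move=> Mmu; have i1 : mu.-integrable setT (fun=> (1 : R)%:E).
  exact: finite_measure_integrable_cst.
have i2 : mu.-integrable setT (fun x => (enorm (x : 'rV[R]_d) `^ p)%:E).
  apply/integrableP; split; first by apply/measurable_EFinP; exact: measurable_enorm_powR.
  by under eq_integral do rewrite gee0_abs ?lee_fin ?powR_ge0//.
have := @integrableD _ _ _ mu _ measurableT _ _ i1 i2.
by apply: eq_integrable.
Qed.

Lemma Mp_integrable mu (f : borelRd R d -> R) (C : R) : Mp p mu -> measurable_fun setT f ->
  (forall x, `|f x| <= C * (1 + enorm (x : 'rV[R]_d) `^ p)) -> mu.-integrable setT (EFin \o f).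
Proof.
move=> Mmu mf fC; have i1 : mu.-integrable setT (fun x => (`|C| * (1 + enorm (x : 'rV[R]_d) `^ p))%:E).
  have := @integrableZl _ _ _ mu _ measurableT `|C| _ (Mp_integrable1 Mmu).
  by apply: eq_integrable.
apply: le_integrable i1 => //; first exact/measurable_EFinP.
move=> x _ /=; rewrite lee_fin.
have x0 : 0 <= 1 + enorm (x : 'rV[R]_d) `^ p by rewrite addr_ge0// powR_ge0.
by rewrite [leRHS]ger0_norm ?mulr_ge0// (le_trans (fC x))// ler_wpM2r// ler_norm.
Qed.

Lemma tail_le rho (x : 'rV[R]_d) : tail p rho x <= 1 + enorm x `^ p.
Proof. by rewrite /tail; case: ifP => // _; rewrite addr_ge0// powR_ge0. Qed.

Lemma measurable_tail rho : measurable_fun setT (tail p rho : borelRd R d -> R).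
Proof.
have mb : measurable_fun setT (fun x : borelRd R d => enorm (x : 'rV[R]_d) <= rho).
  exact: measurable_fun_ler measurable_enorm (measurable_cst _).
apply: (measurable_fun_ifT mb) => //.
by apply: measurable_funD => //; exact: measurable_enorm_powR.
Qed.

Lemma tail_integrable mu rho : Mp p mu -> mu.-integrable setT (fun x => (tail p rho x)%:E).
Proof.
move=> Mmu; apply: (Mp_integrable (C := 1)) => //; first exact: measurable_tail.
by move=> x; rewrite ger0_norm ?tail_ge0// mul1r tail_le.
Qed.

Lemma tail_small mu e : Mp p mu -> 0 < e ->
  exists rho, \int[mu]_x tail p rho x <= e.
Proof.
move=> Mmu e0; pose f n (x : borelRd R d) := (tail p n%:R (x : 'rV[R]_d))%:E.
have mf n : measurable_fun setT (f n) by apply/measurable_EFinP; exact: measurable_tail.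
have f0 : {ae mu, forall x, setT x -> f ^~ x @ \oo --> (cst 0%E : borelRd R d -> \bar R) x}.
  apply: aeW => x _; apply: cvg_near_cst; near=> n.
  rewrite /f /tail ifT// ltW//; near: n; exact: nbhs_infty_gtr.
have fg : {ae mu, forall x n, setT x -> (`|f n x| <= (1 + enorm (x : 'rV[R]_d) `^ p)%:E)%E}.
  by apply: aeW => x n _; rewrite /f gee0_abs lee_fin ?tail_ge0// tail_le.
have [_ _] := @dominated_convergence _ _ _ mu _ measurableT _ _ _ mf (measurable_cst _) f0 (Mp_integrable1 Mmu) fg.
rewrite integral0 => /fine_cvgP[_] /cvgrPdist_le/(_ e e0)[n _ /(_ n (leqnn n))]/=.
by rewrite sub0r normrN => /(le_trans (ler_norm _)) h; exists n%:R.
Unshelve. all: by end_near. Qed.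

End moments.

Lemma Rintegral_lin d (T : measurableType d) {R : realType} (mu : {measure set T -> \bar R})
    (D : set T) (f g : T -> R) (a b : R) : measurable D ->
  mu.-integrable D (EFin \o f) -> mu.-integrable D (EFin \o g) ->
  mu.-integrable D (EFin \o (fun x => a * f x + b * g x)) /\
  \int[mu]_(x in D) (a * f x + b * g x) = a * \int[mu]_(x in D) f x + b * \int[mu]_(x in D) g x.
Proof.
move=> mD intf intg.
have ia : mu.-integrable D (EFin \o (fun x => a * f x)).
  by have := @integrableZl _ _ _ mu _ mD a _ intf; apply: eq_integrable.
have ib : mu.-integrable D (EFin \o (fun x => b * g x)).
  by have := @integrableZl _ _ _ mu _ mD b _ intg; apply: eq_integrable.
split; first by have := @integrableD _ _ _ mu _ mD _ _ ia ib; apply: eq_integrable.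
by rewrite RintegralD// !RintegralZl.
Qed.

Lemma measurable_fun_sublevel d (T : measurableType d) {R : realType} (f : T -> R) :
  (forall c, measurable [set x | f x < c]) -> measurable_fun setT f.
Proof.
move=> mf mD; apply: (measurability _ (RGenInftyO.measurableE R)) => //.
move=> /= _ [_ [c ->] <-]; rewrite setTI (_ : _ @^-1` _ = [set x | f x < c]).
  exact: mf.
by apply/seteqP; split => x /=; rewrite in_itv.
Qed.

Section sup_argument.
Context {R : realType}.

(* Continuous induction along [0, t]. *)
Lemma two_sided_slope (t e : R) (Phi : R -> R) : 0 <= t ->
  (forall z, 0 <= z <= t -> exists2 delta : R, 0 < delta & forall a b,
     0 <= a -> a < b -> b <= t -> b - a < delta -> z = a \/ z = b ->
     Phi b - Phi a <= e * (b - a)) ->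
  Phi t - Phi 0 <= e * t.
Proof.
move=> t0 H; pose S := [set s | 0 <= s <= t /\ Phi s - Phi 0 <= e * s].
have S0 : S 0 by rewrite /S/= lexx t0 subrr mulr0.
have hS : has_sup S by split; [exists 0|exists t => s [/andP[]]].
pose z := sup S.
have z0 : 0 <= z by apply: ub_le_sup => //; exact: hS.2.
have zt : z <= t by apply: ge_sup => [|s [/andP[]]]//; exists 0.
have zt' : 0 <= z <= t by rewrite z0.
have [delta delta0 Hz] := H z zt'.
(* The estimate on an interval ending at [z] puts [z] itself in [S]; the one on an interval starting
   at [z] then goes beyond it, unless [z = t]. *)
have Sz : S z.
  have [s Ss sz] := sup_adherent delta0 hS.
  have [/andP[s0 st] Phis] := Ss.
  have : s <= z by apply: ub_le_sup => //; exact: hS.2.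
  rewrite le_eqVlt => /predU1P[<-//|slz]; split => //.
  have := Hz s z s0 slz zt; rewrite -/z ltrBlDl -ltrBlDr sz => /(_ isT (or_intror erefl)).
  by move: Phis; lra.
move: zt; rewrite le_eqVlt => /predU1P[zE|zt]; first by rewrite -zE; exact: Sz.2.
pose b := Num.min t (z + delta / 2).
have zb : z < b by rewrite lt_min zt ltrDl divr_gt0.
have bt : b <= t by rewrite ge_min lexx.
have bz : b <= z + delta / 2 by rewrite ge_min lexx orbT.
have : S b.
  split; first by rewrite bt (le_trans z0 (ltW zb)).
  have := Hz z b z0 zb bt _ (or_introl erefl).
  have bd : b - z < delta by lra.
  by move=> /(_ bd); have := Sz.2; lra.
by move=> /(ub_le_sup hS.2) /(lt_le_trans zb); rewrite -/z ltxx.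
Qed.

End sup_argument.

(** * One step of the value along a coupling *)

Section lower_bound.
Context {R : realType} {d : nat} (p : R) (V g : 'rV[R]_d -> R) (K L T : R).
Local Notation leb := (@lebesgue_measure R).
Local Notation prob := (probability (borelRd R d) R).
Implicit Types (x : 'rV[R]_d).
Hypotheses (p1 : 1 < p) (cV : continuous V) (K0 : 0 < K) (L0 : 0 <= L) (T0 : 0 < T).
Hypothesis VK : forall x, `|V x| <= K * (1 + enorm x `^ p).
Hypothesis gL : forall x y, `|g x - g y| <= L * enorm (x - y).
Hypothesis KT : K * 2 `^ p * T `^ p <= (4 * p)^-1.
Let p0 : 0 < p. Proof. exact: lt_trans p1. Qed.
Local Notation u := (uval p V g).

Lemma measurable_uval t : 0 <= t <= T ->
  measurable_fun setT (fun x : borelRd R d => u (x : 'rV[R]_d) t).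
Proof.
move=> tT; apply: measurable_fun_sublevel => c; have H := uval_usc p1 cV K0 L0 T0 VK gL KT tT (c := c).
exact: (open_measurable_rV H).
Qed.

Lemma integrable_uval (mu : prob) t : Mp p mu -> 0 <= t <= T ->
  mu.-integrable setT (fun x => (u (x : 'rV[R]_d) t)%:E).
Proof.
move=> Mmu tT; have [C C0 HC] := value_fin p1 cV K0 L0 T0 VK gL KT.
apply: (Mp_integrable Mmu (measurable_uval tT)) => x.
exact: (HC x t tT).2.
Qed.

Lemma integrable_potential (mu : prob) : Mp p mu ->
  mu.-integrable setT (fun x => (V (x : 'rV[R]_d))%:E).
Proof.
move=> Mmu; apply: (Mp_integrable Mmu (C := K)) => //.
exact: continuous_measurable_rV.
Qed.

Lemma transport_cost_integrable pi (c : R) : (transport_cost p pi <= c%:E)%E ->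
  pi.-integrable setT (fun z => (enorm (z.1 - z.2 : 'rV[R]_d) `^ p)%:E).
Proof.
move=> picost; apply/integrableP; split.
  apply/measurable_EFinP; apply: measurableT_comp (measurable_powR _) _.
  exact: measurable_displacement.
under eq_integral do rewrite gee0_abs ?lee_fin ?powR_ge0//.
by apply: le_lt_trans picost _; rewrite ltry.
Qed.

Section step.
Variables (mu nu : prob) (pi : probability (borelRd R d * borelRd R d)%type R).
Hypotheses (Mmu : Mp p mu) (Mnu : Mp p nu) (cpi : coupling mu nu pi).
Variable c : R.
Hypothesis picost : (transport_cost p pi <= c%:E)%E.

Let icost := transport_cost_integrable picost.

Let seg_num (v v0 e kx ky ta : R) : kx <= ky -> - (v - v0) <= e + kx + ta ->
  v0 - (e + ky + ta) <= v.
Proof. by move=> *; lra. Qed.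

Let step_num (ua lp D l Ke k2 ta tau v e cc : R) :
  l * k2 * ta <= l * k2 * tau ->
  (p^-1 * lp + l * Ke) * D <= (p^-1 * lp + l * Ke) * cc ->
  ua + ((p^-1 * lp + l * Ke) * D + (l * k2 * ta + (- l * v + l * e))) <=
  ua + p^-1 * (lp * cc) - l * (v - e - Ke * cc - k2 * tau).
Proof. by move=> *; lra. Qed.

(* [nu0] is the marginal, first or second, at which the modulus of continuity is
   based. *)
Lemma coupling_step (base : bool) a b e Ke tau (rho : R) :
  let nu0 := if base then mu else nu in
  0 <= a -> a < b -> b <= T -> 0 < e -> 0 <= Ke ->
  (forall x z, `|V z - V x| <= e + Ke * enorm (z - x) `^ p + K * (2 `^ p + 2) * tail p rho x) ->
  \int[nu0]_x tail p rho x <= tau ->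
  \int[nu]_y u y b <= \int[mu]_x u x a + p^-1 * ((b - a) `^ (1 - p) * c)
    - (b - a) * (\int[nu0]_x V x - e - Ke * c - K * (2 `^ p + 2) * tau).
Proof.
move=> nu0 a0 ab bT e0 Ke0 HV Htau.
have aT : 0 <= a <= T by rewrite a0 (le_trans (ltW ab)).
have bT' : 0 <= b <= T by rewrite bT (le_trans a0 (ltW ab)).
have [c1 c2] := cpi.
pose l := b - a; have l0 : 0 < l by rewrite subr_gt0.
pose zb (z : borelRd R d * borelRd R d) : 'rV[R]_d := if base then z.1 else z.2.
have Mnu0 : Mp p nu0 by rewrite /nu0; case: (base).
have ibase (f : borelRd R d -> R) : nu0.-integrable setT (EFin \o f) ->
    pi.-integrable setT (EFin \o (fun z => f (zb z))) /\
    \int[pi]_z f (zb z) = \int[nu0]_x f x.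
  rewrite /nu0 /zb; case: (base) => iif.
    split; first by have := integrable_marginal1 c1 iif.
    by congr fine; apply: (integral_marginal1 c1 (measurable_int _ iif)).
  split; first by have := integrable_marginal2 c2 iif.
  by congr fine; apply: (integral_marginal2 c2 (measurable_int _ iif)).
have [iV EV] := ibase _ (integrable_potential Mnu0).
have [iT ET] := ibase _ (tail_integrable rho Mnu0).
have ib := integrable_marginal2 c2 (integrable_uval Mnu bT').
have ia := integrable_marginal1 c1 (integrable_uval Mmu aT).
have Eb : \int[nu]_y u y b = \int[pi]_z u z.2 b.
  by congr fine; rewrite (integral_marginal2 c2 (measurable_int _ (integrable_uval Mnu bT'))).
have Ea : \int[mu]_y u y a = \int[pi]_z u z.1 a.
  by congr fine; rewrite (integral_marginal1 c1 (measurable_int _ (integrable_uval Mmu aT))).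
pose D z := enorm (z.1 - z.2 : 'rV[R]_d) `^ p.
pose A := p^-1 * l `^ (1 - p) + l * Ke.
pose K2 := K * (2 `^ p + 2).
(* A point of the segment is within [|z.1 - z.2|] of either end, so the modulus at the base point
   bounds [V] from below on the whole segment. The nested form of the right-hand side is the one
   that [Rintegral_lin] integrates term by term. *)
have pt z : u z.2 b <= 1 * u z.1 a + 1 * (A * D z + 1 * (l * K2 * tail p rho (zb z) +
    1 * (- l * V (zb z) + l * e * 1))).
  have := @uval_step R d p V g K L T p1 cV K0 L0 T0 VK gL KT z.1 z.2 a l
    (V (zb z) - (e + Ke * D z + K2 * tail p rho (zb z))) a0 l0.
  rewrite /l subrKC => /(_ bT) H; apply: le_trans (H _) _.
    move=> la /andP[la0 la1]; have := HV (zb z) (z.1 + la *: (z.2 - z.1)).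
    have : enorm (z.1 + la *: (z.2 - z.1) - zb z) `^ p <= D z.
      apply: ge0_ler_powR; rewrite ?nnegrE ?enorm_ge0 ?(ltW p0)// /zb.
      case: (base); first by rewrite addrAC subrr add0r enormZ ger0_norm// (enormB z.1) ler_piMl// enorm_ge0.
      rewrite (_ : _ - z.2 = (1 - la) *: (z.1 - z.2)).
        by rewrite enormZ ger0_norm ?subr_ge0// ler_piMl ?enorm_ge0// lerBlDr lerDl.
      by rewrite scalerBl scale1r !scalerBr opprB; rewrite addrAC.
    by move=> /(ler_wpM2l Ke0) h1 /ler_normlP[h2 _]; exact: seg_num h1 h2.
  rewrite enormB -/(D z) -/l /A.
  by rewrite le_eqVlt; apply/orP; left; apply/eqP; ring.
have i1 : pi.-integrable setT (EFin \o (fun=> (1 : R))).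
  exact: finite_measure_integrable_cst.
have E1 : \int[pi]_z (1 : R) = 1.
  by rewrite /Rintegral integral_cst//= [X in (_ * X)%E]probability_setT mule1.
have [j1 J1] := Rintegral_lin (- l) (l * e) measurableT iV i1.
have [j2 J2] := Rintegral_lin (l * K2) 1 measurableT iT j1.
have [j3 J3] := Rintegral_lin A 1 measurableT icost j2.
have [j4 J4] := Rintegral_lin 1 1 measurableT ia j3.
rewrite Eb; apply: (le_trans (le_Rintegral measurableT ib j4 (fun z _ => pt z))).
rewrite J4 J3 J2 J1 E1 ET EV -Ea !mul1r mulr1 -/K2 -/l.
have cD : \int[pi]_z D z <= c.
  rewrite -lee_fin; apply: le_trans picost.
  by rewrite /Rintegral /transport_cost fineK//; exact: integrable_fin_num icost.
have A0 : 0 <= A by rewrite addr_ge0 ?mulr_ge0 ?powR_ge0 ?invr_ge0 ?(ltW p0) ?(ltW l0).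
have K20 : 0 <= l * K2 by rewrite mulr_ge0 ?(ltW l0)// mulr_ge0 ?(ltW K0)// addr_ge0// powR_ge0.
have := ler_wpM2l A0 cD; have := ler_wpM2l K20 Htau.
exact: step_num.
Qed.

End step.

End lower_bound.

(** * Slopes along a path of measures *)

Section lower_bound_path.
Context {R : realType} {d : nat} (p : R) (V g : 'rV[R]_d -> R) (K L T : R).
Local Notation leb := (@lebesgue_measure R).
Local Notation prob := (probability (borelRd R d) R).
Implicit Types (x : 'rV[R]_d).
Hypotheses (p1 : 1 < p) (cV : continuous V) (K0 : 0 < K) (L0 : 0 <= L) (T0 : 0 < T).
Hypothesis VK : forall x, `|V x| <= K * (1 + enorm x `^ p).
Hypothesis gL : forall x y, `|g x - g y| <= L * enorm (x - y).
Hypothesis KT : K * 2 `^ p * T `^ p <= (4 * p)^-1.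
Let p0 : 0 < p. Proof. exact: lt_trans p1. Qed.
Local Notation u := (uval p V g).
Local Notation K2 := (K * (2 `^ p + 2)).
Let K20 : 0 < K2. Proof. by rewrite mulr_gt0// ltr_wpDl ?powR_ge0. Qed.

Lemma coupling_potential (mu nu : prob) pi (c e Ke rho : R) : Mp p mu -> Mp p nu ->
  coupling mu nu pi -> (transport_cost p pi <= c%:E)%E -> 0 <= Ke ->
  (forall x z, `|V z - V x| <= e + Ke * enorm (z - x) `^ p + K2 * tail p rho x) ->
  `|\int[nu]_x V x - \int[mu]_x V x| <= e + Ke * c + K2 * \int[mu]_x tail p rho x.
Proof.
move=> Mmu Mnu [c1 c2] picost Ke0 HV.
pose D (z : borelRd R d * borelRd R d) := enorm (z.1 - z.2 : 'rV[R]_d) `^ p.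
have icost : pi.-integrable setT (EFin \o D).
  exact: (transport_cost_integrable picost).
have iVmu := integrable_potential cV VK Mmu.
have iVnu := integrable_potential cV VK Mnu.
have iT := tail_integrable rho Mmu.
have i1 := integrable_marginal1 c1 iVmu; have i2 := integrable_marginal2 c2 iVnu.
have i3 := integrable_marginal1 c1 iT.
have E1 : \int[mu]_x V x = \int[pi]_z V z.1.
  by congr fine; rewrite (integral_marginal1 c1 (measurable_int _ iVmu)).
have E2 : \int[nu]_x V x = \int[pi]_z V z.2.
  by congr fine; rewrite (integral_marginal2 c2 (measurable_int _ iVnu)).
have E3 : \int[mu]_x tail p rho x = \int[pi]_z tail p rho z.1.
  by congr fine; rewrite (integral_marginal1 c1 (measurable_int _ iT)).
have ic : pi.-integrable setT (EFin \o (fun=> (1 : R))) by exact: finite_measure_integrable_cst.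
have Ec : \int[pi]_z (1 : R) = 1.
  by rewrite /Rintegral integral_cst//= [X in (_ * X)%E]probability_setT mule1.
have [j1 J1] := Rintegral_lin K2 e measurableT i3 ic.
have [j2 J2] := Rintegral_lin Ke 1 measurableT icost j1.
rewrite E1 E2 E3 -RintegralB//.
have iB : pi.-integrable setT (EFin \o (fun z => V z.2 - V z.1)).
  by have := @integrableB _ _ _ pi _ measurableT _ _ i2 i1; apply: eq_integrable.
apply: le_trans (le_normr_Rintegral measurableT iB) _.
have iBa : pi.-integrable setT (EFin \o (fun z => `|V z.2 - V z.1|)).
  by have := integrable_abse iB; apply: eq_integrable.
apply: (@le_trans _ _ (\int[pi]_z (Ke * D z + 1 * (K2 * tail p rho z.1 + e * 1)))).
  apply: le_Rintegral => // z _; have := HV z.1 z.2; rewrite enormB -/(D z).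
  by rewrite mul1r mulr1 => /le_trans; apply; rewrite addrC addrCA addrC -!addrA addrC -!addrA lerD2l addrC.
rewrite J2 J1 Ec mul1r mulr1.
have cD : \int[pi]_z D z <= c.
  rewrite -lee_fin; apply: le_trans picost.
  by rewrite /Rintegral /transport_cost fineK//; exact: integrable_fin_num icost.
rewrite (addrC e) -addrA (addrC e); apply: lerD => //; exact: ler_wpM2l.
Qed.

Variables (sigma : R -> prob) (t : R) (h : R -> R).
Hypotheses (t0 : 0 <= t) (tT : t <= T) (Ms : forall s, 0 <= s <= t -> Mp p (sigma s)).
Hypothesis sh : speed_bound p t sigma h.

Local Notation hp := (fun s => `|h s| `^ p).

Let ihp a b : 0 <= a -> b <= t -> leb.-integrable `[a, b] (EFin \o hp).
Proof.
move=> a0 bt; apply: integrableS (Lp_integrable sh.1) => //; exact: sub_itv.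
Qed.

Let hp_ge0 a b : 0 <= \int[leb]_(s in `[a, b]) hp s.
Proof. by apply: Rintegral_ge0 => s _; exact: powR_ge0. Qed.

(** Jensen's inequality turns the bound of the distance by the integral of [h] into one by the
    integral of [|h|^p]; [eta] is the strict margin from which a coupling is extracted. *)
Lemma speed_coupling a b eta : 0 <= a -> a < b -> b <= t -> 0 < eta ->
  exists2 pi, coupling (sigma a) (sigma b) pi &
  (transport_cost p pi <= ((b - a) `^ (p - 1) * (\int[leb]_(s in `[a, b]) hp s + eta))%:E)%E.
Proof.
move=> a0 ab bt eta0; have ba0 : 0 < b - a by rewrite subr_gt0.
set I := \int[leb]_(s in `[a, b]) hp s.
have q0 : 0 < (b - a) `^ (p - 1) * (I + eta) by rewrite mulr_gt0 ?powR_gt0// ltr_wpDl// hp_ge0.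
set Q := _ * _ in q0 *.
have QE : (Q `^ p^-1) `^ p = Q by rewrite -powRrM mulVf ?gt_eqF// powRr1 ?(ltW q0).
suff W : (wasserstein p (sigma a) (sigma b) < (Q `^ p^-1)%:E)%E.
  by have [pi cpi] := wasserstein_approx p1 W; rewrite QE; exists pi.
rewrite (wasserstein_fin p1 sh a0 (ltW ab) bt) lte_fin.
apply: le_lt_trans (wasserstein_le_Rintegral p1 sh a0 (ltW ab) bt) _.
have iab := speed_bound_integrable p1 sh a0 bt.
have iaba : leb.-integrable `[a, b] (EFin \o (fun s => `|h s|)).
  by have := integrable_abse iab; apply: eq_integrable.
set J := \int[leb]_(s in `[a, b]) `|h s|.
apply: (@le_lt_trans _ _ J).
  by apply: le_Rintegral => // s _; exact: ler_norm.
have J0 : 0 <= J by exact: Rintegral_ge0.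
have mh : measurable_fun `[a, b] (fun s => `|h s|).
  by apply/measurable_EFinP; exact: measurable_int iaba.
have JE : (\int[leb]_(s in `[a, b]) (`|h s|)%:E)%E = J%:E.
  by rewrite /J /Rintegral fineK//; exact: integrable_fin_num iaba.
have := @weighted_jensen _ p p1 _ _ leb `[a, b] (fun s => `|h s|) (cst 1) (b - a)
  (measurable_itv _) mh (measurable_cst _) (fun _ _ => normr_ge0 _) (fun _ _ => ltr01) ba0.
rewrite integral_cst_itv ?(ltW ab)// mul1r JE => /(_ erefl).
under eq_integral do rewrite /= powR1 mul1r.
have -> : (\int[leb]_(s in `[a, b]) (hp s)%:E)%E = I%:E.
  by rewrite /I /Rintegral fineK//; exact: integrable_fin_num (ihp a0 bt).
rewrite poweR_EFin -EFinM lee_fin => JI.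
have Jp : J `^ p < Q by rewrite (le_lt_trans JI)// ltr_pM2l ?powR_gt0// ltrDl.
rewrite ltNge; apply/negP => QJ.
have : (Q `^ p^-1) `^ p <= J `^ p by apply: ge0_ler_powR; rewrite ?nnegrE ?powR_ge0 ?(ltW p0).
by rewrite QE leNgt Jp.
Qed.

(** The added [1] leaves room for the margin [eta <= 1] of [speed_coupling]. *)
Let M := \int[leb]_(s in `[0, t]) hp s + 1.

Let M0 : 0 < M. Proof. by rewrite ltr_wpDl. Qed.

Let hp_le a b : 0 <= a -> a <= b -> b <= t -> \int[leb]_(s in `[a, b]) hp s <= M - 1.
Proof.
move=> a0 ab bt; rewrite /M addrK.
have ih := ihp (lexx 0) (lexx t); have at_ := le_trans ab bt.
rewrite (Rintegral_itv_split ih a0 at_) (Rintegral_itv_split (ihp a0 (lexx t)) ab bt).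
by rewrite addrCA lerDl addr_ge0.
Qed.

Let small (k e : R) : 0 <= k -> 0 < e -> exists2 delta : R, 0 < delta &
  forall l, 0 < l -> l < delta -> k * (l `^ (p - 1) * M) <= e.
Proof.
move=> k0 e0; have kM0 : 0 < k * M + 1 by rewrite ltr_wpDl// mulr_ge0// ltW.
have q0 : 0 < e / (k * M + 1) by rewrite divr_gt0.
exists ((e / (k * M + 1)) `^ (p - 1)^-1); first exact: powR_gt0.
move=> l l0 ld; have : l `^ (p - 1) <= e / (k * M + 1).
  rewrite -[leRHS](powRr1 (ltW q0)) -[X in _ <= _ `^ X](@mulVf _ (p - 1)) ?gt_eqF ?subr_gt0//.
  by rewrite powRrM; apply: ge0_ler_powR; rewrite ?nnegrE ?powR_ge0 ?subr_ge0 ?(ltW p1) ?(ltW l0) ?(ltW ld).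
rewrite ler_pdivlMr// => le_e; apply: le_trans le_e.
by rewrite mulrCA ler_wpM2l ?powR_ge0// lerDl.
Qed.

Local Notation pot s := (\int[sigma s]_x V x).

(** The modulus of continuity is based at [sigma z], so the radius [rho] is chosen before [r]. For
    [r < z] the coupling is swapped to keep [sigma z] as its first marginal. *)
Lemma potential_near z e : 0 <= z <= t -> 0 < e -> exists2 delta : R, 0 < delta &
  forall r, 0 <= r <= t -> `|r - z| < delta -> `|pot r - pot z| <= e.
Proof.
move=> zt e0; have [rho Hrho] := @tail_small _ _ p (sigma z) (e / 3 / K2) (Ms zt) (divr_gt0 (divr_gt0 e0 (ltr0n _ 3)) K20).
have e30 : 0 < e / 3 by rewrite divr_gt0.
have [Ke Ke0 HV] := continuity_modulus p1 cV K0 VK rho e30.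
have [delta delta0 Hd] := small Ke0 e30.
exists delta => // r rt rz.
have tl : K2 * \int[sigma z]_x tail p rho x <= e / 3 by rewrite -ler_pdivlMl// mulrC.
have main (l : R) pi : 0 < l -> l < delta -> coupling (sigma z) (sigma r) pi ->
    (transport_cost p pi <= (l `^ (p - 1) * M)%:E)%E -> `|pot r - pot z| <= e.
  move=> l0 ld cpi cost.
  have := coupling_potential (Ms zt) (Ms rt) cpi cost Ke0 HV.
  by have := Hd l l0 ld; move=> h1 /le_trans; apply; move: h1 tl; lra.
have cM a b : 0 <= a -> a < b -> b <= t ->
    (b - a) `^ (p - 1) * (\int[leb]_(s in `[a, b]) hp s + 1) <= (b - a) `^ (p - 1) * M.
  by move=> a0 ab bt; rewrite ler_wpM2l ?powR_ge0// -lerBrDr hp_le// ltW.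
case/andP: zt => z0 zt; case/andP: rt => r0 rt.
have [zr|rz'|->] := ltgtP z r; last by rewrite subrr normr0 ltW.
  have [pi cpi cost] := speed_coupling z0 zr rt ltr01.
  apply: (main (r - z) pi) => //; first by rewrite subr_gt0.
    by rewrite (le_lt_trans (ler_norm _)).
  by apply: le_trans cost _; rewrite lee_fin cM.
have [pi /(swap_coupling p)[pi' cpi' E] cost] := speed_coupling r0 rz' zt ltr01.
apply: (main (z - r) pi') => //; first by rewrite subr_gt0.
  by rewrite (le_lt_trans (ler_norm _))// distrC.
by rewrite E; apply: le_trans cost _; rewrite lee_fin cM.
Qed.

Lemma potential_path_integrable a b : 0 <= a -> b <= t ->
  leb.-integrable `[a, b] (EFin \o (fun s => pot s)).
Proof.
move=> a0 bt; apply: (@integrableS _ _ _ leb `[0, t]) => //; first exact: sub_itv.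
have c : continuous (fun s => pot (clamp t s)).
  move=> z; apply/cvgrPdist_le => e e0.
  have [delta delta0 H] := potential_near (clamp_itv z t0) e0.
  near=> r; rewrite distrC; apply: H; first exact: clamp_itv.
  apply: (@le_lt_trans _ _ `|z - r|); last first.
    by near: r; apply/nbhs_ballP; exists delta.
  have [zr|rz] := leP z r.
    by rewrite distrC !ler0_norm ?subr_le0 ?le_clamp// !opprB; exact: clampB_le.
  by rewrite distrC !ger0_norm ?subr_ge0 ?le_clamp// ?(ltW rz)//; apply: clampB_le; exact: ltW.
have := @continuous_compact_integrable _ _ `[0, t] (@segment_compact _ 0 t) (continuous_subspaceT c).
apply: eq_integrable => // s; rewrite inE/= in_itv/= => st; by rewrite clamp_id.
Unshelve. all: by end_near. Qed.

(** Integrated value minus the action accumulated since time [0], with the initial cost left out.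
    The lower bound amounts to [Phi t <= Phi 0]. *)
Let Phi s : R := \int[sigma s]_x u x s - p^-1 * \int[leb]_(r in `[0, s]) hp r
  + \int[leb]_(r in `[0, s]) pot r.

Let PhiB a b : 0 <= a -> a < b -> b <= t -> Phi b - Phi a =
  \int[sigma b]_x u x b - \int[sigma a]_x u x a - p^-1 * \int[leb]_(r in `[a, b]) hp r
  + \int[leb]_(r in `[a, b]) pot r.
Proof.
move=> a0 ab bt; rewrite /Phi.
rewrite (Rintegral_itv_split (ihp (lexx 0) bt) a0 (ltW ab)).
rewrite (Rintegral_itv_split (potential_path_integrable (lexx 0) bt) a0 (ltW ab)).
by ring.
Qed.

Let slope_num (Fa Fb e l I eta P v lc Kc k2t : R) : 0 < e -> 0 < l -> 0 < p^-1 -> p^-1 <= 1 ->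
  lc = I + eta -> eta <= e / 6 * l -> Kc <= e / 6 -> k2t <= e / 6 ->
  Fb <= Fa + p^-1 * lc - l * (v - e / 6 - Kc - k2t) -> P <= l * (v + e / 6) ->
  0 < eta -> Fb - Fa - p^-1 * I + P <= e * l.
Proof.
move=> e0 l0 q0 q1 -> h1 h2 h3 h4 h5 h6.
have : p^-1 * eta <= eta by rewrite ler_piMl// ltW.
have : l * Kc <= l * (e / 6) by rewrite ler_pM2l.
have : l * k2t <= l * (e / 6) by rewrite ler_pM2l.
lra.
Qed.

(** As [z] is an end of the interval, the radius and the modulus attached to [sigma z] are chosen
    before the interval is. Five errors of at most [e / 6] per unit of time are made: the margin of
    the coupling, the modulus, the transport cost, the tail, and the variation of the mean of
    [V]. *)
Lemma local_slope z e : 0 <= z <= t -> 0 < e -> exists2 delta : R, 0 < delta & forall a b,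
  0 <= a -> a < b -> b <= t -> b - a < delta -> z = a \/ z = b -> Phi b - Phi a <= e * (b - a).
Proof.
move=> zt e0; have e60 : 0 < e / 6 by rewrite divr_gt0.
have [rho Hrho] := @tail_small _ _ p (sigma z) (e / 6 / K2) (Ms zt) (divr_gt0 e60 K20).
have [Ke Ke0 HV] := continuity_modulus p1 cV K0 VK rho e60.
have [d1 d10 Hd1] := small Ke0 e60.
have [d2 d20 Hd2] := potential_near zt e60.
exists (Num.min d1 d2) => [|a b a0 ab bt]; first by rewrite lt_min d10.
rewrite lt_min => /andP[l1 l2] zab.
have l0 : 0 < b - a by rewrite subr_gt0.
pose eta := Num.min 1 (e / 6 * (b - a)).
have eta0 : 0 < eta by rewrite lt_min ltr01 mulr_gt0.
have [pi cpi cost] := speed_coupling a0 ab bt eta0.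
rewrite PhiB//; set I := \int[leb]_(s in `[a, b]) hp s in cost *.
have at_ : 0 <= a <= t by rewrite a0 (le_trans (ltW ab)).
have bt' : 0 <= b <= t by rewrite bt (le_trans a0 (ltW ab)).
pose base := z == a.
have zE : (if base then sigma a else sigma b) = sigma z.
  by rewrite /base; case: eqP zab => [->//|za [//|->//]].
have := @coupling_step R d p V g K L T p1 cV K0 L0 T0 VK gL KT _ _ pi (Ms at_) (Ms bt') cpi _ cost
  base a b (e / 6) Ke (e / 6 / K2) rho.
rewrite /= zE => /(_ a0 ab (le_trans bt tT) e60 Ke0 HV Hrho) step.
apply: (slope_num (eta := eta) (I := I) e0 l0 _ _ _ _ _ _ step) => //.
- by rewrite invr_gt0.
- by rewrite invf_le1 // ltW.
- rewrite mulrA -powRD ?(gt_eqF l0) ?implybT//.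
  by rewrite (_ : 1 - p + (p - 1) = 0) ?powRr0 ?mul1r//; ring.
- by rewrite /eta ge_min lexx orbT.
- apply: le_trans (Hd1 _ l0 l1); rewrite ler_wpM2l// ler_wpM2l ?powR_ge0//.
  have := hp_le a0 (ltW ab) bt; rewrite -/I => I1.
  have : eta <= 1 by rewrite /eta ge_min lexx.
  by rewrite -[M](subrK 1) => e1; apply: lerD.
- by rewrite mulrC divfK// gt_eqF.
- have -> : (b - a) * (pot z + e / 6) = \int[leb]_(r in `[a, b]) (pot z + e / 6).
    by rewrite /Rintegral integral_cst_itv ?(ltW ab)//= mulrC.
  apply: le_Rintegral => //; first exact: potential_path_integrable.
    apply: continuous_compact_integrable; first exact: segment_compact.
    by apply: continuous_subspaceT; exact: cst_continuous.
  move=> r /=; rewrite in_itv/= => /andP[ar rb].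
  have rt : 0 <= r <= t by rewrite (le_trans a0 ar) (le_trans rb bt).
  have rz : `|r - z| < d2.
    case: zab => ->; first by rewrite ger0_norm ?subr_ge0//; lra.
    by rewrite ler0_norm ?subr_le0//; lra.
  by have /ler_normlP[_ h2] := Hd2 r rt rz; rewrite -lerBlDl.
Qed.

Let end_num (q1 q2 q3 q4 : R) : q1 - q2 + q3 - q4 <= 0 -> q1 <= q4 + q2 - q3.
Proof. by move=> *; lra. Qed.

Lemma value_le_path : \int[sigma t]_x u x t <= \int[sigma 0]_x u x 0
  + p^-1 * \int[leb]_(r in `[0, t]) hp r - \int[leb]_(r in `[0, t]) pot r.
Proof.
suff : Phi t - Phi 0 <= 0.
  rewrite /Phi set_itv1 [\int[leb]_(r in [set 0]) hp r]/Rintegral integral_set1.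
  rewrite [\int[leb]_(r in [set 0]) pot r]/Rintegral integral_set1/= mulr0 subr0 addr0.
  exact: end_num.
apply/ler_addgt0Pr => e e0; rewrite add0r.
have e1 : 0 < e / (t + 1) by rewrite divr_gt0// ltr_wpDl.
apply: (le_trans (two_sided_slope t0 (fun z zt => local_slope zt e1))).
by rewrite mulrAC ler_pdivrMr ?ltr_wpDl// ler_wpM2l ?(ltW e0)// lerDl.
Qed.

End lower_bound_path.

(** * The action of a path of measures *)

Section action_on_measures.
Context {R : realType} {d : nat} (p : R) (V g : 'rV[R]_d -> R) (K L T : R).
Local Notation leb := (@lebesgue_measure R).
Local Notation prob := (probability (borelRd R d) R).
Implicit Types (x : 'rV[R]_d).
Hypotheses (p1 : 1 < p) (cV : continuous V) (K0 : 0 < K) (L0 : 0 <= L) (T0 : 0 < T).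
Hypothesis VK : forall x, `|V x| <= K * (1 + enorm x `^ p).
Hypothesis gL : forall x y, `|g x - g y| <= L * enorm (x - y).
Hypothesis KT : K * 2 `^ p * T `^ p <= (4 * p)^-1.
Hypothesis cg : continuous g.
Let p0 : 0 < p. Proof. exact: lt_trans p1. Qed.

Lemma integrable_initial (mu : prob) : Mp p mu -> mu.-integrable setT (fun x => (g (x : 'rV[R]_d))%:E).
Proof.
move=> Mmu; apply: (Mp_integrable Mmu (C := `|g 0| + L)).
  exact: continuous_measurable_rV.
move=> x; rewrite -[g x](subrKC (g 0)) (le_trans (ler_normD _ _))// mulrDl; apply: lerD.
  by rewrite ler_peMr// lerDl powR_ge0.
by rewrite (le_trans (gL _ _))// subr0 ler_wpM2l//; exact: enorm_le_powR.
Qed.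

Lemma potentialE (f : 'rV[R]_d -> R) (mu : prob) : mu.-integrable setT (fun x => (f x)%:E) ->
  potential f mu = (\int[mu]_x f x)%:E.
Proof. by move=> iF; rewrite /potential /Rintegral fineK//; exact: integrable_fin_num iF. Qed.

Variables (sigma : R -> prob) (t : R).
Hypotheses (t0 : 0 <= t) (tT : t <= T) (acs : ACp_Mp p t sigma).
Local Notation md := (metric_derivative p t sigma).

Lemma speed_bound_metric_derivative : speed_bound p t sigma md.
Proof. by case: acs => _ [h sh]; have [] := metric_derivativeP p1 t0 sh. Qed.

(** A speed bound is nonnegative almost everywhere, so the absolute value, which matches [Lp_on],
    does not change the integral. *)
Lemma speed_actionE (h : R -> R) : speed_bound p t sigma h ->
  (potential g (sigma 0) + \int[leb]_(s in `[0%R, t])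
     ((p^-1 * h s `^ p)%:E - potential V (sigma s)))%E =
  (\int[sigma 0]_x g x + p^-1 * \int[leb]_(r in `[0, t]) (`|h r| `^ p)
    - \int[leb]_(r in `[0, t]) (\int[sigma r]_x V x))%:E.
Proof.
move=> sh; have Ms := acs.1.
have iV := potential_path_integrable p1 cV K0 VK t0 Ms sh (lexx 0) (lexx t).
have ih : leb.-integrable `[0, t] (EFin \o (fun s => `|h s| `^ p)) by exact: Lp_integrable sh.1.
have [ilin E] := @Rintegral_lin _ _ _ leb _ _ _ p^-1 (-1) (measurable_itv `[0, t]) ih iV.
rewrite potentialE; last by apply: integrable_initial; apply: Ms; rewrite lexx.
rewrite -addrA EFinD; congr (_ + _)%E.
rewrite -(mulN1r (\int[leb]_(r in _) _)) -E /Rintegral fineK; last by exact: integrable_fin_num ilin.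
have mf : measurable_fun `[0, t] (fun s => (p^-1 * h s `^ p)%:E - potential V (sigma s))%E.
  apply: emeasurable_funB.
    apply/measurable_EFinP; apply: measurable_funM => //.
    apply: measurableT_comp (measurable_powR _) _; exact: sh.1.1.
  apply: eq_measurable_fun (measurable_int _ iV) => s; rewrite inE/= in_itv/= => st.
  by rewrite potentialE//; exact: (integrable_potential cV VK (Ms _ st)).
apply: ae_eq_integral => //; first exact: measurable_int ilin.
have := speed_bound_ae_ge0 p1 sh; apply: (@filterS _ _ (@ae_lebesgue_filter R)) => s h0.
rewrite /= in_itv/= => st; rewrite ger0_norm ?h0//.
rewrite potentialE; last by exact: (integrable_potential cV VK (Ms _ st)).
by rewrite mulN1r EFinD EFinN.
Qed.

Lemma action_MpE : action_Mp p g V t sigma =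
  (\int[sigma 0]_x g x + p^-1 * \int[leb]_(r in `[0, t]) (`|md r| `^ p)
    - \int[leb]_(r in `[0, t]) (\int[sigma r]_x V x))%:E.
Proof. exact: speed_actionE speed_bound_metric_derivative. Qed.

Lemma action_Mp_ge : ((\int[sigma t]_x uval p V g x t)%:E <= action_Mp p g V t sigma)%E.
Proof.
rewrite action_MpE lee_fin.
apply: le_trans (value_le_path p1 cV K0 L0 T0 VK gL KT t0 tT acs.1 speed_bound_metric_derivative) _.
rewrite lerD2r lerD2r; have M0 : Mp p (sigma 0) by apply: acs.1; rewrite lexx.
have zT : 0 <= (0 : R) <= T by rewrite lexx ltW.
apply: le_Rintegral => //.
- exact: (integrable_uval p1 cV K0 L0 T0 VK gL KT M0 zT).
- exact: integrable_initial.
(* The constant path gives [u(x, 0) <= g(x)]. *)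
move=> x _; have [ac e0] := @ACp_cst _ _ _ p1 0 x (lexx _).
apply: le_trans (uval_le p1 cV K0 L0 T0 VK gL KT zT ac erefl) _.
have E : energy p 0 (fun=> x) = 0 by apply/le_anti; rewrite e0 energy_ge0.
rewrite /real_action E mulr0 addr0 /potential_cost set_itv1 /Rintegral integral_set1/= subr0//.
Qed.

End action_on_measures.

Lemma measurable_fun_le d (T : measurableType d) {R : realType} (f : T -> R) :
  (forall c, measurable [set x | f x <= c]) -> measurable_fun setT f.
Proof.
move=> mf mD; apply: (measurability _ (RGenOInfty.measurableE R)) => //.
move=> /= _ [_ [c ->] <-]; rewrite setTI (_ : _ @^-1` _ = ~` [set x | f x <= c]).
  by apply: measurableC; exact: mf.
apply/seteqP; split => x /=; rewrite in_itv/= andbT ltNge; first by move/negP.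
by move/negP.
Qed.

Lemma nested_compact (Z : topologicalType) (C : set Z) (A : nat -> set Z) :
  compact C -> (forall n, closed (A n)) -> (forall n, A n `<=` C) ->
  (forall n, A n !=set0) -> (forall n m, (n <= m)%N -> A m `<=` A n) ->
  exists z, forall n, A n z.
Proof.
move=> cC clA AC A0 ndA; pose F : set_system Z := [set B | exists n, A n `<=` B].
have FF : ProperFilter F.
  split; first by move=> [n]; have [z Az] := A0 n => /(_ _ Az).
  split; first by exists 0%N.
  - move=> P Q [n nP] [m mQ]; exists (maxn n m) => z Az; split.
      by apply/nP/(ndA _ _ (leq_maxl n m)).
    by apply/mQ/(ndA _ _ (leq_maxr n m)).
  - by move=> P Q PQ [n nP]; exists n; exact: subset_trans PQ.
have [|z [_ clz]] := cC F FF; first by exists 0%N.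
by exists z => n; apply: clA => B zB; apply: clz => //; exists n.
Qed.

(** * Measurable selection of minimizers *)

(* Among the minimizers of [F 0], minimize [F 1], then [F 2], and so on: a
   point that survives all the steps is determined by its values [F j], and
   these are Borel functions of the parameter. *)
Section lexicographic_selection.
Context {R : realType} {d : nat} (Z : topologicalType) (D : set Z) (z0 : Z).
Variable F : nat -> 'rV[R]_d -> Z -> R.
Hypothesis D0 : D !=set0.
Hypothesis F0_lb : forall x, exists m, forall z, D z -> m <= F 0 x z.
Hypothesis F0_compact : forall x c, compact [set z | D z /\ F 0 x z <= c].
Hypothesis F0_closed : forall x c, closed [set z | D z /\ F 0 x z <= c].
Hypothesis F_continuous : forall j x, continuous (F j.+1 x).
Hypothesis F_usc : forall j z c, D z -> open [set x | F j x z < c].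

Fixpoint lexmin (k : nat) x : set Z := if k is k'.+1 then
  [set z | lexmin k' x z /\ forall z', lexmin k' x z' -> F k' x z <= F k' x z'] else D.

Definition lexval k x : R := F k x (xget z0 (lexmin k.+1 x)).

Lemma lexmin_sub k x : lexmin k x `<=` D.
Proof. by elim: k => [|k IH] //= z [/IH]. Qed.

Lemma lexmin_mono n m x : (n <= m)%N -> lexmin m x `<=` lexmin n x.
Proof.
move=> nm; rewrite -(subnK nm); elim: (m - n)%N => [|k IH] //=.
by move=> z [Mz _]; exact: IH.
Qed.

Let infinitesimal (a b : R) : (forall n, a <= b + n.+1%:R^-1) -> a <= b.
Proof.
move=> H; apply/ler_addgt0Pr => e e0.
have [n ne] : exists n, n.+1%:R^-1 < e.
  exists (Num.truncn e^-1); rewrite invf_plt ?posrE//.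
  by have /andP[] := truncn_itv (ltW (eqbRL (invr_gt0 _) e0)).
by rewrite (le_trans (H n))// lerD2l ltW.
Qed.

(** The first minimization rests on the compactness of the sublevels of [F 0]: those at levels
    decreasing to the infimum are nested and nonempty. The later functions are continuous and
    minimized over a compact set. *)
Lemma lexmin1 x : exists2 m, lexmin 1 x = [set z | D z /\ F 0 x z <= m] & lexmin 1 x !=set0.
Proof.
have [lb Hlb] := F0_lb x; pose S := [set F 0 x z | z in D]; pose m := inf S.
have hS : has_inf S.
  by split; [have [z Dz] := D0; exists (F 0 x z), z|exists lb => _ [z Dz <-]; exact: Hlb].
have mle z : D z -> m <= F 0 x z by move=> Dz; apply: ge_inf; [exact: hS.2|exists z].
pose A n := [set z | D z /\ F 0 x z <= m + n.+1%:R^-1].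
have [||||z Az] := @nested_compact Z (A 0%N) A (@F0_compact x _).
- by move=> n; exact: F0_closed.
- move=> n z [Dz Fz]; split => //; rewrite (le_trans Fz)// lerD2l lef_pV2 ?posrE//.
  by rewrite ler_nat.
- move=> n; have [|_ [z Dz <-] zm] := @inf_adherent _ S n.+1%:R^-1 _ hS; first by rewrite invr_gt0.
  by exists z; split => //; exact: ltW.
- move=> i j ij z [Dz Fz]; split => //; rewrite (le_trans Fz)// lerD2l lef_pV2 ?posrE//.
  by rewrite ler_nat.
have zm : F 0 x z <= m by apply: infinitesimal => n; have [] := Az n.
have Dz : D z by have [] := Az 0%N.
exists m; last by exists z; split => // z' Dz'; rewrite (le_trans zm)// mle.
apply/seteqP; split => y /= [Dy Hy]; split => //; first exact: le_trans (Hy _ Dz) zm.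
by move=> z' Dz'; rewrite (le_trans Hy)// mle.
Qed.

Lemma lexmin_closed k x : closed (lexmin k.+1 x) /\ lexmin k.+1 x !=set0.
Proof.
have [m E M0] := lexmin1 x; elim: k => [|k [clk nek]].
  by split => //; rewrite E; exact: F0_closed.
have ck : compact (lexmin k.+1 x).
  have sub : lexmin k.+1 x `<=` [set z | D z /\ F 0 x z <= m] by rewrite -E; exact: lexmin_mono.
  exact: (subclosed_compact clk (@F0_compact x m) sub).
have [z zM zmin] := @compact_EVT_min _ _ (F k.+1 x) _ nek ck (continuous_subspaceT (@F_continuous k x)).
have zM' : lexmin k.+1 x z by rewrite inE in zM.
have zmin' y : lexmin k.+1 x y -> F k.+1 x z <= F k.+1 x y by move=> My; apply: zmin; rewrite inE.
split; last by exists z; split.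
rewrite (_ : lexmin k.+2 x = lexmin k.+1 x `&` (F k.+1 x @^-1` [set r | r <= F k.+1 x z])).
  apply: closedI => //; apply: closed_comp; last exact: closed_le.
  by move=> y _; exact: F_continuous.
apply/seteqP; split => y /= [My Hy]; split => //; first exact: Hy.
by move=> y' My'; rewrite (le_trans Hy)// zmin'.
Qed.

Lemma lexvalE k x z : lexmin k.+1 x z -> F k x z = lexval k x.
Proof.
move=> Mz; have := xgetPex z0 (ex_intro _ z Mz); rewrite /lexval.
move: (xget _ _) => y [My Hy]; have [Mz' Hz] := Mz.
by apply/le_anti; rewrite Hz// Hy.
Qed.

Lemma lexminP k x z : D z -> (forall j, (j < k)%N -> F j x z <= lexval j x) -> lexmin k x z.
Proof.
move=> Dz; elim: k => [|k IH] Hz //.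
have Mk : lexmin k x z by apply: IH => j jk; apply: Hz; exact: ltnW.
split => // z' Mz'; rewrite (le_trans (Hz k _))//.
have [_ [y My]] := lexmin_closed k x; rewrite -(lexvalE My).
by have [_] := My; apply.
Qed.

(** Strict inequalities leave room for rational thresholds. At fixed thresholds, upper
    semicontinuity in [x] makes the condition open for each [z], and a union of open sets over
    uncountably many [z] is still open. *)
Lemma measurable_exists_lt k (w : nat -> borelRd R d -> R) :
  (forall j, (j <= k)%N -> measurable_fun setT (w j)) ->
  measurable ([set x | exists z, D z /\ forall j, (j <= k)%N -> F j x z < w j x] : set (borelRd R d)).
Proof.
move=> mw; pose A (r : {ffun 'I_k.+1 -> rat}) : set (borelRd R d) :=
  (\bigcap_(j : 'I_k.+1) [set x | ratr (r j) < w j x]) `&`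
  [set x | exists z, D z /\ forall j : 'I_k.+1, F j x z < ratr (r j)].
rewrite (_ : [set x | _] = \bigcup_r A r).
  apply: countable_bigcupT_measurable => [|r]; first exact: countableP.
  apply: measurableI.
    apply: countable_bigcapT_measurable => j; rewrite -[X in measurable X]setTI.
    have mj := mw j (ltn_ord j).
    rewrite (_ : [set x | _] = w j @^-1` `]ratr (r j), +oo[); first exact: mj.
    by apply/seteqP; split => x /=; rewrite in_itv/= andbT.
  apply: open_measurable_rV.
  rewrite (_ : [set x | _] = \bigcup_(z in D) \bigcap_(j : 'I_k.+1) [set x | F j x z < ratr (r j)]).
    apply: bigcup_open => z Dz.
    rewrite (_ : \bigcap_j _ = \big[setI/setT]_(j <- enum 'I_k.+1) [set x | F j x z < ratr (r j)]).
      elim/big_rec: _ => [|j B _ oB]; first exact: openT.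
      by apply: openI => //; exact: F_usc.
    rewrite -bigcap_seq; apply/seteqP; split => x Hx j _; apply: Hx => //=.
    by rewrite mem_enum.
  apply/seteqP; split => x /=.
    by move=> [z [Dz Hz]]; exists z => // j _; exact: Hz.
  by move=> [z Dz Hz]; exists z; split => // j; exact: Hz.
apply/seteqP; split => x /=.
  move=> [z [Dz Hz]].
  have /choice[r Hr] (j : 'I_k.+1) : exists r : rat, F j x z < ratr r < w j x.
    have [r] := rat_in_itvoo (Hz j (ltn_ord j)).
    by rewrite in_itv/=; exists r.
  exists [ffun j => r j] => //; split; first by move=> j _ /=; rewrite ffunE; have /andP[] := Hr j.
  by exists z; split => // j; rewrite ffunE; have /andP[] := Hr j.
move=> [r _ [Hr [z [Dz Hz]]]]; exists z; split => // j jk.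
have jk' : (j < k.+1)%N by [].
exact: lt_trans (Hz (Ordinal jk')) (Hr (Ordinal jk') _).
Qed.

(** By strong induction: [lexval k x <= c] holds exactly when, for every [n], some [z] has
    [F k x z < c + 1 / (n + 1)] and exceeds each earlier minimal value by less than [1 / (n + 1)].
    Compactness turns these approximate points into one that attains the earlier values. *)
Lemma measurable_lexval k : measurable_fun setT (lexval k : borelRd R d -> R).
Proof.
elim/ltn_ind: k => k IH; apply: measurable_fun_le => c.
pose w n j (x : borelRd R d) := (if (j < k)%N then lexval j x else c) + n.+1%:R^-1.
rewrite (_ : [set x | _] = \bigcap_n [set x | exists z, D z /\ forall j, (j <= k)%N -> F j x z < w n j x]).
  apply: bigcap_measurable => // n _; apply: measurable_exists_lt => j jk.
  by have := IH j; rewrite /w; case: (j < k)%N => [/(_ isT) ?|_]; exact: measurable_funD.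
apply/seteqP; split => x /=.
  move=> vc n _; have [_ [z Mz]] := lexmin_closed k x.
  exists z; split; first exact: lexmin_sub Mz.
  move=> j; rewrite leq_eqVlt /w => /predU1P[->|jk].
    by rewrite ltnn (lexvalE Mz) ltr_pwDr.
  rewrite jk -(@lexvalE j x z) ?ltrDl ?invr_gt0//.
  by apply: (@lexmin_mono j.+1 k.+1) Mz; exact: ltnW.
(* [F 0] is kept apart: its sublevels are compact by assumption, while those of the later functions
   are closed by continuity. *)
move=> Hx; pose A n := [set z | (D z /\ F 0 x z <= w n 0%N x) /\
  forall j, (0 < j <= k)%N -> F j x z <= w n j x].
have wn n m j y : (n <= m)%N -> w m j y <= w n j y.
  by move=> nm; rewrite lerD2l lef_pV2 ?posrE// ler_nat.
have [||||z Az] := @nested_compact Z [set z | D z /\ F 0 x z <= w 0%N 0%N x] A (@F0_compact x _).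
- move=> n; rewrite (_ : A n = [set z | D z /\ F 0 x z <= w n 0%N x] `&`
      \bigcap_(j in [set j | (0 < j <= k)%N]) (F j x @^-1` [set r | r <= w n j x])).
    apply: closedI; first exact: F0_closed.
    apply: closed_bigI => -[|j] // _; apply: closed_comp; last exact: closed_le.
    by move=> y _; exact: F_continuous.
  by apply/seteqP; split => y /= [].
- by move=> n z [[Dz Fz] _]; split => //; rewrite (le_trans Fz)// wn.
- move=> n; have [z [Dz Hz]] := Hx n Logic.I; exists z.
  by split=> [|j /andP[_ jk]]; [split => //|]; rewrite ltW// Hz.
- move=> n m nm z [[Dz Fz] Hz]; split; first by split => //; rewrite (le_trans Fz)// wn.
  by move=> j jk; rewrite (le_trans (Hz _ jk))// wn.
have Dz : D z by have [[]] := Az 0%N.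
have Hz j : (j <= k)%N -> F j x z <= if (j < k)%N then lexval j x else c.
  move=> jk; apply: infinitesimal => n; have [[_ h0] h1] := Az n.
  by case: j jk => [|j] jk; [exact: h0|exact: h1].
have Mz : lexmin k x z.
  by apply: lexminP => // j jk; have := Hz j (ltnW jk); rewrite jk.
have [_ [y My]] := lexmin_closed k x; rewrite -(lexvalE My).
have := Hz k (leqnn k); rewrite ltnn; apply: le_trans.
by have [_] := My; apply.
Qed.

(** The nested compact sets of successive minimizers have a common point, at which each [F j] takes
    the measurable value [lexval j]. *)
Lemma lexicographic_selection : exists v : nat -> borelRd R d -> R,
  (forall j, measurable_fun setT (v j)) /\
  forall x, exists2 z, D z & (forall z', D z' -> F 0 x z <= F 0 x z') /\ forall j, F j x z = v j x.
Proof.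
exists (fun j x => lexval j x); split; first exact: measurable_lexval.
move=> x; have [m E _] := lexmin1 x.
have [|||||z Az] := @nested_compact Z (lexmin 1 x) (fun n => lexmin n.+1 x).
- by rewrite E; exact: F0_compact.
- by move=> n; have [] := lexmin_closed n x.
- by move=> n; exact: lexmin_mono.
- by move=> n; have [] := lexmin_closed n x.
- by move=> n j nj; exact: lexmin_mono.
exists z; first by have [] := Az 0%N.
split; first by have [_] := Az 0%N.
by move=> j; exact: lexvalE.
Qed.

End lexicographic_selection.

(** * Compactness of the sublevels of the action *)

Section family_energy_cons.
Context {R : realType} {d : nat} (p : R).
Implicit Types (gamma : R -> 'rV[R]_d).

Lemma family_energy_nil gamma : family_energy p gamma [::] = 0.
Proof. by rewrite /family_energy big_nil. Qed.

Lemma family_energy_cons gamma J s :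
  family_energy p gamma (J :: s) = itv_energy p gamma J + family_energy p gamma s.
Proof. by rewrite /family_energy big_cons. Qed.

Lemma family_energy_cons_le gamma gamma' J s e :
  family_energy p gamma s <= family_energy p gamma' s + e / 2 ->
  itv_energy p gamma J <= itv_energy p gamma' J + e / 2 ->
  family_energy p gamma (J :: s) <= family_energy p gamma' (J :: s) + e.
Proof.
rewrite !family_energy_cons => h1 h2; apply: le_trans (lerD h2 h1) _.
by rewrite addrACA -splitr.
Qed.

Lemma itv_energy_le_close gamma gamma' a b e : 0 < e ->
  `|enorm (gamma' b - gamma' a) `^ p - enorm (gamma b - gamma a) `^ p| <=
    e / ((b - a) `^ (1 - p) + 1) ->
  itv_energy p gamma (a, b) <= itv_energy p gamma' (a, b) + e.
Proof.
move=> e0 /ler_normlP[h _]; rewrite /itv_energy/= -lerBlDl -mulrBr.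
set k := (b - a) `^ (1 - p) in h *; have k0 : 0 <= k := powR_ge0 _ _.
apply: (@le_trans _ _ (k * (e / (k + 1)))).
  by rewrite ler_wpM2l// -[leLHS]opprB.
by rewrite mulrCA ler_piMr ?(ltW e0)// ler_pdivrMr ?ltr_wpDl// mul1r lerDl.
Qed.

Lemma increment_close gamma gamma' a b e :
  enorm (gamma' a - gamma a) < e / 2 -> enorm (gamma' b - gamma b) < e / 2 ->
  `|enorm (gamma' b - gamma' a) - enorm (gamma b - gamma a)| < e.
Proof.
move=> h1 h2; apply: le_lt_trans (enorm_lip _ _) _.
rewrite (_ : _ - _ - _ = (gamma' b - gamma b) - (gamma' a - gamma a)).
  by rewrite (le_lt_trans (enormD _ _))// enormN [ltRHS]splitr ltrD.
by rewrite !opprB [LHS]addrACA [RHS]addrACA [- gamma' a - _]addrC.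
Qed.

End family_energy_cons.

Section path_compactness.
Import ArrowAsProduct.
Context {R : realType} {d : nat} (p : R) (V g : 'rV[R]_d -> R) (K L T : R).
Local Notation leb := (@lebesgue_measure R).
Implicit Types (x : 'rV[R]_d) (zeta eta : R -> 'rV[R]_d).
Hypotheses (p1 : 1 < p) (cV : continuous V) (K0 : 0 < K) (L0 : 0 <= L) (T0 : 0 < T).
Hypothesis VK : forall x, `|V x| <= K * (1 + enorm x `^ p).
Hypothesis gL : forall x y, `|g x - g y| <= L * enorm (x - y).
Hypothesis KT : K * 2 `^ p * T `^ p <= (4 * p)^-1.
Let p0 : 0 < p. Proof. exact: lt_trans p1. Qed.

(** A local Lipschitz bound from the tangent inequality, used with both orders of the two points; it
    includes [a = 0]. *)
Lemma powR_close (a e : R) : 0 <= a -> 0 < e -> exists2 delta : R, 0 < delta &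
  forall y, 0 <= y -> `|y - a| < delta -> `|y `^ p - a `^ p| <= e.
Proof.
move=> a0 e0; have q0 : 0 < p * (a + 1) `^ (p - 1) by rewrite mulr_gt0// powR_gt0// ltr_wpDl.
exists (Num.min 1 (e / (p * (a + 1) `^ (p - 1)))); first by rewrite lt_min ltr01 divr_gt0.
move=> y y0; rewrite lt_min => /andP[y1 ye].
have ya : y <= a + 1 by move: y1; rewrite ltr_norml => /andP[_]; rewrite ltrBlDl => /ltW.
have key (m z : R) : 0 <= m -> 0 <= z -> m <= a + 1 -> z <= a + 1 -> `|m - z| = `|y - a| ->
    m `^ p - z `^ p <= e.
  move=> m0 z0 ma za E; have := powR_tangent p1 z0 m0 => tan.
  have mp : m `^ (p - 1) * m = m `^ p.
    move: m0; rewrite le_eqVlt => /predU1P[<-|m0]; first by rewrite mulr0 powR0// gt_eqF.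
    by rewrite -[X in _ * X](powRr1 (ltW m0)) -powRD ?subrK// (gt_eqF m0) implybT.
  have le1 : m `^ p - z `^ p <= p * m `^ (p - 1) * (m - z).
    by rewrite mulrBr -mulrA mp; move: tan; rewrite [z * _]mulrC mulrA; lra.
  have [mz|/ltW zm] := lerP m z.
    rewrite (le_trans le1)// (le_trans _ (ltW e0))// mulr_ge0_le0 ?subr_le0//.
    by rewrite mulr_ge0 ?powR_ge0// ltW.
  have mz0 : 0 <= m - z by rewrite subr_ge0.
  rewrite (le_trans le1)// (@le_trans _ _ (p * (a + 1) `^ (p - 1) * (m - z)))//.
    rewrite ler_wpM2r// ler_pM2l//; apply: ge0_ler_powR; rewrite ?nnegrE ?subr_ge0 ?(ltW p1)//.
    by rewrite addr_ge0.
  by rewrite -ler_pdivlMl// mulrC ltW// (le_lt_trans (ler_norm _))// E.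
have a1 : a <= a + 1 by rewrite lerDl.
by rewrite ler_norml -[- e <= _]opprK lerNl opprB !key// distrC.
Qed.

Lemma near_value zeta s e : 0 < e -> \forall eta \near zeta, enorm (eta s - zeta s) < e.
Proof.
move=> e0; have := @proj_continuous R (fun=> 'rV[R]_d) s zeta.
move=> /(enorm_cvgP (F := nbhs zeta) (fun eta => eta s) (zeta s)).1 /(_ e e0).
by apply: filterS => eta; rewrite enormB.
Qed.

(** Paths carry the topology of pointwise convergence, and a family energy depends continuously on
    finitely many values. Taken over all families, this is the lower semicontinuity of the
    energy. *)
Lemma near_family_energy zeta s e : 0 < e ->
  \forall eta \near zeta, family_energy p zeta s <= family_energy p eta s + e.
Proof.
elim: s e => [|[a b] s IH] e e0.
  apply: filterS (near_value zeta 0 ltr01) => eta _.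
  by rewrite !family_energy_nil add0r ltW.
have e20 : 0 < e / 2 by rewrite divr_gt0.
have e30 : 0 < e / 2 / ((b - a) `^ (1 - p) + 1) by rewrite divr_gt0// ltr_wpDl// powR_ge0.
have [delta delta0 H] := powR_close (enorm_ge0 (zeta b - zeta a)) e30.
have d20 : 0 < delta / 2 by rewrite divr_gt0.
apply: filterS3 (IH _ e20) (near_value zeta a d20) (near_value zeta b d20) => eta h1 h2 h3.
apply: family_energy_cons_le h1 _; apply: itv_energy_le_close => //.
by apply: H; [exact: enorm_ge0|exact: increment_close].
Qed.

Variable t : R.
Hypotheses (t0 : 0 <= t) (tT : t <= T).

(** Paths are translated to end at [0], so that the set over which the action is minimized does not
    depend on the parameter [x]. *)
Definition pinned : set (R -> 'rV[R]_d) :=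
  [set zeta | [/\ clamped t zeta, zeta t = 0 & ACp p t zeta]].

Definition shifted_action x zeta : R := real_action p V g t (fun s => zeta s + x).

(** Bounds on all family energies pass to pointwise limits directly, and they imply the class [ACp]
    and the bound on the energy. *)
Let bounded (C : R) : set (R -> 'rV[R]_d) := [set zeta | [/\ clamped t zeta, zeta t = 0 &
  forall s, itv_family t s -> family_energy p zeta s <= C]].

Let bounded_pinned C zeta : bounded C zeta -> pinned zeta /\ energy p t zeta <= C.
Proof. by move=> [cz z0 Hz]; have [] := energy_bound_energy p1 t0 cz Hz. Qed.

Let closure_near (A : set (R -> 'rV[R]_d)) zeta : closure A zeta ->
  forall P : set (R -> 'rV[R]_d), (\forall eta \near zeta, P eta) -> exists2 eta, A eta & P eta.
Proof. by move=> clA P nP; have [eta [Aeta Peta]] := clA _ nP; exists eta. Qed.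

Let eq_of_close (v w : 'rV[R]_d) : (forall e, 0 < e -> enorm (v - w) <= e) -> v = w.
Proof.
move=> H; apply/subr0_eq/enorm_eq0/le_anti.
rewrite enorm_ge0 andbT; apply/ler_addgt0Pr => e e0; rewrite add0r; exact: H.
Qed.

Let bounded_closure (A : set (R -> 'rV[R]_d)) C : A `<=` bounded C -> closure A `<=` bounded C.
Proof.
move=> AC zeta /closure_near clz; split.
- move=> s; apply: eq_of_close => e e0; have e20 : 0 < e / 2 by rewrite divr_gt0.
  have [eta /AC[ce _ _] [h1 h2]] := clz _ (filterI (near_value zeta s e20) (near_value zeta (clamp t s) e20)).
  rewrite (le_trans (enorm_triangle (eta s) _ _))// [leRHS]splitr lerD// ltW//.
  by rewrite enormB -ce.
- apply: eq_of_close => e e0; have [eta /AC[_ ce _] h1] := clz _ (near_value zeta t e0).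
  by rewrite ltW// -ce enormB.
- move=> s fs; apply/ler_addgt0Pr => e e0.
  have [eta /AC[_ _ ce] h1] := clz _ (near_family_energy zeta s e0).
  by rewrite (le_trans h1)// lerD2r ce.
Qed.

Let bounded_increment C : 0 <= C -> forall e, 0 < e -> exists2 delta : R, 0 < delta &
  forall zeta a b, bounded C zeta -> `|b - a| < delta -> enorm (zeta b - zeta a) <= e.
Proof.
move=> C0 e e0; have e20 : 0 < e / 2 by rewrite divr_gt0.
have [M M0 Me] := powR_small p1 C0 e20.
exists (e / 2 / M); first by rewrite divr_gt0.
move=> zeta a b [cz _ Hz]; wlog ab : a b / a <= b => [H ba|].
  by have [/H|/ltW /H] := leP a b; [exact|rewrite enormB; apply; rewrite distrC].
rewrite ger0_norm ?subr_ge0// => ba.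
rewrite (le_trans (energy_bound_increment p1 t0 cz Hz M0 ab))// [leRHS]splitr lerD//.
by rewrite mulrC -ler_pdivlMr// ltW.
Qed.

(* The paths of bounded energy are equicontinuous, so that closeness at finitely
   many times gives uniform closeness. *)
Let near_uniform C zeta e : 0 <= C -> bounded C zeta -> 0 < e ->
  \forall eta \near zeta, bounded C eta -> forall s, 0 <= s <= t -> enorm (eta s - zeta s) < e.
Proof.
move=> C0 Bz e0; have e40 : 0 < e / 4 by rewrite divr_gt0.
have [delta delta0 H] := bounded_increment C0 e40.
pose n := Num.truncn (t / delta).
pose node (i : 'I_n.+1) : R := i%:R * delta.
have : \forall eta \near zeta, forall i : 'I_n.+1, enorm (eta (node i) - zeta (node i)) < e / 4.
  by apply: (@filter_forall _ _ _ (nbhs zeta) (nbhs_filter zeta)) => i; exact: near_value.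
apply: filterS => eta Hn Beta s /andP[s0 st].
have i0 : (Num.truncn (s / delta) < n.+1)%N.
  by rewrite ltnS /n; apply: le_truncn; rewrite ler_pM2r ?invr_gt0.
pose i : 'I_n.+1 := Ordinal i0.
have /andP[i1 i2] := truncn_itv (divr_ge0 s0 (ltW delta0)).
have si : `|s - node i| < delta.
  rewrite /node/= ger0_norm; last by rewrite subr_ge0 -ler_pdivlMr.
  by rewrite ltrBlDl -[X in _ + X]mul1r -mulrDl natr1 -ltr_pdivrMr.
have h1 := H eta _ _ Beta si; have h2 := H zeta _ _ Bz si; have h3 := Hn i.
apply: (@le_lt_trans _ _ (e / 4 + (e / 4 + e / 4))); last by lra.
rewrite (le_trans (enorm_triangle (eta (node i)) _ _))// lerD//.
rewrite (le_trans (enorm_triangle (zeta (node i)) _ _))//; apply: lerD; first exact: ltW.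
by rewrite enormB.
Qed.

Let near_potential C x zeta e : 0 <= C -> bounded C zeta -> 0 < e ->
  \forall eta \near zeta, bounded C eta ->
  `|potential_cost V t (fun s => eta s + x) - potential_cost V t (fun s => zeta s + x)| <= e.
Proof.
move=> C0 Bz e0; have [[cz zt az] _] := bounded_pinned Bz.
have az' := ACp_shift x az.
have [rho Hrho] := ACp_bounded p1 t0 az'.
have te0 : 0 < e / (t + 1) by rewrite divr_gt0// ltr_wpDl.
have [delta delta0 H] := potential_cost_close p1 cV rho te0.
apply: filterS (near_uniform C0 Bz delta0) => eta Hu Beta.
have [[_ _ ae] _] := bounded_pinned Beta.
apply: (@le_trans _ _ (t * (e / (t + 1)))).
  apply: (H t _ _ t0 az' (ACp_shift x ae)) => s st; split; first exact: Hrho.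
  by rewrite opprD addrACA subrr addr0; exact: Hu.
by rewrite mulrCA ler_piMr ?(ltW e0)// ler_pdivrMr ?ltr_wpDl// mul1r lerDl.
Qed.

Let sublevel x c := [set zeta | pinned zeta /\ shifted_action x zeta <= c].

Let sublevel_bounded x c : exists2 C, 0 <= C & sublevel x c `<=` bounded C.
Proof.
have [C0 C00 HC] := action_coercive p1 cV K0 L0 T0 VK gL KT.
pose C := 2 * p * (c + C0 * (1 + enorm x `^ p)).
exists (Num.max 0 C); first by rewrite le_max lexx.
move=> zeta [[cz zt az] Hz]; split => // s fs.
apply: le_trans (ACp_family_energy_le p1 az fs) _; rewrite le_max; apply/orP; right.
have := HC t _ _ (ACp_shift x az); rewrite t0 tT energy_shift zt add0r => /(_ isT) h.
have p20 : 0 < 2 * p by rewrite mulr_gt0.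
rewrite -(ler_pM2l (x := (2 * p)^-1)) ?invr_gt0// /C mulKf ?gt_eqF//.
by rewrite (le_trans h)// lerD2r.
Qed.

(** Sublevels have bounded energy by coercivity, so pointwise closeness is uniform and both [g] and
    the potential pass to the limit. The inequality for the action is then read as a bound on the
    energy, which is checked on families. *)
Lemma sublevel_closed x c : closed [set zeta | pinned zeta /\ shifted_action x zeta <= c].
Proof.
have [C C0 sC] := sublevel_bounded x c => zeta clz.
have Bz := bounded_closure sC clz; have [[cz zt az] _] := bounded_pinned Bz.
split => //; rewrite /shifted_action /real_action energy_shift.
set P := potential_cost V t _; set G := g _.
suff [_ E] : ACp p t zeta /\ energy p t zeta <= p * (c - G + P).
  rewrite -ler_pdivrMl// in E; move: E; move: (p^-1 * _) => q; lra.
apply: energy_bound_energy => // s fs; apply/ler_addgt0Pr => e e0.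
(* Three errors: one from the family energy, one from [g] and one from the potential, each amounting
   to [p * e']. *)
pose e' := e / p / 3; have e'0 : 0 < e' by rewrite !divr_gt0.
have pe : p * e' * 3 = e by rewrite /e'; field; rewrite gt_eqF.
have Le0 : 0 < e' / (L + 1) by rewrite divr_gt0// ltr_wpDl.
have pe0 : 0 < p * e' by rewrite mulr_gt0.
have [eta [Seta Heta] [h1 [h2 h3]]] := closure_near clz
  (filterI (near_family_energy zeta s pe0) (filterI (near_value zeta 0 Le0) (near_potential x C0 Bz e'0))).
have Beta := sC _ (conj Seta Heta).
have /ler_normlP[_ h3'] := h3 Beta.
have [_ _ ae] := Seta.
have h4 := ACp_family_energy_le p1 ae fs.
have h5 : `|g (eta 0 + x) - G| <= e'.
  rewrite (le_trans (gL _ _))// opprD addrACA subrr addr0.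
  rewrite (le_trans (ler_wpM2l L0 (ltW h2)))// mulrCA ler_piMr ?(ltW e'0)//.
  by rewrite ler_pdivrMr ?ltr_wpDl// mul1r lerDl.
have /ler_normlP[h5' _] := h5.
move: Heta; rewrite /shifted_action /real_action energy_shift => Heta.
have Hen : energy p t eta <= p * (c - g (eta 0 + x) + potential_cost V t (fun s => eta s + x)).
  by rewrite -ler_pdivrMl//; move: Heta; rewrite lerBlDr -lerBrDl addrAC.
apply: le_trans h1 _; rewrite -pe.
have h6 : p * (c - g (eta 0 + x) + potential_cost V t (fun s => eta s + x)) <=
    p * (c - G + P + e' * 2).
  by rewrite ler_pM2l//; move: h3' h5'; rewrite -/P; move: (g _) (potential_cost _ _ _) => *; lra.
have := le_trans h4 (le_trans Hen h6).
rewrite mulrDr; move: (p * (_ + P)) (family_energy _ _ _) => q1 q2; lra.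
Qed.

(** The bound on the energy confines every value to one ball, and a product of balls is compact by
    Tychonoff's theorem. *)
Lemma sublevel_compact x c : compact [set zeta | pinned zeta /\ shifted_action x zeta <= c].
Proof.
have [C C0 sC] := sublevel_bounded x c.
pose rho := 1 + t `^ (p - 1) * C.
have cA : compact [set zeta : R -> 'rV[R]_d | forall s, enorm (zeta s) <= rho].
  by apply: (@tychonoff R (fun=> 'rV[R]_d) (fun=> [set v | enorm v <= rho])) => s; exact: enorm_ball_compact.
apply: (subclosed_compact (@sublevel_closed x c) cA) => zeta Sz s.
have [[cz zt az] eC] := bounded_pinned (sC _ Sz).
rewrite -cz (le_trans (enorm_le_powR p1 _))// lerD2l.
have /andP[s0 st] := clamp_itv s t0.
have := ACp_increment p1 az s0 st (lexx t); rewrite zt sub0r enormN => /le_trans; apply.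
by rewrite ler_wpM2l ?powR_ge0.
Qed.

(** The coordinates at rational times, enumerated; they determine a continuous path. A number that
    encodes no pair gives the constant [0]. *)
Let coordinates (j : nat) (zeta : R -> 'rV[R]_d) : R :=
  if unpickle j is Some qi then zeta (ratr (qi : rat * 'I_d).1) ord0 qi.2 else 0.

Let coordinates_continuous j : continuous (coordinates j).
Proof.
move=> zeta; apply/(@cvgrPdist_lt _ _ _ (nbhs zeta)) => e e0; rewrite /coordinates.
case: unpickle => [[q i]|] /=.
  apply: filterS (near_value zeta (ratr q) e0) => eta; apply: le_lt_trans.
  by have := coord_le_enorm (eta (ratr q) - zeta (ratr q)) i; rewrite !mxE distrC.
by apply: filterS (near_value zeta 0 e0) => eta _; rewrite subrr normr0.
Qed.

(** The action is minimized before the coordinates at rational times. The values of the latter at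
    the selected path are Borel in [x]. *)
Lemma measurable_selection : exists zeta : 'rV[R]_d -> R -> 'rV[R]_d,
  [/\ forall x, pinned (zeta x),
      forall x eta, pinned eta -> shifted_action x (zeta x) <= shifted_action x eta &
      forall (q : rat) i, measurable_fun setT (fun x : borelRd R d => zeta x (ratr q) ord0 i)].
Proof.
pose F j x eta := if j is j'.+1 then coordinates j' eta else shifted_action x eta.
have D0 : pinned !=set0.
  exists (fun=> 0); split => //; exact: (ACp_cst p1 0 t0).1.
have [C0 C00 HC] := action_coercive p1 cV K0 L0 T0 VK gL KT.
have lb x : exists m, forall eta, pinned eta -> m <= F 0%N x eta.
  exists (- (C0 * (1 + enorm x `^ p))) => eta [cz zt az] /=.
  have := HC t _ _ (ACp_shift x az); rewrite t0 tT zt add0r => /(_ isT).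
  have : 0 <= (2 * p)^-1 * energy p t (fun s => eta s + x).
    by rewrite mulr_ge0 ?energy_ge0// invr_ge0 mulr_ge0// ltW.
  by move=> h1 /(le_trans h1); rewrite /shifted_action -lerBlDr sub0r.
have cF j x : continuous (F j.+1 x) by exact: coordinates_continuous.
have oF j eta c : pinned eta -> open [set x | F j x eta < c].
  move=> [cz zt az]; case: j => [|j]; last first.
    rewrite /F; have [h|h] := boolP (coordinates j eta < c).
      by rewrite (_ : [set _ | _] = setT); [exact: openT|apply/seteqP; split].
    by rewrite (_ : [set _ | _] = set0); [exact: open0|apply/seteqP; split].
  apply: enorm_open => x /= Fx; pose e := (c - shifted_action x eta) / 2.
  have e0 : 0 < e by rewrite divr_gt0// subr_gt0.
  have [delta delta0 H] := real_action_shift_close p1 cV L0 gL x t0 az e0.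
  exists delta => // y /H /ler_normlP[_]; rewrite -/(shifted_action _ _) -/(shifted_action x eta).
  by move: Fx; rewrite /e; move: (shifted_action _ _) (shifted_action _ _) => *; lra.
have [v [mv Hv]] := @lexicographic_selection R d (forall _ : R, 'rV[R]_d) pinned (fun=> 0) F D0 lb (fun x c => @sublevel_compact x c)
  (fun x c => @sublevel_closed x c) cF oF.
have /choice[zeta Hz] x : exists z, pinned z /\
    ((forall z', pinned z' -> F 0%N x z <= F 0%N x z') /\ forall j, F j x z = v j x).
  by have [z Dz Hz] := Hv x; exists z.
exists zeta; split=> [x|x eta peta|q i].
- exact: (Hz x).1.
- exact: (Hz x).2.1.
- apply: eq_measurable_fun (mv (pickle (q, i)).+1) => x _.
  by rewrite -(Hz x).2.2 /F /coordinates pickleK.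
Qed.

End path_compactness.

(** * A Borel family of minimizing paths *)

Section minimizing_paths.
Context {R : realType} {d : nat} (p : R) (V g : 'rV[R]_d -> R) (K L T : R).
Implicit Types (x : 'rV[R]_d).
Hypotheses (p1 : 1 < p) (cV : continuous V) (K0 : 0 < K) (L0 : 0 <= L) (T0 : 0 < T).
Hypothesis VK : forall x, `|V x| <= K * (1 + enorm x `^ p).
Hypothesis gL : forall x y, `|g x - g y| <= L * enorm (x - y).
Hypothesis KT : K * 2 `^ p * T `^ p <= (4 * p)^-1.
Variable t : R.
Hypotheses (t0 : 0 <= t) (tT : t <= T).
Let p0 : 0 < p. Proof. exact: lt_trans p1. Qed.

Lemma measurable_rational_times (i : 'I_d) (zeta : 'rV[R]_d -> R -> 'rV[R]_d) s :
  (forall x, continuous (zeta x)) ->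
  (forall q : rat, measurable_fun setT (fun x : borelRd R d => zeta x (ratr q) ord0 i)) ->
  measurable_fun setT (fun x : borelRd R d => zeta x s ord0 i).
Proof.
move=> cz mz; have /choice[q Hq] (n : nat) : exists q : rat, s < ratr q < s + n.+1%:R^-1.
  have [|q] := @rat_in_itvoo R s (s + n.+1%:R^-1); first by rewrite ltrDl invr_gt0.
  by rewrite in_itv/=; exists q.
apply: (measurable_fun_cvg (h := fun n (x : borelRd R d) => zeta x (ratr (q n)) ord0 i)) => // x _.
have qs : ratr (q n) @[n --> \oo] --> s.
  apply/cvgrPdist_lt => e e0; near=> n.
  have /andP[q1 q2] := Hq n; rewrite distrC gtr0_norm ?subr_gt0//.
  rewrite ltrBlDl (lt_trans q2)// ltrD2l invf_plt ?posrE//.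
  by near: n; exists (Num.bound e^-1) => // m /= em;
    rewrite (lt_le_trans (archi_boundP _))// ?invr_ge0 ?(ltW e0)// ler_nat (leq_trans em).
apply: (cvg_coord (f := fun n => zeta x (ratr (q n)))); exact: cvg_comp qs (cz x s).
Unshelve. all: by end_near. Qed.

(** The selected paths are translated back to end at [x]. Continuity extends measurability from
    rational to all times, and then to the pair of variables. *)
Lemma measurable_minimizers : exists gamma : 'rV[R]_d -> R -> 'rV[R]_d,
  [/\ forall x, [/\ ACp p t (gamma x), continuous (gamma x) & gamma x t = x],
      forall x, real_action p V g t (gamma x) = uval p V g x t &
      measurable_fun setT (fun z : borelRd R d * R => gamma z.1 z.2 : borelRd R d)].
Proof.
have [zeta [Pz Hz mz]] := measurable_selection p1 cV K0 L0 T0 VK gL KT t0 tT.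
have tT' : 0 <= t <= T by rewrite t0.
have cz x : continuous (zeta x).
  have [cx _ ax] := Pz x; exact: ACp_clamped_continuous ax cx.
exists (fun x s => zeta x s + x); split => [x|x|].
- have [cx zx ax] := Pz x; split; [exact: ACp_shift| |by rewrite zx add0r].
  by move=> s; apply: cvgD; [exact: cz|exact: cvg_cst].
- have [cx zx ax] := Pz x; apply/le_anti/andP; split; last first.
    by apply: (uval_le p1 cV K0 L0 T0 VK gL KT tT'); [exact: ACp_shift|rewrite zx add0r].
  apply/ler_addgt0Pr => e e0.
  have [gam [ag cg gx H]] := uval_approx p1 cV K0 L0 T0 VK gL KT x tT' e0.
  have := Hz x (fun s => gam s - x); rewrite /shifted_action.
  have -> : (fun s => gam s - x + x) = gam by apply/funext => s; rewrite subrK.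
  have Pg : pinned p t (fun s => gam s - x).
    by split; [move=> s; rewrite cg|rewrite gx subrr|exact: ACp_shift].
  by move=> /(_ Pg) /le_trans; apply; exact: ltW.
apply: (caratheodory_measurable_rV (f := fun (x : borelRd R d) s => zeta x s + x)) => [s|x].
  apply: measurable_fun_rV => i; under eq_fun do rewrite mxE.
  apply: measurable_funD; last exact: measurable_coord.
  by apply: measurable_rational_times.
by move=> s; apply: cvgD; [exact: cz|exact: cvg_cst].
Qed.

End minimizing_paths.

(** * Upper bound *)

Section interval_fubini.
Context dX (X : measurableType dX) {R : realType} (mu : probability X R) (a b : R).
Local Notation leb := (@lebesgue_measure R).
Variable F : X * R -> R.
Hypothesis mF : measurable_fun setT F.

Let cut (z : X * R) : R := F z * \1_`[a, b] z.2.

Let mcut : measurable_fun setT cut.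
Proof.
apply: measurable_funM => //; apply: measurableT_comp measurable_snd.
exact: measurable_indic.
Qed.

Let integral_cut x : (\int[leb]_(s in `[a, b]) (F (x, s))%:E = \int[leb]_s (cut (x, s))%:E)%E.
Proof.
rewrite integral_mkcond; apply: eq_integral => s _.
by rewrite patchE /cut indicE; case: ifP; rewrite ?mulr1 ?mulr0.
Qed.

Let cut_slice s : (\int[mu]_x (cut (x, s))%:E = (fun s => \int[mu]_x (F (x, s))%:E) \_ `[a, b] s)%E.
Proof.
rewrite patchE /cut /= indicE; case: ifP => sab.
  by apply: eq_integral => x _; rewrite mulr1.
by under eq_integral do rewrite mulr0; rewrite integral0.
Qed.

Lemma interval_tonelli : (forall z, 0 <= F z) ->
  (\int[mu]_x \int[leb]_(s in `[a, b]) (F (x, s))%:E =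
   \int[leb]_(s in `[a, b]) \int[mu]_x (F (x, s))%:E)%E.
Proof.
move=> F0; under eq_integral do rewrite integral_cut.
rewrite (fubini_tonelli (m1 := mu) (m2 := leb) (fun z => (cut z)%:E)).
- by rewrite [RHS]integral_mkcond; apply: eq_integral => s _; exact: cut_slice.
- exact/measurable_EFinP.
- by move=> z; rewrite lee_fin mulr_ge0.
Qed.

Lemma measurable_interval_integral : (forall z, 0 <= F z) ->
  measurable_fun setT (fun x => \int[leb]_(s in `[a, b]) (F (x, s))%:E)%E.
Proof.
move=> F0; under eq_fun do rewrite integral_cut.
apply: (measurable_fun_fubini_tonelli_F (m2 := leb) (fun z => (cut z)%:E)).
- exact/measurable_EFinP.
- by move=> z; rewrite lee_fin mulr_ge0.
Qed.

Lemma interval_fubini :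
  (\int[mu]_x \int[leb]_(s in `[a, b]) `|F (x, s)|%:E < +oo)%E ->
  (forall x, leb.-integrable `[a, b] (fun s => (F (x, s))%:E)) ->
  (forall s, a <= s <= b -> mu.-integrable setT (fun x => (F (x, s))%:E)) ->
  mu.-integrable setT (fun x => (\int[leb]_(s in `[a, b]) F (x, s))%:E) /\
  \int[mu]_x \int[leb]_(s in `[a, b]) F (x, s) =
  \int[leb]_(s in `[a, b]) \int[mu]_x F (x, s).
Proof.
move=> Foo iF1 iF2.
have ic : (mu \x leb)%E.-integrable setT (fun z => (cut z)%:E).
  apply/(integrable12ltyP mu leb); first exact/measurable_EFinP.
  apply: le_lt_trans Foo; rewrite le_eqVlt; apply/orP; left; apply/eqP.
  apply: eq_integral => x _; rewrite [RHS]integral_mkcond; apply: eq_integral => s _.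
  by rewrite patchE /cut indicE; case: ifP; rewrite ?mulr1 ?mulr0//= normr0.
have E x : (\int[leb]_(s in `[a, b]) F (x, s))%:E = (\int[leb]_s (cut (x, s))%:E)%E.
  by rewrite -integral_cut /Rintegral fineK//; exact: integrable_fin_num (iF1 x).
split.
  by have := integrable_fubini_F ic; apply: eq_integrable.
rewrite /Rintegral; congr fine.
under eq_integral do rewrite fineK ?(integrable_fin_num _ (iF1 _))// integral_cut.
rewrite (Fubini ic) [RHS]integral_mkcond; apply: eq_integral => s _.
rewrite cut_slice !patchE; case: ifPn => //; rewrite inE/= in_itv/= => sab.
by rewrite fineK//; exact: integrable_fin_num (iF2 _ sab).
Qed.

End interval_fubini.

Lemma measurable_slice_integral dX (X : measurableType dX) {R : realType}
    (mu : probability X R) (F : X * R -> R) :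
  measurable_fun setT F -> (forall z, 0 <= F z) ->
  measurable_fun setT (fun s => \int[mu]_x (F (x, s))%:E)%E.
Proof.
move=> mF F0; apply: (measurable_fun_fubini_tonelli_G (m1 := mu) (fun z => (F z)%:E)).
  exact/measurable_EFinP.
by move=> z; rewrite lee_fin.
Qed.

(** * Transport of a measure along a measurable family of paths *)

Section flow.
Context {R : realType} {d : nat} (p t C : R).
Local Notation leb := (@lebesgue_measure R).
Local Notation prob := (probability (borelRd R d) R).
Implicit Types (x : 'rV[R]_d).
Hypothesis p1 : 1 < p.
Let p0 : 0 < p. Proof. exact: lt_trans p1. Qed.
Variable gamma : 'rV[R]_d -> R -> 'rV[R]_d.
Hypothesis ag : forall x, ACp p t (gamma x).
Hypothesis cg : forall x, continuous (gamma x).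
Hypothesis gt : forall x, gamma x t = x.
Hypothesis mg : measurable_fun setT (fun z : borelRd R d * R => gamma z.1 z.2 : borelRd R d).
Hypothesis gC : forall x, energy p t (gamma x) <= C * (1 + enorm x `^ p).
Variable mu : prob.
Hypothesis Mmu : Mp p mu.

Lemma measurable_slice s : measurable_fun setT (fun x : borelRd R d => gamma x s : borelRd R d).
Proof. exact: (measurable_fun_pair1 s mg). Qed.

Let speed (z : borelRd R d * R) : R := enorm (derive1 (gamma z.1) z.2).

Let measurable_speed : measurable_fun setT speed.
Proof.
apply: measurableT_comp measurable_enorm _.
exact: (measurable_derive1 (f := fun x : borelRd R d => gamma x) measurable_slice cg).
Qed.

Let measurable_speed_pow : measurable_fun setT (fun z => speed z `^ p).
Proof. exact: measurableT_comp (measurable_powR _) measurable_speed. Qed.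

Let speed_pow_ge0 z : 0 <= speed z `^ p. Proof. exact: powR_ge0. Qed.

Let mean_energy s : \bar R := (\int[mu]_x (speed (x, s) `^ p)%:E)%E.

Let mean_energy_ge0 s : (0 <= mean_energy s)%E.
Proof. by apply: integral_ge0 => x _; rewrite lee_fin. Qed.

Let measurable_mean_energy : measurable_fun setT mean_energy.
Proof. exact: (measurable_slice_integral mu measurable_speed_pow speed_pow_ge0). Qed.

Lemma measurable_flow_energy : measurable_fun setT (fun x : borelRd R d => energy p t (gamma x)).
Proof.
have := measurable_interval_integral 0 t measurable_speed_pow speed_pow_ge0.
by move=> /(measurableT_comp (@fine_measurable R _ measurableT)).
Qed.

Lemma integrable_flow_energy : mu.-integrable setT (fun x => (energy p t (gamma x))%:E).
Proof.
apply: (Mp_integrable (C := C) Mmu); first exact: measurable_flow_energy.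
by move=> x; rewrite ger0_norm ?energy_ge0.
Qed.

Lemma integral_mean_energy :
  (\int[leb]_(s in `[0%R, t]) mean_energy s = (\int[mu]_x energy p t (gamma x))%:E)%E.
Proof.
rewrite -(interval_tonelli mu 0 t measurable_speed_pow)//.
rewrite [in RHS]/Rintegral fineK; last exact: integrable_fin_num integrable_flow_energy.
by apply: eq_integral => x _; rewrite -path_energy_fin.
Qed.

(** The norm of the velocity in [L^p(mu)]. Where this norm is infinite [fine] returns [0], which
    concerns a null set of times in [[0, t]]. *)
Definition mean_speed s : R := fine (\int[mu]_x (enorm (derive1 (gamma x) s) `^ p)%:E)%E `^ p^-1.

Let mean_speedX_le s : ((mean_speed s `^ p)%:E <= mean_energy s)%E.
Proof.
rewrite /mean_speed -powRrM mulVf ?gt_eqF// powRr1; last by apply: fine_ge0; exact: mean_energy_ge0.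
by have := mean_energy_ge0 s; rewrite /mean_energy/speed/=; case: (\int[mu]_x _)%E => //= _; rewrite leey.
Qed.

Let measurable_mean_speed : measurable_fun setT mean_speed.
Proof.
apply: measurableT_comp (measurable_powR _) _.
exact: measurableT_comp measurable_mean_energy.
Qed.

Lemma mean_speed_Lp : Lp_on p t mean_speed.
Proof.
split; first exact: measurable_funTS.
apply: (@le_lt_trans _ _ (\int[leb]_(s in `[0%R, t]) mean_energy s)%E); last first.
  by rewrite integral_mean_energy ltry.
apply: ge0_le_integral => //.
- apply/measurable_EFinP; apply: measurableT_comp (measurable_powR _) _.
  by apply: measurableT_comp => //; exact: measurable_funTS.
- exact: measurable_funTS.
by move=> s _; rewrite ger0_norm ?powR_ge0// mean_speedX_le.
Qed.

Lemma mean_speed_energy :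
  \int[leb]_(s in `[0, t]) (`|mean_speed s| `^ p) <= \int[mu]_x energy p t (gamma x).
Proof.
have iL := Lp_integrable mean_speed_Lp.
rewrite -lee_fin -integral_mean_energy /Rintegral fineK ?(integrable_fin_num _ iL)//.
apply: ge0_le_integral => //.
- exact: measurable_int iL.
- exact: measurable_funTS.
by move=> s _; rewrite ger0_norm ?powR_ge0// mean_speedX_le.
Qed.

Let ae_mean_speedX : {ae leb, forall s, 0 <= s <= t -> (mean_speed s `^ p)%:E = mean_energy s}.
Proof.
have ime : leb.-integrable `[0, t] mean_energy.
  apply/integrableP; split; first exact: measurable_funTS.
  by under eq_integral do rewrite gee0_abs//; rewrite integral_mean_energy ltry.
have := @integrable_ae _ _ _ leb _ (measurable_itv `[0, t]) _ ime.
apply: (@filterS _ _ (@ae_lebesgue_filter R)) => s H st.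
rewrite /mean_speed -powRrM mulVf ?gt_eqF// powRr1; last by apply: fine_ge0; exact: mean_energy_ge0.
by rewrite fineK//; apply: H; rewrite /= in_itv.
Qed.

Definition flow s : prob := image_probability (measurable_slice s) mu.

Lemma flow_moment s : 0 <= s <= t -> Mp p (flow s).
Proof.
move=> /andP[s0 st]; rewrite /Mp ge0_integral_image/=; last 2 first.
- by apply/measurable_EFinP; exact: measurable_enorm_powR.
- by move=> x; rewrite lee_fin powR_ge0.
have := integrable_flow_energy; have := Mp_integrable1 Mmu => i1 i2.
have [i3 _] := @Rintegral_lin _ _ _ mu _ _ _ (2 `^ p) (2 `^ p * t `^ (p - 1)) measurableT i1 i2.
have [_] := integrableP _ _ _ i3; apply: le_lt_trans; apply: ge0_le_integral => //.
- by move=> x _; rewrite lee_fin powR_ge0.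
- apply/measurable_EFinP; apply: measurableT_comp (measurable_enorm_powR p) _.
  exact: measurable_slice.
- apply: measurableT_comp => //; exact: measurable_int i3.
move=> x _ /=; rewrite lee_fin (le_trans _ (ler_norm _))//.
have := ACp_increment p1 (ag x) s0 st (lexx _); rewrite gt => H.
have -> : gamma x s = x - (x - gamma x s) by rewrite subKr.
apply: (@le_trans _ _ ((enorm x + enorm (x - gamma x s)) `^ p)).
  apply: ge0_ler_powR; rewrite ?nnegrE ?(ltW p0) ?enorm_ge0 ?addr_ge0 ?enorm_ge0//.
  by rewrite -(enormN (x - gamma x s)); exact: enormD.
apply: le_trans (powRD_le p1 (enorm_ge0 x) (enorm_ge0 (x - gamma x s))) _.
rewrite -mulrA -mulrDr ler_wpM2l ?powR_ge0// lerD//.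
by rewrite lerDr.
Qed.

Let measurable_slices a b : measurable_fun setT
  (fun x : borelRd R d => (gamma x a : borelRd R d, gamma x b : borelRd R d)).
Proof. exact: measurable_fun_pair (measurable_slice a) (measurable_slice b). Qed.

Lemma flow_coupling a b : coupling (flow a) (flow b) (image_probability (measurable_slices a b) mu).
Proof.
split => A mA; rewrite [LHS]image_probabilityE [RHS]image_probabilityE;
  by congr (mu _); apply/seteqP; split => x //= [].
Qed.

Lemma flow_transport_cost a b : transport_cost p (image_probability (measurable_slices a b) mu) =
  (\int[mu]_x (enorm (gamma x a - gamma x b) `^ p)%:E)%E.
Proof.
rewrite /transport_cost ge0_integral_image//=; last by move=> z; rewrite lee_fin powR_ge0.
apply/measurable_EFinP; apply: measurableT_comp (measurable_powR _) _.
exact: measurable_displacement.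
Qed.

Let mean_speed_ge0 s : 0 <= mean_speed s. Proof. exact: powR_ge0. Qed.

(* Minkowski's integral inequality, through Jensen's inequality with weight [w];
   adding [e] keeps the weight positive. *)
Let flow_wasserstein_approx a b e : 0 <= a -> a < b -> b <= t -> 0 < e ->
  (wasserstein p (flow a) (flow b) <=
   (\int[leb]_(s in `[a, b]) mean_speed s + e * (b - a))%:E)%E.
Proof.
move=> a0 ab bt e0; have ba0 : 0 < b - a by rewrite subr_gt0.
pose w s := mean_speed s + e; set W := \int[leb]_(s in _) _ + _.
have w0 s : 0 < w s by rewrite ltr_wpDl.
have mw : measurable_fun setT w by exact: measurable_funD.
have ims : leb.-integrable `[a, b] (EFin \o mean_speed).
  apply: integrableS (Lp_integrable1 p1 mean_speed_Lp) => //.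
  by move=> s /=; rewrite !in_itv/= => /andP[as_ sb]; rewrite (le_trans a0)// (le_trans sb).
have ie : leb.-integrable `[a, b] (EFin \o (fun=> e)).
  apply: continuous_compact_integrable; first exact: segment_compact.
  by apply: continuous_subspaceT; exact: cst_continuous.
have WE : (\int[leb]_(s in `[a, b]) (w s)%:E = W%:E)%E.
  have iw : leb.-integrable `[a, b] (EFin \o w).
    have := @integrableD _ _ _ leb _ (measurable_itv `[a, b]) _ _ ims ie.
    by apply: eq_integrable.
  rewrite -[LHS]fineK; last exact: integrable_fin_num iw.
  congr (_%:E); rewrite /W -[LHS]/(\int[leb]_(s in `[a, b]) (mean_speed s + e)) RintegralD//.
  congr (_ + _); rewrite /Rintegral integral_cst//= lebesgue_measure_itv/= lte_fin ab.
  by rewrite -EFinB -EFinM.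
have W0 : 0 < W.
  by rewrite ltr_wpDl ?mulr_gt0//; apply: Rintegral_ge0 => s _; exact: mean_speed_ge0.
apply: (wasserstein_le p1 (ltW W0) (flow_coupling a b)); rewrite flow_transport_cost.
pose F (z : borelRd R d * R) := w z.2 `^ (1 - p) * speed z `^ p.
have mF : measurable_fun setT F.
  apply: measurable_funM measurable_speed_pow; apply: measurableT_comp (measurable_powR _) _.
  exact: measurableT_comp mw measurable_snd.
have F0 z : 0 <= F z by rewrite mulr_ge0 ?powR_ge0.
have mI := measurable_interval_integral a b mF F0.
apply: (@le_trans _ _ (\int[mu]_x ((W `^ (p - 1))%:E * \int[leb]_(s in `[a, b]) (F (x, s))%:E))%E).
  apply: ge0_le_integral => //.
  - by move=> x _; rewrite lee_fin powR_ge0.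
  - apply/measurable_EFinP; apply: measurableT_comp (measurable_powR _) _.
    exact: measurableT_comp measurable_displacement (measurable_slices a b).
  - exact: measurable_funeM.
  move=> x _; have [ac mx _] := ag x.
  have msx : measurable_fun `[a, b] (fun s => speed (x, s)).
    by apply: measurable_funTS; exact: measurable_fun_pair2 measurable_speed.
  have := @weighted_jensen _ _ p1 _ _ leb _ _ _ _ (measurable_itv `[a, b]) msx (measurable_funTS mw) _ _ W0 WE.
  move=> /(_ (fun s _ => enorm_ge0 _) (fun s _ => w0 s)); apply: le_trans.
  rewrite -poweR_EFin; apply: gt0_ler_poweR; rewrite ?(ltW p0)// ?in_itv/= ?leey ?andbT ?lee_fin ?enorm_ge0//.
    by apply: integral_ge0 => s _; rewrite lee_fin enorm_ge0.
  by rewrite enormB; exact: path_increment_le ac mx a0 (ltW ab) bt.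
rewrite ge0_integralZl ?lee_fin ?powR_ge0//; last first.
  by move=> x _; apply: integral_ge0 => s _; rewrite lee_fin.
rewrite (interval_tonelli mu a b mF F0).
(* For almost every time, the average over [mu] of the integrand is [w^(1 - p)] times
   [mean_speed^p], hence at most [w], whose integral is [W]. *)
apply: (@le_trans _ _ ((W `^ (p - 1))%:E * \int[leb]_(s in `[a, b]) (w s)%:E)%E); last first.
  rewrite WE -EFinM lee_fin -[X in _ * X](powRr1 (ltW W0)) -powRD ?subrK//.
  by rewrite (gt_eqF W0) implybT.
apply: lee_wpmul2l; first by rewrite lee_fin powR_ge0.
have E s : (\int[mu]_x (F (x, s))%:E = (w s `^ (1 - p))%:E * mean_energy s)%E.
  rewrite /F /mean_energy/=; under eq_integral do rewrite EFinM.
  rewrite ge0_integralZl ?lee_fin ?powR_ge0//.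
    by apply/measurable_EFinP; exact: (measurable_fun_pair1 s measurable_speed_pow).
  by move=> x _; rewrite lee_fin.
apply: ae_ge0_le_integral => //.
- by move=> s _; apply: integral_ge0 => x _; rewrite lee_fin.
- apply: measurable_funTS; exact: (measurable_slice_integral mu mF F0).
- by move=> s _; rewrite lee_fin ltW.
- by apply/measurable_EFinP; exact: measurable_funTS.
have := ae_mean_speedX; apply: (@filterS _ _ (@ae_lebesgue_filter R)) => s H.
rewrite /= in_itv/= => /andP[as_ sb]; rewrite E -H ?(le_trans a0)//=; last exact: le_trans bt.
rewrite -EFinM lee_fin (@le_trans _ _ (w s `^ (1 - p) * w s `^ p))//.
  rewrite ler_wpM2l ?powR_ge0//; apply: ge0_ler_powR; rewrite ?nnegrE ?(ltW p0) ?(ltW (w0 s))//.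
  by rewrite lerDl ltW.
by rewrite -powRD ?(gt_eqF (w0 s)) ?implybT// subrK powRr1// ltW.
Qed.

Lemma flow_speed_bound : speed_bound p t flow mean_speed.
Proof.
split => [|a b a0 ab bt]; first exact: mean_speed_Lp.
move: ab; rewrite le_eqVlt => /predU1P[<-|ab].
  apply: (@le_trans _ _ (0%R)%:E); last by apply: integral_ge0 => s _; rewrite lee_fin mean_speed_ge0.
  apply: (wasserstein_le p1 (lexx _) (flow_coupling a a)); rewrite flow_transport_cost.
  under eq_integral do rewrite subrr enorm0 powR0 ?(gt_eqF p0)//.
  by rewrite integral0 lee_fin powR_ge0.
have ba0 : 0 < b - a by rewrite subr_gt0.
have ims : leb.-integrable `[a, b] (EFin \o mean_speed).
  apply: integrableS (Lp_integrable1 p1 mean_speed_Lp) => //.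
  by move=> s /=; rewrite !in_itv/= => /andP[as_ sb]; rewrite (le_trans a0)// (le_trans sb).
apply/lee_addgt0Pr => e e0; rewrite -[X in (_ <= X + _)%E]fineK; last exact: integrable_fin_num ims.
have := flow_wasserstein_approx a0 ab bt (divr_gt0 e0 ba0).
by rewrite divfK ?gt_eqF.
Qed.

Lemma flow_ACp : ACp_Mp p t flow.
Proof. by split; [exact: flow_moment|exists mean_speed; exact: flow_speed_bound]. Qed.

Lemma flow_end : same_measure (flow t) mu.
Proof.
move=> A mA; rewrite [LHS]image_probabilityE; congr (mu _).
by apply/seteqP; split => x /=; rewrite gt.
Qed.

Lemma integrable_flow s (f : 'rV[R]_d -> R) :
  (flow s).-integrable setT (fun x : borelRd R d => (f x)%:E) ->
  mu.-integrable setT (fun x => (f (gamma x s))%:E) /\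
  \int[flow s]_x f x = \int[mu]_x f (gamma x s).
Proof.
move=> iF; have mf := measurable_int _ iF.
have mfg : measurable_fun setT (fun x : borelRd R d => (f (gamma x s))%:E).
  exact: measurableT_comp mf (measurable_slice s).
split.
  apply/integrableP; split => //.
  have [_] := integrableP _ _ _ iF; apply: le_lt_trans.
  rewrite (ge0_integral_image (measurable_slice s) mu (h := fun x => `|(f x)%:E|%E))//.
  exact: measurableT_comp.
rewrite /Rintegral; congr fine; rewrite integralE [RHS]integralE.
rewrite (ge0_integral_image (measurable_slice s) mu (measurable_funepos mf))//.
rewrite (ge0_integral_image (measurable_slice s) mu (measurable_funeneg mf))//.
pose k (x : borelRd R d) : borelRd R d := gamma x s.
by rewrite (funepos_comp (fun x : borelRd R d => (f x)%:E) k) (funeneg_comp (fun x : borelRd R d => (f x)%:E) k).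
Qed.

End flow.

(** * Action of the flow along minimizers *)

Section upper_bound.
Context {R : realType} {d : nat} (p : R) (V g : 'rV[R]_d -> R) (K L T : R).
Local Notation leb := (@lebesgue_measure R).
Local Notation prob := (probability (borelRd R d) R).
Implicit Types (x : 'rV[R]_d).
Hypotheses (p1 : 1 < p) (cV : continuous V) (K0 : 0 < K) (L0 : 0 <= L) (T0 : 0 < T).
Hypothesis VK : forall x, `|V x| <= K * (1 + enorm x `^ p).
Hypothesis gL : forall x y, `|g x - g y| <= L * enorm (x - y).
Hypothesis KT : K * 2 `^ p * T `^ p <= (4 * p)^-1.
Hypothesis cg : continuous g.
Variable t : R.
Hypotheses (t0 : 0 <= t) (tT : t <= T).
Let p0 : 0 < p. Proof. exact: lt_trans p1. Qed.
Let tT' : 0 <= t <= T. Proof. by rewrite t0. Qed.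

Lemma value_fin_uval x : value p g V x t = (uval p V g x t)%:E.
Proof. by have [C _ /(_ x t tT')[]] := value_fin p1 cV K0 L0 T0 VK gL KT. Qed.

Variable gamma : 'rV[R]_d -> R -> 'rV[R]_d.
Hypothesis Pgamma : forall x, [/\ ACp p t (gamma x), continuous (gamma x) & gamma x t = x].
Hypothesis gamma_min : forall x, real_action p V g t (gamma x) = uval p V g x t.
Hypothesis mg : measurable_fun setT (fun z : borelRd R d * R => gamma z.1 z.2 : borelRd R d).

Let ag x : ACp p t (gamma x). Proof. by case: (Pgamma x). Qed.
Let cgam x : continuous (gamma x). Proof. by case: (Pgamma x). Qed.
Let gt x : gamma x t = x. Proof. by case: (Pgamma x). Qed.

Lemma minimizer_energy_le : exists C, forall x, energy p t (gamma x) <= C * (1 + enorm x `^ p).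
Proof.
have [C C0 HC] := action_coercive p1 cV K0 L0 T0 VK gL KT.
have [C' C'0 HC'] := value_fin p1 cV K0 L0 T0 VK gL KT.
have pp : 0 < 2 * p by rewrite mulr_gt0.
exists (2 * p * (C' + C)) => x; rewrite -mulrA -ler_pdivrMl//.
have := HC t (gamma x) tT' (ag x); rewrite gt gamma_min => /le_trans; apply.
rewrite mulrDl lerD2r; have [_] := HC' x t tT'; exact/le_trans/ler_norm.
Qed.

Variable mu : prob.
Hypothesis Mmu : Mp p mu.
Local Notation sigma := (flow mg mu).

(** By minimality the metric derivative is at most the mean speed almost everywhere, so the kinetic
    part is at most the mean of the energies. Fubini's theorem exchanges time and space in the
    potential part, and the sum becomes the integral of the actions of the minimizers. *)
Lemma minimizer_flow_action :
  ACp_Mp p t sigma /\ (action_Mp p g V t sigma <= (\int[mu]_x uval p V g x t)%:E)%E.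
Proof.
have [C gC] := minimizer_energy_le.
have acs : ACp_Mp p t sigma := flow_ACp p1 ag cgam gt mg gC Mmu.
split => //; rewrite (action_MpE p1 cV K0 L0 VK gL cg t0 acs) lee_fin.
have Ms := acs.1; have M0 : Mp p (sigma 0) by apply: Ms; rewrite lexx.
have sb : speed_bound p t sigma (mean_speed p gamma mu) := flow_speed_bound p1 ag cgam mg gC Mmu.
have [smd mdmin] := metric_derivativeP p1 t0 sb.
set md := metric_derivative p t sigma in smd mdmin *.
have iE := integrable_flow_energy cgam mg gC Mmu.
have kin : \int[leb]_(r in `[0, t]) (`|md r| `^ p) <= \int[mu]_x energy p t (gamma x).
  apply: le_trans (mean_speed_energy p1 ag cgam mg gC Mmu).
  apply: ae_le_Rintegral => //; [exact: Lp_integrable smd.1|exact: Lp_integrable sb.1|].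
  have := mdmin _ sb; have := speed_bound_ae_ge0 p1 smd.
  apply: (@filterS2 _ _ (@ae_lebesgue_filter R)) => r md0 mdle; rewrite /= in_itv/= => rt.
  have mr0 := md0 rt; apply: ge0_ler_powR; rewrite ?nnegrE ?(ltW p0)//.
  by rewrite !ger0_norm ?mdle// (le_trans mr0 (mdle rt)).
have [ig gE] := integrable_flow (integrable_initial p1 L0 gL cg M0).
have cnV : continuous (fun x => `|V x|).
  by move=> x; apply: continuous_comp; [exact: cV|exact: norm_continuous].
have nVK x : `| `|V x| | <= K * (1 + enorm x `^ p) by rewrite normr_id.
pose F (z : borelRd R d * R) := V (gamma z.1 z.2).
have mF : measurable_fun setT F := measurableT_comp (continuous_measurable_rV cV) mg.
have mnF : measurable_fun setT (fun z => `|F z|) by exact: measurableT_comp.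
have iV s : 0 <= s <= t -> mu.-integrable setT (fun x => (V (gamma x s))%:E) /\
    \int[sigma s]_x V x = \int[mu]_x V (gamma x s).
  by move=> st; apply: integrable_flow; exact: (integrable_potential cV VK (Ms s st)).
have inV s : 0 <= s <= t -> mu.-integrable setT (fun x => (`|V (gamma x s)|)%:E) /\
    \int[sigma s]_x `|V x| = \int[mu]_x `|V (gamma x s)|.
  move=> st; apply: (integrable_flow (f := fun x => `|V x|)).
  exact: (integrable_potential cnV nVK (Ms s st)).
(* Absolute integrability comes from the regularity in time of the means of [|V|], which is
   continuous with the same growth as [V]. *)
have Foo : (\int[mu]_x \int[leb]_(s in `[0%R, t]) `|F (x, s)|%:E < +oo)%E.
  rewrite (interval_tonelli mu 0 t mnF)//.
  have inV' := potential_path_integrable p1 cnV K0 nVK t0 Ms sb (lexx 0) (lexx t).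
  have [_] := integrableP _ _ _ inV'; apply: le_lt_trans.
  rewrite le_eqVlt; apply/orP; left; apply/eqP; apply: eq_integral => s; rewrite inE/= in_itv/= => st.
  have [i1 E1] := inV s st.
  rewrite E1 ger0_norm; last by apply: Rintegral_ge0.
  by rewrite /Rintegral fineK//; exact: integrable_fin_num i1.
have iF1 x : leb.-integrable `[0, t] (fun s => (F (x, s))%:E) by exact: (ACp_integrable p1 cV t0 (ag x)).
have [iP PE] := interval_fubini mF Foo iF1 (fun s st => (iV s st).1).
have -> : \int[leb]_(r in `[0, t]) (\int[sigma r]_x V x) = \int[mu]_x potential_cost V t (gamma x).
  rewrite -[RHS]/(\int[mu]_x \int[leb]_(s in `[0, t]) F (x, s)) PE.
  by apply: eq_Rintegral => r; rewrite inE/= in_itv/= => /iV[].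
have [i1 E1] := @Rintegral_lin _ _ _ mu _ _ _ 1 p^-1 measurableT ig iE.
have [i2 E2] := @Rintegral_lin _ _ _ mu _ _ _ 1 (-1) measurableT i1 iP.
have -> : \int[mu]_x uval p V g x t =
    \int[mu]_x g (gamma x 0) + p^-1 * \int[mu]_x energy p t (gamma x) - \int[mu]_x potential_cost V t (gamma x).
  rewrite -[X in X + _ * _]mul1r -E1 -[X in X - _]mul1r -mulN1r -E2.
  apply: eq_Rintegral => x _; rewrite -gamma_min /real_action !mul1r mulN1r //.
by rewrite gE lerD2r lerD2l ler_wpM2l ?invr_ge0 ?(ltW p0).
Qed.

End upper_bound.

(** * The horizon and the conclusion *)

Lemma exists_horizon {R : realType} (p K : R) : 1 < p -> 0 < K ->
  exists2 T : R, 0 < T & K * 2 `^ p * T `^ p <= (4 * p)^-1.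
Proof.
move=> p1 K0; have p0 : 0 < p by exact: lt_trans p1.
have c0 : 0 < K * 2 `^ p by rewrite mulr_gt0// powR_gt0.
have b0 : 0 < (4 * p)^-1 / (K * 2 `^ p) by rewrite divr_gt0// invr_gt0 mulr_gt0.
(* The time at which the smallness condition holds with equality. *)
exists (((4 * p)^-1 / (K * 2 `^ p)) `^ p^-1); first exact: powR_gt0.
by rewrite -powRrM mulVf ?gt_eqF// powRr1 ?(ltW b0)// mulrC divfK// gt_eqF.
Qed.

Theorem theorem1p2 (R : realType) (d : nat) (p : R) (V : 'rV[R]_d -> R)
    (p_gt1 : 1 < p) (V_cont : continuous V) (V_lb : has_lbound (range V))
    (V_bigO : bigO_power p V) :
  exists2 T : R, 0 < T &
  forall g : 'rV[R]_d -> R, continuous g -> lipschitz_continuous g ->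
    (forall (mu : probability (borelRd R d) R) (t : R),
        Mp p mu -> 0 <= t < T ->
        mu.-integrable setT (fun x => value p g V x t) /\
        value_Mp p g V mu t = (\int[mu]_x value p g V x t)%E) /\
    (forall t : R, 0 < t < T ->
      exists Psi : (borelRd R d * R)%type -> borelRd R d,
        [/\ measurable_fun ([set: borelRd R d] `*` `[0, t]) Psi,
            forall x : 'rV[R]_d, minimizer p g V x t (fun s => Psi (x, s)) &
            forall mu : probability (borelRd R d) R, Mp p mu ->
              exists2 sigma : R -> probability (borelRd R d) R,
                forall s : R, 0 <= s <= t ->
                  same_measure (sigma s) (pushforward mu (fun x => Psi (x, s))) &
                minimizing_path p g V mu t sigma]).
Proof.
have [K K0 VK] := bigO_power_bound V_cont V_bigO.
have [T T0 KT] := exists_horizon p_gt1 K0.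
(* [T] is fixed before [g] is introduced. The given Lipschitz constant may be negative in dimension
   [0], hence the absolute value. *)
exists T => // g cg [L' gL']; pose L := `|L'|.
have L0 : 0 <= L by exact: normr_ge0.
have gL x y : `|g x - g y| <= L * enorm (x - y).
  by rewrite (le_trans (gL' x y))// ler_wpM2r ?enorm_ge0// ler_norm.
have vE t : 0 <= t <= T -> forall x, value p g V x t = (uval p V g x t)%:E.
  by move=> /andP[t0 tT] x; exact: value_fin_uval p_gt1 V_cont K0 L0 T0 VK gL KT _ t0 tT x.
have iu t (mu : probability (borelRd R d) R) : 0 <= t <= T -> Mp p mu ->
    mu.-integrable setT (fun x : borelRd R d => (uval p V g x t)%:E).
  by move=> tT Mmu; exact: integrable_uval p_gt1 V_cont K0 L0 T0 VK gL KT _ _ Mmu tT.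
have lower t mu : 0 <= t <= T -> Mp p mu ->
    ((\int[mu]_x uval p V g x t)%:E <= value_Mp p g V mu t)%E.
  move=> tT Mmu; case/andP: (tT) => t0 tT'.
  apply: le_ereal_inf_tmp => _ [sigma [acs st] <-].
  have -> : \int[mu]_x uval p V g x t = \int[sigma t]_x uval p V g x t.
    rewrite /Rintegral; congr fine; apply: eq_measure_integral => A mA _; exact/esym/st.
  exact: (action_Mp_ge p_gt1 V_cont K0 L0 T0 VK gL KT cg t0 tT' acs).
(* The measurability proof [mg] is part of the witness, because [flow] is built from it; the same
   family of paths serves every [mu]. *)
have main t : 0 <= t <= T -> exists gamma : 'rV[R]_d -> R -> 'rV[R]_d,
    [/\ forall x, [/\ ACp p t (gamma x), continuous (gamma x) & gamma x t = x],
        forall x, real_action p V g t (gamma x) = uval p V g x t &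
        exists2 mg : measurable_fun setT
          (fun z : borelRd R d * R => gamma z.1 z.2 : borelRd R d),
        forall mu, Mp p mu -> minimizing_path p g V mu t (flow mg mu) &
        forall mu, Mp p mu -> value_Mp p g V mu t = (\int[mu]_x uval p V g x t)%:E].
  move=> tT; case/andP: (tT) => t0 tT'.
  have [gamma [Pg Hg mg]] := measurable_minimizers p_gt1 V_cont K0 L0 T0 VK gL KT t0 tT'.
  have adm mu : Mp p mu -> admissible_Mp p mu t (flow mg mu) /\
      (action_Mp p g V t (flow mg mu) <= (\int[mu]_x uval p V g x t)%:E)%E.
    move=> Mmu; have [acs up] :=
      minimizer_flow_action p_gt1 V_cont K0 L0 T0 VK gL KT cg t0 tT' Pg Hg mg Mmu.
    by split => //; split => //; apply: flow_end => x; case: (Pg x).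
  have vle mu : Mp p mu -> (value_Mp p g V mu t <= action_Mp p g V t (flow mg mu))%E.
    by move=> /adm[am _]; apply: ereal_inf_lbound; exists (flow mg mu).
  exists gamma; split => //; exists mg => mu Mmu; have [am up] := adm _ Mmu.
    split => //; apply/le_anti; rewrite vle// andbT.
    exact: le_trans up (lower _ _ tT Mmu).
  by apply/le_anti; rewrite lower// andbT (le_trans (vle _ Mmu)).
split=> [mu t Mmu /andP[t0 /ltW tT]|t /andP[/ltW t0 /ltW tT]].
  have tT' : 0 <= t <= T by rewrite t0.
  under eq_fun do rewrite vE//; split; first exact: iu.
  have [_ [_ _ [_ _ /(_ _ Mmu) ->]]] := main t tT'.
  by rewrite /Rintegral fineK//; exact: integrable_fin_num (iu _ _ tT' Mmu).
have tT' : 0 <= t <= T by rewrite t0.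
have [gamma [Pg Hg [mg Hmin _]]] := main t tT'.
exists (fun z => gamma z.1 z.2); split => [|x|mu Mmu]; first exact: measurable_funTS.
  have [ag _ gt] := Pg x; split => //.
  by rewrite vE// -Hg; exact: actionE.
exists (flow mg mu); last exact: Hmin.
by move=> s _ A mA; rewrite [LHS]image_probabilityE.
Qed.
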